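(* Let $h>0$ and let $S_W$ be the space of tempered distributions $F$ on $\mathbb{R}^{2n}$ such that the function $$(\mathcal V_WF)(X,Y)=(\pi h)^{-n}\int_{\mathbb{R}^{2n}}F(T)\,e^{-\frac1h|X-T|^2-\frac{2i}hY\cdot(X-T)}\,dT$$ (the integral denoting the duality bracket) is continuous on $\mathbb{R}^{2n}\times\mathbb{R}^{2n}$ and satisfies $$|(\mathcal V_WF)(X,Y)|\le\psi(Y)\quad\text{for all }X,Y,$$ for some function $\psi\in L^1(\mathbb{R}^{2n})\cap L^\infty(\mathbb{R}^{2n})$. Then, for all $F\in S_W$, $F\star\nu_h^{\rm Weyl}$ belongs to $D_h(\mathbb{R}^{2n})$, and for some constant $C>0$, $$\|F\star\nu_h^{\rm Weyl}\|_{D_h(\mathbb{R}^{2n})}\le C\big(\|\psi\|_{L^1(\mathbb{R}^{2n})}+\|\psi\|_{L^\infty(\mathbb{R}^{2n})}\big).$$ Consequently, for every $F\in S_W$ the operator ${\rm Op}_h^{\rm Weyl}(F)$ can be defined by $${\rm Op}_h^{\rm Weyl}(F)=(2\pi h)^{-2n}\int_{\mathbb{R}^{4n}}\Pi_{Xh}\,(F\star\nu_h^{\rm Weyl})^{\rm ext}(Y,X)\,\Pi_{Yh}\,dX\,dY,$$ as a bounded operator in $L^2(\mathbb{R}^n)$.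
   Context: The measure $\nu_h^{\rm Weyl}$ on $\mathbb{R}^{2n}$ is $d\nu_h^{\rm Weyl}(X)=(\pi h)^{-n}e^{-\frac1h|X|^2}dX$. For $X=(x,\xi)\in\mathbb{R}^{2n}$, $\Psi_{Xh}(u)=(\pi h)^{-n/4}e^{-\frac{|u-x|^2}{2h}}e^{\frac ihu\cdot\xi-\frac i{2h}x\cdot\xi}$, and $\Pi_{Xh}f=\langle f,\Psi_{Xh}\rangle\Psi_{Xh}$ (scalar product of $L^2(\mathbb{R}^n)$ linear in the first variable). Operator-valued integrals are weak integrals. $D_h(\mathbb{R}^{2n})$ is the set of functions $F:\mathbb{R}^{2n}\to\mathbb{C}$ for which there is a real-analytic function $F^{\rm ext}(X,Y)$ on $\mathbb{R}^{2n}\times\mathbb{R}^{2n}$ (the sesqui-holomorphic extension; unique) such that, with $X=(x,\xi)$, $Y=(y,\eta)$: (1) $(\partial_{x_j}+i\partial_{\xi_j})F^{\rm ext}=0$ and $(\partial_{y_j}-i\partial_{\eta_j})F^{\rm ext}=0$ for $1\le j\le n$; (2) $F^{\rm ext}(X,X)=F(X)$; (3) there is $\psi_F\in L^1(\mathbb{R}^{2n})\cap L^\infty(\mathbb{R}^{2n})$ with $|F^{\rm ext}(X,Y)|\le e^{\frac1{4h}|X-Y|^2}\psi_F(X-Y)$. The norm is $\|F\|_{D_h}=\|\psi_F\|_{L^1}+\|\psi_F\|_{L^\infty}$, with $\psi_F$ the least admissible function $\psi_F(V)=\sup_{X-Y=V}|F^{\rm ext}(X,Y)|e^{-|V|^2/(4h)}$.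 *)

(* Defs.v *)
From HB Require Import structures.
From mathcomp Require Import all_boot all_order all_algebra.
From mathcomp Require Import all_classical all_reals all_analysis.
From mathcomp Require Import complex.

Set Implicit Arguments.
Unset Strict Implicit.
Unset Printing Implicit Defensive.

Import Order.TTheory GRing.Theory Num.Theory.
Import numFieldNormedType.Exports.

Local Open Scope classical_set_scope.
Local Open Scope ring_scope.

Local Notation Re := complex.Re.
Local Notation Im := complex.Im.

Section measurable_rV.
Context {R : realType}.
Variable d : nat.

Let coors : 'I_d -> 'rV[R]_d -> R := fun i x => x ord0 i.

Let rV_set0 : g_sigma_preimage coors set0.
Proof. exact: sigma_algebra0. Qed.

Let rV_setC A : g_sigma_preimage coors A -> g_sigma_preimage coors (~` A).
Proof. exact: sigma_algebraC. Qed.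

Let rV_bigcup (F : _^nat) : (forall i, g_sigma_preimage coors (F i)) ->
  g_sigma_preimage coors (\bigcup_i (F i)).
Proof. exact: sigma_algebra_bigcup. Qed.

(* R^d is ['rV[R]_d], with the sigma-algebra generated by the coordinates, as for [d.-tuple]; it is
   its Borel sigma-algebra. *)
HB.instance Definition _ := @isMeasurable.Build default_measure_display
  'rV[R]_d (g_sigma_preimage coors) rV_set0 rV_setC rV_bigcup.

Lemma measurable_coord_rV (i : 'I_d) :
  measurable_fun [set: 'rV[R]_d] (fun x : 'rV[R]_d => x ord0 i).
Proof.
move=> _ Y mY; rewrite setTI; apply: sub_sigma_algebra => /=.
rewrite -bigcup_seq/=; exists i => /=; first by rewrite mem_index_enum.
by exists Y => //; rewrite setTI.
Qed.

Lemma measurable_fun_rVP d1 (T1 : measurableType d1) (f : T1 -> 'rV[R]_d) :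
  (forall i, measurable_fun [set: T1] (fun x => f x ord0 i)) ->
  measurable_fun [set: T1] f.
Proof.
move=> mf _ A mA; rewrite setTI.
have : (g_sigma_preimage coors) A by [].
rewrite /g_sigma_preimage => gA.
pose S := [set B : set 'rV[R]_d | measurable (f @^-1` B)].
suff : S A by [].
apply: gA; split.
- split => /=.
  + by rewrite /S /= preimage_set0; exact: measurable0.
  + by move=> B SB; rewrite /S /= setTD preimage_setC; exact: measurableC.
  + by move=> F SF; rewrite /S /= preimage_bigcup; exact: bigcupT_measurable.
- rewrite -bigcup_seq => B [i _ [C mC <-]].
  by rewrite /S /= setTI -comp_preimage -[X in measurable X]setTI; exact: mf.
Qed.

End measurable_rV.

Section lebesgue_rV.
Context {R : realType}.

Definition rV_cons d (p : R * 'rV[R]_d) : 'rV[R]_d.+1 :=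
  row_mx (const_mx p.1 : 'rV[R]_1) p.2.

Definition rV_uncons d (x : 'rV[R]_d.+1) : R * 'rV[R]_d :=
  (x ord0 ord0, \row_j x ord0 (lift ord0 j)).

Lemma rV_cons0 d (p : R * 'rV[R]_d) : rV_cons p ord0 ord0 = p.1.
Proof.
have -> : (ord0 : 'I_d.+1) = @lshift 1 d ord0 by exact/val_inj.
by rewrite /rV_cons (@row_mxEl _ _ 1 d) mxE.
Qed.

Lemma rV_consS d (p : R * 'rV[R]_d) j : rV_cons p ord0 (lift ord0 j) = p.2 ord0 j.
Proof.
have -> : lift ord0 j = @rshift 1 d j by exact/val_inj.
by rewrite /rV_cons (@row_mxEr _ _ 1 d).
Qed.

Lemma rV_consK d : cancel (@rV_cons d) (@rV_uncons d).
Proof.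
move=> p; rewrite /rV_uncons rV_cons0 [RHS]surjective_pairing; congr pair.
by apply/rowP => j; rewrite mxE rV_consS.
Qed.

Lemma measurable_rV_cons d : measurable_fun setT (@rV_cons d).
Proof.
apply: measurable_fun_rVP => i; case: (unliftP ord0 i) => [j|] ->.
- under eq_fun do rewrite rV_consS.
  exact: (measurableT_comp (measurable_coord_rV j) measurable_snd).
- by under eq_fun do rewrite rV_cons0; exact: measurable_fst.
Qed.

Lemma measurable_rV_uncons d : measurable_fun setT (@rV_uncons d).
Proof.
apply: measurable_fun_pair; first exact: measurable_coord_rV.
apply: measurable_fun_rVP => i.
by under eq_fun do rewrite mxE; exact: measurable_coord_rV.
Qed.

Section step.
Variables (d : nat) (m : {sigma_finite_measure set 'rV[R]_d -> \bar R}).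

Definition lebesgue_rV_step : set 'rV[R]_d.+1 -> \bar R :=
  pushforward (lebesgue_measure \x m)%E (@rV_cons d).

Let mcons : measurable_fun setT (@rV_cons d) := @measurable_rV_cons d.

Let step0 : lebesgue_rV_step set0 = 0%E. Proof. exact: measure0. Qed.

Let step_ge0 A : (0 <= lebesgue_rV_step A)%E. Proof. exact: measure_ge0. Qed.

Let step_sigma_additive : semi_sigma_additive lebesgue_rV_step.
Proof. exact: measure_semi_sigma_additive. Qed.

HB.instance Definition _ := isMeasure.Build _ _ _ lebesgue_rV_step
  step0 step_ge0 step_sigma_additive.

Let step_sigma_finite : sigma_finite setT lebesgue_rV_step.
Proof.
have /sigma_finiteP[F [TF ndF Foo]] := sigma_finiteT (@lebesgue_measure R).
have /sigma_finiteP[G [TG ndG Goo]] := sigma_finiteT m.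
exists (fun k => @rV_uncons d @^-1` (F k `*` G k)).
  apply/seteqP; split => // x _.
  have [k _ Fk] : (\bigcup_k F k) (rV_uncons x).1 by rewrite -TF.
  have [l _ Gl] : (\bigcup_k G k) (rV_uncons x).2 by rewrite -TG.
  exists (maxn k l) => //; split.
    by move: Fk; exact/subsetPset/ndF/leq_maxl.
  by move: Gl; exact/subsetPset/ndG/leq_maxr.
move=> k; have [mF Fk] := Foo k; have [mG Gk] := Goo k.
split.
  rewrite -[X in measurable X]setTI; apply: measurable_rV_uncons => //.
  exact: measurableX.
rewrite /lebesgue_rV_step /pushforward -comp_preimage.
rewrite (_ : @rV_uncons d \o @rV_cons d = id); last first.
  by apply/funext => p /=; rewrite rV_consK.
by rewrite preimage_id product_measure1E// lte_mul_pinfty// ge0_fin_numE.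
Qed.

HB.instance Definition _ := Measure_isSigmaFinite.Build _ _ _ lebesgue_rV_step
  step_sigma_finite.

End step.

Fixpoint lebesgue_rV d : {sigma_finite_measure set 'rV[R]_d -> \bar R} :=
  match d with
  | 0 => \d_(0 : 'rV[R]_0)
  | d'.+1 => lebesgue_rV_step (lebesgue_rV d')
  end.

Lemma lebesgue_rV_box d (A : 'I_d -> set R) :
  (forall i, measurable (A i)) ->
  lebesgue_rV d [set x : 'rV[R]_d | forall i, A i (x ord0 i)] =
  (\prod_(i < d) lebesgue_measure (A i))%E.
Proof.
elim: d A => [A _|d IH A mA].
  rewrite big_ord0 /= (_ : [set x | _] = setT) ?diracT//.
  by apply/seteqP; split => // x _ [].
have E : @rV_cons d @^-1` [set x : 'rV[R]_d.+1 | forall i, A i (x ord0 i)] =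
    A ord0 `*` [set x : 'rV[R]_d | forall i, A (lift ord0 i) (x ord0 i)].
  apply/seteqP; split => [[t v] /= Atv|[t v] /= [At Av] i].
    split=> [|i]; first by have := Atv ord0; rewrite rV_cons0.
    by have := Atv (lift ord0 i); rewrite rV_consS.
  by case: (unliftP ord0 i) => [j|] ->; rewrite ?rV_cons0 ?rV_consS.
rewrite big_ord_recl -(IH (fun i => A (lift ord0 i)))//.
have mB : measurable [set x : 'rV[R]_d | forall i, A (lift ord0 i) (x ord0 i)].
  have -> : [set x : 'rV[R]_d | forall i, A (lift ord0 i) (x ord0 i)] =
      \bigcap_(i in [set: 'I_d])
        ((fun x : 'rV[R]_d => x ord0 i) @^-1` A (lift ord0 i)).
    by apply/seteqP; split => [x Ax i _|x Ax i]; [exact: Ax|exact: Ax].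
  apply: fin_bigcap_measurable => // i _.
  by rewrite -[X in measurable X]setTI; apply: measurable_coord_rV.
rewrite /= /lebesgue_rV_step /pushforward E.
exact: (@product_measure1E _ _ _ _ R (@lebesgue_measure R) (lebesgue_rV d) _ _
  (mA ord0) mB).
Qed.

End lebesgue_rV.

Section complex_valued.
Context {R : realType}.
Local Open Scope complex_scope.

Definition cexp (z : R[i]) : R[i] :=
  (expR (Re z))%:C * (cos (Im z) +i* sin (Im z)).

Definition ccontinuous (T : topologicalType) (f : T -> R[i]) : Prop :=
  continuous (fun x => Re (f x)) /\ continuous (fun x => Im (f x)).

Section integral.
Context d (T : measurableType d) (mu : {measure set T -> \bar R}).
Implicit Type f : T -> R[i].

Definition cmeasurable f : Prop :=
  measurable_fun setT (fun x => Re (f x)) /\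
  measurable_fun setT (fun x => Im (f x)).

Definition cintegrable f : Prop :=
  mu.-integrable setT (fun x => (Re (f x))%:E) /\
  mu.-integrable setT (fun x => (Im (f x))%:E).

Definition cintegral f : R[i] :=
  (\int[mu]_x Re (f x)) +i* (\int[mu]_x Im (f x)).

End integral.
End complex_valued.

Section calculus.
Context {R : realType} {d : nat}.
Local Open Scope complex_scope.
Implicit Types (f : 'rV[R]_d -> R[i]) (x : 'rV[R]_d) (j : 'I_d).

Definition dotp (x y : 'rV[R]_d) : R := \sum_i x ord0 i * y ord0 i.
Definition sqnorm x : R := dotp x x.

Definition basis_rV j : 'rV[R]_d := delta_mx ord0 j.

Definition cpartial j f x : R[i] :=
  ('D_(basis_rV j) (fun y => Re (f y)) x) +i*
  ('D_(basis_rV j) (fun y => Im (f y)) x).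

Definition cderivable j f x : Prop :=
  derivable (fun y => Re (f y)) x (basis_rV j) /\
  derivable (fun y => Im (f y)) x (basis_rV j).

Definition partials (a : seq 'I_d) f := foldr cpartial f a.

Definition smooth f : Prop := forall a,
  ccontinuous (partials a f) /\ forall j x, cderivable j (partials a f) x.

Definition monomial (a : 'I_d -> nat) x : R := \prod_j x ord0 j ^+ a j.

(* Near each point, [f] is the sum of an absolutely convergent power series;
   multi-indices are summed over the cubes {0, .., N-1}^d. *)
Definition real_analytic f : Prop := forall p : 'rV[R]_d,
  exists (c : ('I_d -> nat) -> R[i]) (r : R), 0 < r /\
    forall v : 'rV[R]_d, (forall j, `|v ord0 j| < r) ->
      (exists B : R, forall N : nat,
        \sum_(a : {ffun 'I_d -> 'I_N})
          Normc.normc (c (fun j => a j)) * `|monomial (fun j => a j) v| <= B) /\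
      (Normc.normc
         (\sum_(a : {ffun 'I_d -> 'I_N})
            c (fun j => a j) * (monomial (fun j => a j) v)%:C - f (p + v))
       @[N --> \oo] --> (0 : R)).

Definition schwartz_seminorm (N : nat) f : \bar R :=
  ereal_sup [set r : \bar R | exists (a : seq 'I_d) x, (size a <= N)%N /\
    r = ((1 + sqnorm x) ^+ N * Normc.normc (partials a f x))%:E].

Definition schwartz f : Prop :=
  smooth f /\ forall N, (schwartz_seminorm N f < +oo)%E.

(* A tempered distribution is represented by its duality bracket, as a function
   defined on all functions; only its values on Schwartz functions matter. *)
Definition tempered (F : ('rV[R]_d -> R[i]) -> R[i]) : Prop :=
  (forall (a b : R[i]) phi psi, schwartz phi -> schwartz psi ->
     F (fun x => a * phi x + b * psi x) = a * F phi + b * F psi) /\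
  (exists (N : nat) (C : R), forall phi, schwartz phi ->
     ((Normc.normc (F phi))%:E <= C%:E * schwartz_seminorm N phi)%E).

(* The convolution (F * g)(X) = <F, g(X - .)> with a Schwartz function [g]. *)
Definition dconv (F : ('rV[R]_d -> R[i]) -> R[i]) (g : 'rV[R]_d -> R[i])
    (X : 'rV[R]_d) : R[i] :=
  F (fun T => g (X - T)).

Definition in_L1_Linfty (psi : 'rV[R]_d -> R) : Prop :=
  psi \in Lfun (lebesgue_rV d) 1%E /\ psi \in Lfun (lebesgue_rV d) +oo%E.

Definition L1_Linfty_norm (psi : 'rV[R]_d -> \bar R) : \bar R :=
  ('N[lebesgue_rV d]_1[psi] + 'N[lebesgue_rV d]_+oo[psi])%E.

End calculus.

Section L2.
Context {R : realType} {n : nat}.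
Local Open Scope complex_scope.
Local Notation fn := ('rV[R]_n -> R[i]).
Implicit Types f g : fn.

Definition L2norm f : \bar R :=
  'N[lebesgue_rV n]_2%:E[(fun u => (Normc.normc (f u))%:E)].

(* Elements of L^2 are represented by functions; equality in L^2 is equality
   almost everywhere. *)
Definition in_L2 f : Prop := cmeasurable f /\ (L2norm f < +oo)%E.

Definition inner f g : R[i] :=
  cintegral (lebesgue_rV n) (fun u => f u * conjc (g u)).

Definition bounded_operator (A : fn -> fn) : Prop :=
  (forall (a b : R[i]) f g, in_L2 f -> in_L2 g ->
     {ae lebesgue_rV n, forall u,
        A (fun v => a * f v + b * g v) u = a * A f u + b * A g u}) /\
  (exists M : R, forall f, in_L2 f ->
     in_L2 (A f) /\ (L2norm (A f) <= M%:E * L2norm f)%E).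

Definition is_weak_integral d (T : measurableType d)
    (mu : {measure set T -> \bar R}) (K : T -> fn -> fn) (B : fn -> fn) : Prop :=
  forall f g, in_L2 f -> in_L2 g ->
    cintegrable mu (fun t => inner (K t f) g) /\
    inner (B f) g = cintegral mu (fun t => inner (K t f) g).

End L2.

(* A point X = (x, xi) of R^{2n} is the row vector [row_mx x xi]. *)

Section phase_space.
Context {R : realType} {n : nat}.
Local Open Scope complex_scope.
Local Notation V := 'rV[R]_(n + n).
Implicit Types (h : R) (X Y T : V) (F : V -> R[i]) (G : V -> V -> R[i]).

Definition nu_weyl_density h X : R[i] :=
  ((pi * h) ^- n * expR (- (h^-1 * sqnorm X)))%:C.

Definition coherent_state h X (u : 'rV[R]_n) : R[i] :=
  let x := lsubmx X in let xi := rsubmx X in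
  ((pi * h) `^ (- (n%:R / 4)) * expR (- (sqnorm (u - x) / (2 * h))))%:C *
  cexp (0 +i* (h^-1 * dotp u xi - (2 * h)^-1 * dotp x xi)).

Definition coherent_proj h X (f : 'rV[R]_n -> R[i]) (u : 'rV[R]_n) : R[i] :=
  inner f (coherent_state h X) * coherent_state h X u.

Definition is_sesqui_ext F G : Prop :=
  real_analytic (fun Z : 'rV[R]_((n + n) + (n + n)) => G (lsubmx Z) (rsubmx Z)) /\
  (forall X Y (j : 'I_n),
     cpartial (lshift n j) (fun X' => G X' Y) X
     + (0 +i* 1) * cpartial (rshift n j) (fun X' => G X' Y) X = 0) /\
  (forall X Y (j : 'I_n),
     cpartial (lshift n j) (fun Y' => G X Y') Y
     - (0 +i* 1) * cpartial (rshift n j) (fun Y' => G X Y') Y = 0) /\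
  (forall X, G X X = F X).

(* F^ext: the sesqui-holomorphic extension is unique when it exists; the value
   is arbitrary otherwise. *)
Definition sesqui_ext F : V -> V -> R[i] :=
  xget (fun _ _ => 0) [set G | is_sesqui_ext F G].

Definition Dh h F : Prop :=
  exists G, is_sesqui_ext F G /\
    exists psi : V -> R, in_L1_Linfty psi /\
      forall X Y, Normc.normc (G X Y)
                  <= expR ((4 * h)^-1 * sqnorm (X - Y)) * psi (X - Y).

(* The least admissible function in [Dh]. *)
Definition Dh_psi h F (W : V) : \bar R :=
  ereal_sup [set r : \bar R | exists X Y, X - Y = W /\
    r = (Normc.normc (sesqui_ext F X Y) * expR (- (sqnorm W / (4 * h))))%:E].

Definition Dh_norm h F : \bar R := L1_Linfty_norm (Dh_psi h F).

Definition V_weyl h (F : (V -> R[i]) -> R[i]) X Y : R[i] :=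
  ((pi * h) ^- n)%:C *
  F (fun T => cexp (- (h^-1 * sqnorm (X - T)) +i* - (2 / h * dotp Y (X - T)))).

Definition V_weyl_bound h (F : (V -> R[i]) -> R[i]) (psi : V -> R) : Prop :=
  forall X Y, Normc.normc (V_weyl h F X Y) <= psi Y.

Definition S_W h (F : (V -> R[i]) -> R[i]) : Prop :=
  tempered F /\
  ccontinuous (fun Z : V * V => V_weyl h F Z.1 Z.2) /\
  exists psi, in_L1_Linfty psi /\ V_weyl_bound h F psi.

(* The integration variable [p] is (X, Y), so [sesqui_ext _ p.2 p.1] is the
   extension at (Y, X). *)
Definition is_weyl_operator h (F : (V -> R[i]) -> R[i])
    (A : ('rV[R]_n -> R[i]) -> ('rV[R]_n -> R[i])) : Prop :=
  exists2 B : ('rV[R]_n -> R[i]) -> ('rV[R]_n -> R[i]),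
    is_weak_integral (lebesgue_rV (n + n) \x lebesgue_rV (n + n))%E
      (fun (p : V * V) f => coherent_proj h p.1 (fun u =>
         sesqui_ext (dconv F (nu_weyl_density h)) p.2 p.1
         * coherent_proj h p.2 f u)) B
  & A = (fun f u => ((2 * pi * h) ^- (2 * n))%:C * B f u).

End phase_space.

(* Main.v *)
Require Import Defs.
From HB Require Import structures.
From mathcomp Require Import all_boot all_order all_algebra.
From mathcomp Require Import all_classical all_reals all_analysis.
From mathcomp Require Import measurable_realfun ess_sup_inf hoelder complex.
From mathcomp Require Import ring lra.

Set Implicit Arguments.
Unset Strict Implicit.
Unset Printing Implicit Defensive.

Import Order.TTheory GRing.Theory Num.Theory.
Import numFieldNormedType.Exports.

Local Open Scope classical_set_scope.
Local Open Scope ring_scope.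
Local Open Scope complex_scope.

Local Notation Re := complex.Re.
Local Notation Im := complex.Im.
Local Notation normc := Normc.normc.

(** Identify [X = (x, xi)] with [z = x + i xi], and let [w], [s] be the complex points of [Y], [T].
   The convolution of [F] with the Gaussian measure pairs [F] with [e^{-|z - s|^2 / h}]. Writing
   [|z - s|^2] as the value at [w = z] of [z . conj w - z . conj s - conj w . s + |s|^2] produces a
   function [G(X, Y)] which is holomorphic in [z] and antiholomorphic in [w]: it is the
   sesqui-holomorphic extension ([weyl_ext], [weyl_ext_sesqui]). Completing the square,
   [|G(X, Y)| = e^{|X - Y|^2 / (4h)} |V F((X + Y) / 2, J (X - Y) / 2)|] with [J (x, xi) = (xi, -x)]
   ([normc_weyl_ext]), so that a bound [psi] for [V F] gives the profile [psi (J V / 2)], whose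
   norm is at most [4 ^ n] times that of [psi] ([Dh_norm_bound]).

   The analytic point is that [G] is real analytic although [F] is only a distribution. The functional
   [Q |-> <F, e^{-|T|^2 / h} Q>] is continuous on functions of exponential type, for which the
   remainders of the exponential series are small; expanding the exponential under the bracket gives
   the power series of [G] and its derivatives ([laplace_series], [is_cderive_laplace]), and the
   Cauchy-Riemann equations become linear relations between linear forms. As [sesqui_ext] selects an
   arbitrary extension, uniqueness is part of the proof: an extension of [0] has vanishing first
   derivatives on the diagonal, because those along [(e, e)] vanish and the Cauchy-Riemann equations
   give the others; by induction it is flat there, and analytic continuation makes it zero
   ([sesqui_ext_unique]).

   For the operator, the overlap of two coherent states has modulus [e^{-|X - Y|^2 / (4h)}]
   ([normc_overlap], a complex Gaussian integral), which cancels the growth of [G]: the kernel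
   [G(Y, X) <Psi_Y, Psi_X>] is bounded by an integrable function of [Y - X]. The transform
   [f |-> <f, Psi_X>] is bounded in [L^2] ([bessel]), so by Young's inequality the weak integral
   converges absolutely and defines a bounded sesquilinear form. The image of [f] is constructed as a
   superposition of coherent states with a square-integrable amplitude, namely as a limit of
   superpositions of truncated amplitudes ([superpose_L2], from the Riesz-Fischer argument of
   [L2_series]); linearity and the norm bound then follow by duality ([kernel_operator_bounded]). *)

(** * Complex numbers and directional derivatives *)

Section complex_modulus.
Lemma le_of_eq (R : realType) (x y : R) : x = y -> x <= y.
Proof. by move=> ->. Qed.

Context {R : realType}.
Implicit Types (z w : R[i]) (x : R).

Lemma cReD z w : Re (z + w) = Re z + Re w. Proof. by case: z; case: w. Qed.
Lemma cImD z w : Im (z + w) = Im z + Im w. Proof. by case: z; case: w. Qed.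
Lemma cReN z : Re (- z) = - Re z. Proof. by case: z. Qed.
Lemma cImN z : Im (- z) = - Im z. Proof. by case: z. Qed.
Lemma cReM z w : Re (z * w) = Re z * Re w - Im z * Im w.
Proof. by case: z; case: w. Qed.
Lemma cImM z w : Im (z * w) = Re z * Im w + Im z * Re w.
Proof. by case: z; case: w. Qed.
Lemma cRe_sum I (r : seq I) (P : pred I) (F : I -> R[i]) :
  Re (\sum_(i <- r | P i) F i) = \sum_(i <- r | P i) Re (F i).
Proof. by elim/big_rec2: _ => // i ? z _ <-; rewrite cReD. Qed.
Lemma cIm_sum I (r : seq I) (P : pred I) (F : I -> R[i]) :
  Im (\sum_(i <- r | P i) F i) = \sum_(i <- r | P i) Im (F i).
Proof. by elim/big_rec2: _ => // i ? z _ <-; rewrite cImD. Qed.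
Lemma eq_cplx z w : Re z = Re w -> Im z = Im w -> z = w.
Proof. by case: z => a b; case: w => c d /= -> ->. Qed.

Lemma normc_ge0 z : 0 <= normc z.
Proof. by case: z => a b; exact: sqrtr_ge0. Qed.
Lemma sqr_normc z : normc z ^+ 2 = Re z ^+ 2 + Im z ^+ 2.
Proof. by case: z => a b /=; rewrite sqr_sqrtr// addr_ge0// sqr_ge0. Qed.
Lemma normcM z w : normc (z * w) = normc z * normc w.
Proof. exact: Normc.normcM. Qed.
Lemma normcD z w : normc (z + w) <= normc z + normc w.
Proof. exact: le_normcD. Qed.
Lemma normcN z : normc (- z) = normc z.
Proof. by case: z => a b /=; rewrite !sqrrN. Qed.
Lemma normcB z w : normc (z - w) = normc (w - z).
Proof. by rewrite -normcN opprB. Qed.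
Lemma normcJ z : normc (conjc z) = normc z.
Proof. by case: z => a b /=; rewrite sqrrN. Qed.
Lemma normc_real x : normc x%:C = `|x|.
Proof. by rewrite /= expr0n addr0 sqrtr_sqr. Qed.
Lemma normc0 : normc (0 : R[i]) = 0.
Proof. by rewrite normc_real normr0. Qed.
Lemma normc1 : normc (1 : R[i]) = 1.
Proof. by rewrite normc_real normr1. Qed.
Lemma normcX z k : normc (z ^+ k) = normc z ^+ k.
Proof. by elim: k => [|k IH]; rewrite ?expr0 ?normc1// !exprS normcM IH. Qed.
Lemma normcV z : normc z^-1 = (normc z)^-1.
Proof. exact: Normc.normcV. Qed.
Lemma normc_sum I (r : seq I) (P : pred I) (F : I -> R[i]) :
  normc (\sum_(i <- r | P i) F i) <= \sum_(i <- r | P i) normc (F i).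
Proof.
elim/big_rec2: _ => [|i ? z _ h]; first by rewrite normc0.
by rewrite (le_trans (normcD _ _))// lerD2l.
Qed.
Lemma Re_le_normc z : `|Re z| <= normc z.
Proof.
rewrite -ler_sqr ?nnegrE ?normc_ge0// sqr_normc real_normK ?num_real//.
by rewrite lerDl sqr_ge0.
Qed.
Lemma Im_le_normc z : `|Im z| <= normc z.
Proof.
rewrite -ler_sqr ?nnegrE ?normc_ge0// sqr_normc real_normK ?num_real//.
by rewrite lerDr sqr_ge0.
Qed.
Lemma normc_le z : normc z <= `|Re z| + `|Im z|.
Proof.
rewrite -ler_sqr ?nnegrE ?normc_ge0 ?addr_ge0// sqr_normc sqrrD.
by rewrite !real_normK ?num_real// lerD2r lerDl mulrn_wge0// mulr_ge0.
Qed.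
Lemma normc_eq0 z : normc z = 0 -> z = 0.
Proof. exact: Normc.eq0_normc. Qed.
Lemma mulcJ z : z * conjc z = (normc z ^+ 2)%:C.
Proof. by rewrite sqr_normc; case: z => a b; apply: eq_cplx => /=; ring. Qed.
Lemma cexpD z w : cexp (z + w) = cexp z * cexp w.
Proof.
case: z => a b; case: w => c d; rewrite /cexp /= expRD cosD sinD.
by apply: eq_cplx => /=; ring.
Qed.
Lemma cexp0 : cexp (0 : R[i]) = 1.
Proof. by rewrite /cexp /= expR0 cos0 sin0 mul1r. Qed.
Lemma normc_cexp z : normc (cexp z) = expR (Re z).
Proof.
rewrite /cexp normcM normc_real /= ger0_norm ?expR_ge0//.
by rewrite cos2Dsin2 sqrtr1 mulr1.
Qed.
Lemma cexp_real x : cexp x%:C = (expR x)%:C.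
Proof. by rewrite /cexp /= cos0 sin0 mulr1. Qed.
Lemma cexp_bigsum I (r : seq I) (P : pred I) (F : I -> R[i]) :
  cexp (\sum_(i <- r | P i) F i) = \prod_(i <- r | P i) cexp (F i).
Proof. by elim/big_rec2: _ => [|i z y _ <-]; rewrite ?cexp0 ?cexpD. Qed.
Lemma conj_cexp z : conjc (cexp z) = cexp (conjc z).
Proof.
by case: z => a b; rewrite /cexp /= cosN sinN; apply: eq_cplx => /=; ring.
Qed.
Lemma Re_cexp z : Re (cexp z) = expR (Re z) * cos (Im z).
Proof. by case: z => a b; rewrite /cexp cReM /= mul0r subr0. Qed.
Lemma Im_cexp z : Im (cexp z) = expR (Re z) * sin (Im z).
Proof. by case: z => a b; rewrite /cexp cImM /= mul0r addr0. Qed.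

End complex_modulus.

Section complex_derivative.
Context {R : realType} {V : normedModType R}.
Implicit Types (f g : V -> R[i]) (x v : V) (L : R[i]).

(** A relation rather than an operator, so that the rules of calculus compose without
   differentiability side conditions. *)
Definition is_cderive x v f L : Prop :=
  is_derive x v (fun y => Re (f y)) (Re L) /\
  is_derive x v (fun y => Im (f y)) (Im L).

Lemma is_cderive_eq x v f L L' : is_cderive x v f L -> L = L' -> is_cderive x v f L'.
Proof. by move=> h <-. Qed.

Lemma is_cderive_ext x v f g L : is_cderive x v f L -> f =1 g -> is_cderive x v g L.
Proof. by move=> h /funext <-. Qed.

Lemma is_cderive_cst x v L : is_cderive x v (fun=> L) 0.
Proof. by split; exact: is_derive_cst. Qed.

Lemma is_cderiveD x v f g L M : is_cderive x v f L -> is_cderive x v g M ->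
  is_cderive x v (fun y => f y + g y) (L + M).
Proof.
move=> [f1 f2] [g1 g2]; split.
- rewrite cReD (_ : (fun y => _) = (fun y => Re (f y)) + (fun y => Re (g y))).
    exact: is_deriveD.
  by apply/funext => y /=; rewrite cReD.
- rewrite cImD (_ : (fun y => _) = (fun y => Im (f y)) + (fun y => Im (g y))).
    exact: is_deriveD.
  by apply/funext => y /=; rewrite cImD.
Qed.

Lemma is_cderiveM x v f g L M : is_cderive x v f L -> is_cderive x v g M ->
  is_cderive x v (fun y => f y * g y) (L * g x + f x * M).
Proof.
move=> [f1 f2] [g1 g2]; split.
- rewrite (_ : (fun y => _) = (fun y => Re (f y)) * (fun y => Re (g y)) -
     (fun y => Im (f y)) * (fun y => Im (g y))); last first.
    by apply/funext => y /=; rewrite cReM.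
  apply: is_derive_eq.
  by rewrite cReD !cReM /GRing.scale /=; ring.
- rewrite (_ : (fun y => _) = (fun y => Re (f y)) * (fun y => Im (g y)) +
     (fun y => Im (f y)) * (fun y => Re (g y))); last first.
    by apply/funext => y /=; rewrite cImM.
  apply: is_derive_eq.
  by rewrite cImD !cImM /GRing.scale /=; ring.
Qed.

Lemma is_cderiveZ x v f L c : is_cderive x v f L ->
  is_cderive x v (fun y => c * f y) (c * L).
Proof.
move=> h; apply: is_cderive_eq (is_cderiveM (is_cderive_cst x v c) h) _.
by rewrite mul0r add0r.
Qed.

Lemma is_cderiveN x v f L : is_cderive x v f L -> is_cderive x v (fun y => - f y) (- L).
Proof.
move=> h; apply: is_cderive_ext (is_cderive_eq (is_cderiveZ (-1) h) _) _.
  by rewrite mulN1r.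
by move=> y; rewrite mulN1r.
Qed.

Lemma is_cderive_sum I (r : seq I) (P : pred I) (F : I -> V -> R[i]) (L : I -> R[i]) x v :
  (forall i, P i -> is_cderive x v (F i) (L i)) ->
  is_cderive x v (fun y => \sum_(i <- r | P i) F i y) (\sum_(i <- r | P i) L i).
Proof.
move=> h; elim: r => [|i r IH].
  rewrite big_nil; apply: is_cderive_ext (is_cderive_cst _ _ 0) _ => y.
  by rewrite big_nil.
rewrite big_cons; case: ifPn => Pi; last first.
  by apply: is_cderive_ext IH _ => y; rewrite big_cons (negbTE Pi).
by apply: is_cderive_ext (is_cderiveD (h _ Pi) IH) _ => y; rewrite big_cons Pi.
Qed.

Lemma is_cderive_real x v (f : V -> R) (l : R) : is_derive x v f l ->
  is_cderive x v (fun y => (f y)%:C) l%:C.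
Proof. by move=> h; split => //=; exact: is_derive_cst. Qed.

End complex_derivative.

(** * Derivatives along lines and the exponential series *)

Section complex_derivative_line.
Context {R : realType} {V : normedModType R}.
Implicit Types (f g : V -> R[i]) (x v : V) (L : R[i]).

Lemma is_derive_line (f : V -> R) x v l :
  is_derive (0 : R) 1 (fun t : R => f (t *: v + x)) l <-> is_derive x v f l.
Proof.
have E : (fun h : R => h^-1 *: (((fun t : R => f (t *: v + x)) \o shift 0) (h *: 1) -
            f (0 *: v + x))) =
    (fun h => h^-1 *: ((f \o shift x) (h *: v) - f x)).
  by apply/funext => h /=; rewrite scale0r add0r addr0 /GRing.scale /= mulr1.
split => -[h1 h2]; split; move: h1 h2; rewrite /derivable /derive.
- by rewrite E.
- by move=> _; rewrite E.
- by rewrite E.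
- by move=> _; rewrite E.
Qed.

Lemma is_cderive_line f x v L :
  is_cderive (0 : R) 1 (fun t : R => f (t *: v + x)) L <-> is_cderive x v f L.
Proof. by split => -[h1 h2]; split; apply/is_derive_line. Qed.

Lemma is_derive_comp1 (phi : R -> R) (f : V -> R) x v (l m : R) :
  is_derive (f x) (1 : R) phi m -> is_derive x v f l ->
  is_derive x v (fun y => phi (f y)) (l * m).
Proof.
move=> h1 /is_derive_line h2; apply/is_derive_line.
have h1' : is_derive (f ((0 : R) *: v + x)) (1 : R) phi m by rewrite scale0r add0r.
have := @is_derive1_comp _ phi (fun t : R => f (t *: v + x)) _ _ _ h1' h2.
by rewrite /GRing.scale /= mulrC.
Qed.

Lemma is_cderive_cexp x v f L : is_cderive x v f L ->
  is_cderive x v (fun y => cexp (f y)) (L * cexp (f x)).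
Proof.
move=> [f1 f2]; split.
- rewrite (_ : (fun y => _) = (fun y => expR (Re (f y))) * (fun y => cos (Im (f y)))).
    have e1 := is_derive_comp1 (is_derive_expR _) f1.
    have e2 := is_derive_comp1 (is_derive_cos _) f2.
    apply: is_derive_eq; rewrite cReM Re_cexp Im_cexp /GRing.scale /=; ring.
  by apply/funext => y; rewrite Re_cexp.
- rewrite (_ : (fun y => _) = (fun y => expR (Re (f y))) * (fun y => sin (Im (f y)))).
    have e1 := is_derive_comp1 (is_derive_expR _) f1.
    have e2 := is_derive_comp1 (is_derive_sin _) f2.
    apply: is_derive_eq; rewrite cImM Re_cexp Im_cexp /GRing.scale /=; ring.
  by apply/funext => y; rewrite Im_cexp.
Qed.

(** Series and functionals are differentiated by estimating the increment, which produces a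
   quadratic remainder rather than a difference quotient. *)
Lemma is_derive_quad (f : V -> R) x v (l K rho : R) : 0 < rho ->
  (forall t : R, `|t| < rho -> `|f (t *: v + x) - f x - t * l| <= K * t ^+ 2) ->
  is_derive x v f l.
Proof.
move=> rho0 h.
suff C : (fun h : R => h^-1 *: ((f \o shift x) (h *: v) - f x)) @ 0^' --> l.
  by split; [apply/cvg_ex; exists l | apply/cvg_lim].
have K0 : 0 <= K.
  have rho2 : `|rho / 2| < rho by rewrite gtr0_norm; lra.
  have := h (rho / 2).
  move=> /(_ rho2) /(le_trans (normr_ge0 _)).
  have r2 : 0 < (rho / 2) ^+ 2 by rewrite exprn_gt0// divr_gt0.
  by rewrite (pmulr_lge0 _ r2).
apply/cvgrPdist_le => e e0; near=> t.
have t0 : t != 0 by near: t; exact: nbhs_dnbhs_neq.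
have trho : `|t| < rho.
  near: t; apply: dnbhs0_lt; exact: rho0.
have te : `|t| < e / (K + 1).
  near: t; apply: dnbhs0_lt; by rewrite divr_gt0// ltr_wpDl.
have -> : l - t^-1 *: ((f \o shift x) (t *: v) - f x) =
   - (t^-1 * (f (t *: v + x) - f x - t * l)).
  rewrite /= -[_ *: (_ - f x)]/(_ * (_ - f x)).
  by move: (f _ - f x) => A; field.
rewrite normrN normrM normfV ler_pdivrMl ?normr_gt0//.
rewrite (le_trans (h _ trho))// -(real_normK (num_real t)) expr2 mulrA mulrC.
rewrite ler_wpM2l//.
rewrite (@le_trans _ _ ((K + 1) * `|t|))//.
  by rewrite ler_wpM2r// lerDl.
by rewrite mulrC -ler_pdivlMr ?ltr_wpDl// ltW.
Unshelve. all: by end_near. Qed.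

Lemma is_cderive_quad f x v L (K rho : R) : 0 < rho ->
  (forall t : R, `|t| < rho ->
    normc (f (t *: v + x) - f x - t%:C * L) <= K * t ^+ 2) ->
  is_cderive x v f L.
Proof.
move=> rho0 h; split; apply: (is_derive_quad rho0) => t tr.
  apply: le_trans (h t tr); apply: le_trans (Re_le_normc _).
  by rewrite !cReD !cReN cReM /= mul0r subr0.
apply: le_trans (h t tr); apply: le_trans (Im_le_normc _).
by rewrite !cImD !cImN cImM /= mul0r addr0.
Qed.

End complex_derivative_line.

Section curves.
Context {R : realType}.

(** There is no mean value theorem for complex-valued curves; multiplying by the conjugate of
   [f b - f a] reduces the inequality to the monotonicity of a real function. *)
Lemma is_cderive_mean_value (f df : R -> R[i]) (phi dphi : R -> R) (a b : R) : a <= b ->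
  (forall t : R, is_cderive t 1 f (df t)) ->
  (forall t : R, is_derive t 1 phi (dphi t)) ->
  (forall t, a <= t <= b -> normc (df t) <= dphi t) ->
  normc (f b - f a) <= phi b - phi a.
Proof.
move=> ab hf hphi hle.
set al := f b - f a.
have [->|al0] := eqVneq al 0.
  rewrite normc0.
  have [] := @MVT_segment _ phi dphi a b ab (fun x _ => hphi x).
    apply: derivable_within_continuous => x _; exact: ex_derive.
  move=> c; rewrite in_itv/= => cab ->; rewrite mulr_ge0// ?subr_ge0//.
  exact: le_trans (normc_ge0 _) (hle _ cab).
pose u t := Re (conjc al * f t).
have hu (t : R) : is_derive t 1 u (Re (conjc al * df t)).
  by have [] := is_cderiveZ (conjc al) (hf t).
have hw (t : R) : is_derive t 1 (fun t => normc al * phi t - u t)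
    (normc al * dphi t - Re (conjc al * df t)).
  have -> : (fun t => normc al * phi t - u t) = (normc al \*: phi) - u.
    by apply/funext.
  by apply: is_derive_eq.
have [] := @MVT_segment _ _ _ a b ab (fun x _ => hw x).
  apply: derivable_within_continuous => x _; exact: ex_derive.
move=> c; rewrite in_itv/= => cab E.
have : 0 <= normc al * phi b - u b - (normc al * phi a - u a).
  rewrite E mulr_ge0// ?subr_ge0// (le_trans (ler_norm _))//.
  rewrite (le_trans (Re_le_normc _))// normcM normcJ ler_wpM2l ?normc_ge0//.
  exact: hle.
have -> : normc al * phi b - u b - (normc al * phi a - u a) =
   normc al * (phi b - phi a) - (u b - u a) by ring.
have -> : u b - u a = normc al ^+ 2.
  rewrite /u -cReN -cReD -mulrN -mulrDr -/al.
  by rewrite mulrC mulcJ.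
rewrite subr_ge0 expr2 ler_pM2l// lt_neqAle normc_ge0 andbT eq_sym.
by apply: contra al0 => /eqP/normc_eq0 ->.
Qed.

Definition cexp_sum k (w : R[i]) : R[i] := \sum_(l < k) w ^+ l / (l`!)%:R.
Definition cexp_tail k (w : R[i]) : R[i] := cexp w - cexp_sum k w.

Lemma is_cderive_scale (w : R[i]) (t : R) : is_cderive t 1 (fun s : R => s%:C * w) w.
Proof.
have h : is_cderive t 1 (fun s : R => s%:C) 1.
  by apply: is_cderive_real; exact: is_derive_id.
apply: is_cderive_eq (is_cderiveM h (is_cderive_cst t 1 w)) _.
by rewrite mulr0 addr0 mul1r.
Qed.

End curves.

Section power_series_terms.
Context {R : realType} {V : normedModType R}.

Definition cexp_term k (w : R[i]) : R[i] := w ^+ k / (k`!)%:R.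

Lemma is_cderiveX (f : V -> R[i]) x v L k : is_cderive x v f L ->
  is_cderive x v (fun y => f y ^+ k) (k%:R * f x ^+ k.-1 * L).
Proof.
move=> h; elim: k => [|k IH].
  apply: is_cderive_ext (is_cderive_eq (is_cderive_cst x v 1) _) _ => //.
  by rewrite !mul0r.
apply: is_cderive_ext (is_cderive_eq (is_cderiveM h IH) _) _ => //.
  case: k {IH} => [|k]; first by rewrite /= expr0; ring.
  by rewrite /= exprS -[in RHS]natr1; ring.
by move=> y; rewrite exprS.
Qed.

Lemma is_cderive_term (f : V -> R[i]) x v L k : is_cderive x v f L ->
  is_cderive x v (fun y => cexp_term k.+1 (f y)) (L * cexp_term k (f x)).
Proof.
move=> h.
apply: is_cderive_ext (is_cderive_eq (is_cderiveZ (((k.+1)`!)%:R^-1) (is_cderiveX k.+1 h)) _) _.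
  rewrite /cexp_term factS natrM invfM /=.
  have : (k.+1%:R : R[i]) != 0 by rewrite pnatr_eq0.
  have : ((k`!)%:R : R[i]) != 0 by rewrite pnatr_eq0 -lt0n fact_gt0.
  move: (k.+1%:R : R[i]) ((k`!)%:R : R[i]) => a b h1 h2.
  by field; rewrite ?h1 ?h2.
by move=> y; rewrite /cexp_term mulrC.
Qed.

Lemma cexp_term0 (w : R[i]) : cexp_term 0 w = 1.
Proof. by rewrite /cexp_term expr0 fact0 divr1. Qed.

(** The remainders form a chain under differentiation, so that bounds on their derivatives follow
   from bounds on their values. *)
Lemma is_cderive_tail (f : V -> R[i]) x v L k : is_cderive x v f L ->
  is_cderive x v (fun y => cexp_tail k.+1 (f y)) (L * cexp_tail k (f x)).
Proof.
move=> h.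
have E y : cexp_tail k.+1 (f y) =
    cexp (f y) - (1 + \sum_(l < k) cexp_term l.+1 (f y)).
  by rewrite /cexp_tail /cexp_sum big_ord_recl -/(cexp_term 0 _) cexp_term0.
apply: is_cderive_ext (fun y => esym (E y)).
apply: is_cderive_eq (is_cderiveD (is_cderive_cexp h) (is_cderiveN (is_cderiveD
   (is_cderive_cst x v 1) (is_cderive_sum (index_enum 'I_k)
     (P := xpredT) (fun i _ => is_cderive_term i h))))) _.
by rewrite add0r /cexp_tail mulrBr /cexp_sum mulr_sumr.
Qed.

End power_series_terms.

Section tail_bound.
Context {R : realType}.

(** By induction on [k], integrating the derivative of the remainder along the segment from [0]
   to [w]. *)
Lemma normc_cexp_tail k (w : R[i]) :
  normc (cexp_tail k w) <= normc w ^+ k / (k`!)%:R * expR (normc w).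
Proof.
suff H : forall t : R, 0 <= t <= 1 -> normc (cexp_tail k (t%:C * w)) <=
    (t * normc w) ^+ k / (k`!)%:R * expR (normc w).
  by have := H 1; rewrite !mul1r; apply; rewrite ler01 lexx.
elim: k => [|k IH] t /andP[t0 t1].
  rewrite expr0 fact0 divr1 mul1r /cexp_tail /cexp_sum big_ord0 subr0 normc_cexp.
  rewrite ler_expR cReM /= mul0r subr0.
  rewrite (le_trans (ler_norm _))// normrM (ger0_norm t0).
  by rewrite (le_trans _ (Re_le_normc _))// ler_piMl.
pose f s := cexp_tail k.+1 (s%:C * w).
pose df s := w * cexp_tail k (s%:C * w).
pose c := normc w ^+ k.+1 / (k.+1)`!%:R * expR (normc w).
pose phi (s : R) : R := c * s ^+ k.+1.
pose dphi (s : R) : R := c * (k.+1%:R * s ^+ k).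
have hphi (s : R) : is_derive s 1 phi (dphi s).
  have -> : phi = c \*: (id ^+ k.+1).
    by apply/funext => y; rewrite /phi exprfctE.
  apply: is_derive_eq.
  by rewrite /dphi /GRing.scale /= mulr1.
have := @is_cderive_mean_value R f df phi dphi 0 t t0
  (fun s => is_cderive_tail k (is_cderive_scale w s)) hphi.
have f0 : f 0 = 0.
  rewrite /f mul0r /cexp_tail cexp0 /cexp_sum big_ord_recl expr0 fact0 divr1.
  by rewrite big1 ?addr0 ?subrr// => i _; rewrite expr0n /= mul0r.
rewrite f0 subr0 /phi expr0n /= mulr0 subr0 => H.
apply: le_trans (H _) _; last by rewrite /c exprMn; apply: le_of_eq; ring.
move=> s /andP[s0 st]; rewrite /df normcM.
have s1 : 0 <= s <= 1 by rewrite s0 (le_trans st).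
apply: le_trans (ler_wpM2l (normc_ge0 _) (IH s s1)) _.
rewrite /dphi /c exprMn factS natrM exprS.
have : (k.+1%:R : R) != 0 by rewrite pnatr_eq0.
have : ((k`!)%:R : R) != 0 by rewrite pnatr_eq0 -lt0n fact_gt0.
move: (k.+1%:R : R) ((k`!)%:R : R) => a b h1 h2.
by apply: le_of_eq; field; rewrite ?h1 ?h2.
Qed.

Lemma expR_ge_term (k : nat) (x : R) : 0 <= x -> x ^+ k / (k`!)%:R <= expR x.
Proof.
case: k => [|k] x0; first by rewrite expr0 fact0 divr1 -expR0 ler_expR.
by apply: le_trans (expR_ge1Dxn k x0); rewrite lerDr.
Qed.

End tail_bound.

(** * Smooth functions with dominated derivatives *)

Section smooth_classes.
Context {R : realType} {d : nat}.
Local Notation V := 'rV[R]_d.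
Implicit Types (f g : V -> R[i]) (x v : V) (L : R[i]) (j : 'I_d) (N : nat).

Lemma cpartialP j f x L : is_cderive x (basis_rV j) f L ->
  cderivable j f x /\ cpartial j f x = L.
Proof.
by move=> [[? h1] [? h2]]; split => //; rewrite /cpartial h1 h2; case: L h1 h2.
Qed.

Lemma cderivableP j f x : cderivable j f x ->
  is_cderive x (basis_rV j) f (cpartial j f x).
Proof. by move=> [h1 h2]; split; exact/derivableP. Qed.

Lemma cpartialE j f (df : V -> R[i]) :
  (forall x, is_cderive x (basis_rV j) f (df x)) ->
  (forall x, cderivable j f x) /\ cpartial j f = df.
Proof.
move=> h; split=> [x|]; first by have [] := cpartialP (h x).
by apply/funext => x; have [] := cpartialP (h x).
Qed.

Lemma ccontinuousD (T : topologicalType) (f g : T -> R[i]) :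
  ccontinuous f -> ccontinuous g -> ccontinuous (fun t => f t + g t).
Proof.
move=> [f1 f2] [g1 g2]; split=> t.
  by under eq_fun do rewrite cReD; apply: continuousD; [exact: f1|exact: g1].
by under eq_fun do rewrite cImD; apply: continuousD; [exact: f2|exact: g2].
Qed.

Lemma ccontinuousM (T : topologicalType) (f g : T -> R[i]) :
  ccontinuous f -> ccontinuous g -> ccontinuous (fun t => f t * g t).
Proof.
move=> [f1 f2] [g1 g2]; split=> t.
  under eq_fun do rewrite cReM; apply: cvgB; apply: cvgM;
   [exact: f1|exact: g1|exact: f2|exact: g2].
under eq_fun do rewrite cImM; apply: cvgD; apply: cvgM;
   [exact: f1|exact: g2|exact: f2|exact: g1].
Qed.

Lemma ccontinuous_cst (T : topologicalType) (c : R[i]) :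
  ccontinuous (fun _ : T => c).
Proof. by split=> t; exact: cst_continuous. Qed.

Lemma ccontinuous_cexp (T : topologicalType) (f : T -> R[i]) :
  ccontinuous f -> ccontinuous (fun t => cexp (f t)).
Proof.
move=> [f1 f2]; split=> t.
  under eq_fun do rewrite Re_cexp.
  apply: cvgM; apply: continuous_comp.
  - exact: f1.
  - exact: continuous_expR.
  - exact: f2.
  - exact: continuous_cos.
under eq_fun do rewrite Im_cexp.
apply: cvgM; apply: continuous_comp.
- exact: f1.
- exact: continuous_expR.
- exact: f2.
- exact: continuous_sin.
Qed.

Lemma ccontinuous_real (T : topologicalType) (f : T -> R) :
  continuous f -> ccontinuous (fun t => (f t)%:C).
Proof. by move=> h; split => // t; exact: cst_continuous. Qed.

Lemma coord_rV_continuous (j : 'I_d) : continuous (fun x : V => x ord0 j).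
Proof. exact: coord_continuous. Qed.

(** Recursive on the order, so that the closure properties are proved one derivative at a time. *)
Fixpoint differentiable_upto N f : Prop :=
  ccontinuous f /\
  (if N is N'.+1 then
     forall j, (forall x, cderivable j f x) /\ differentiable_upto N' (cpartial j f)
   else True).
Local Notation diffn := differentiable_upto.

Lemma diffn_cont N f : diffn N f -> ccontinuous f.
Proof. by case: N => [|N] []. Qed.

Lemma diffnW N f : diffn N.+1 f -> diffn N f.
Proof.
elim: N f => [|N IH] f [cf h]; first by [].
by split => // j; have [h1 h2] := h j; split => //; exact: IH.
Qed.

Lemma diffn_der N j f : diffn N.+1 f ->
  [/\ forall x, is_cderive x (basis_rV j) f (cpartial j f x) & diffn N (cpartial j f)].
Proof. by move=> [_ /(_ j)[h1 h2]]; split => // x; exact: cderivableP. Qed.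

Lemma diffn_step N f (df : 'I_d -> V -> R[i]) : ccontinuous f ->
  (forall j x, is_cderive x (basis_rV j) f (df j x)) ->
  (forall j, diffn N (df j)) -> diffn N.+1 f.
Proof.
move=> cf h hd; split => // j; have [h1 h2] := cpartialE (h j).
by split => //; rewrite h2.
Qed.

Lemma diffn_cst N c : diffn N (fun=> c).
Proof.
elim: N c => [|N IH] c; first by split => //; exact: ccontinuous_cst.
apply: (diffn_step (df := fun _ _ => 0)) => //; first exact: ccontinuous_cst.
by move=> j x; exact: is_cderive_cst.
Qed.

Lemma diffnD N f g : diffn N f -> diffn N g -> diffn N (fun x => f x + g x).
Proof.
elim: N f g => [|N IH] f g hf hg.
  by split => //; apply: ccontinuousD; [exact: diffn_cont hf|exact: diffn_cont hg].
apply: (diffn_step (df := fun j x => cpartial j f x + cpartial j g x)).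
- by apply: ccontinuousD; [exact: diffn_cont hf|exact: diffn_cont hg].
- move=> j x; have [h1 _] := diffn_der j hf; have [h2 _] := diffn_der j hg.
  exact: is_cderiveD.
- by move=> j; have [_ h1] := diffn_der j hf; have [_ h2] := diffn_der j hg; exact: IH.
Qed.

Lemma diffnM N f g : diffn N f -> diffn N g -> diffn N (fun x => f x * g x).
Proof.
elim: N f g => [|N IH] f g hf hg.
  by split => //; apply: ccontinuousM; [exact: diffn_cont hf|exact: diffn_cont hg].
apply: (diffn_step (df := fun j x => cpartial j f x * g x + f x * cpartial j g x)).
- by apply: ccontinuousM; [exact: diffn_cont hf|exact: diffn_cont hg].
- move=> j x; have [h1 _] := diffn_der j hf; have [h2 _] := diffn_der j hg.
  exact: is_cderiveM.
- move=> j; have [_ h1] := diffn_der j hf; have [_ h2] := diffn_der j hg.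
  by apply: diffnD; apply: IH => //; exact: diffnW.
Qed.

Lemma diffnZ N c f : diffn N f -> diffn N (fun x => c * f x).
Proof. by apply: diffnM; exact: diffn_cst. Qed.

Lemma diffn_cexp N f : diffn N f -> diffn N (fun x => cexp (f x)).
Proof.
elim: N f => [|N IH] f hf.
  by split => //; apply: ccontinuous_cexp; exact: diffn_cont hf.
apply: (diffn_step (df := fun j x => cpartial j f x * cexp (f x))).
- by apply: ccontinuous_cexp; exact: diffn_cont hf.
- by move=> j x; have [h1 _] := diffn_der j hf; exact: is_cderive_cexp.
- move=> j; have [_ h1] := diffn_der j hf; apply: diffnM => //.
  by apply: IH; exact: diffnW.
Qed.

Lemma diffn_sum N I (r : seq I) (P : pred I) (F : I -> V -> R[i]) :
  (forall i, P i -> diffn N (F i)) -> diffn N (fun x => \sum_(i <- r | P i) F i x).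
Proof.
move=> h; elim: r => [|i r IH].
  have -> : (fun x => \sum_(i <- [::] | P i) F i x) = fun=> 0.
    by apply/funext => x; rewrite big_nil.
  exact: diffn_cst.
have -> : (fun x => \sum_(i <- i :: r | P i) F i x) =
   fun x => if P i then F i x + \sum_(i <- r | P i) F i x else \sum_(i <- r | P i) F i x.
  by apply/funext => x; rewrite big_cons.
by case Pi: (P i) => //; apply: diffnD IH; exact: h.
Qed.

Lemma diffn_prod N I (r : seq I) (P : pred I) (F : I -> V -> R[i]) :
  (forall i, P i -> diffn N (F i)) -> diffn N (fun x => \prod_(i <- r | P i) F i x).
Proof.
move=> h; elim: r => [|i r IH].
  have -> : (fun x => \prod_(i <- [::] | P i) F i x) = fun=> 1.
    by apply/funext => x; rewrite big_nil.
  exact: diffn_cst.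
have -> : (fun x => \prod_(i <- i :: r | P i) F i x) =
   fun x => if P i then F i x * \prod_(i <- r | P i) F i x else \prod_(i <- r | P i) F i x.
  by apply/funext => x; rewrite big_cons.
by case Pi: (P i) => //; apply: diffnM IH; exact: h.
Qed.

Lemma diffn_exp N f k : diffn N f -> diffn N (fun x => f x ^+ k).
Proof.
move=> h; elim: k => [|k IH]; first exact: diffn_cst.
rewrite (_ : (fun x => _) = fun x => f x * f x ^+ k); first exact: diffnM.
by apply/funext => x; rewrite exprS.
Qed.

Definition linform (a : 'I_d -> R[i]) (x : V) : R[i] := \sum_j a j * (x ord0 j)%:C.

Lemma linformD a x y : linform a (x + y) = linform a x + linform a y.
Proof.
rewrite /linform -big_split /=; apply: eq_bigr => j _.
by rewrite mxE rmorphD mulrDr.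
Qed.

Lemma linformZ a (t : R) x : linform a (t *: x) = t%:C * linform a x.
Proof.
rewrite /linform mulr_sumr; apply: eq_bigr => j _.
by rewrite mxE rmorphM mulrCA.
Qed.

Lemma linform_basis a j : linform a (basis_rV j) = a j.
Proof.
rewrite /linform (bigD1 j)//= big1 => [|i ij]; rewrite /basis_rV mxE ?eqxx /=.
  by rewrite mulr1 addr0.
by rewrite (negbTE ij) mulr0.
Qed.

Lemma is_cderive_linform a x v : is_cderive x v (linform a) (linform a v).
Proof.
apply: (@is_cderive_quad _ _ _ _ _ _ 0 1) => // t _.
by rewrite linformD linformZ addrK subrr normc0 mul0r.
Qed.

Lemma is_cderive_coord j x v :
  is_cderive x v (fun y => (y ord0 j)%:C) (v ord0 j)%:C.
Proof.
apply: (@is_cderive_quad _ _ _ _ _ _ 0 1) => // t _.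
by rewrite !mxE rmorphD rmorphM addrK subrr normc0 mul0r.
Qed.

Lemma diffn_coord N j : diffn N (fun y => (y ord0 j)%:C).
Proof.
have c : ccontinuous (fun y : V => (y ord0 j)%:C).
  by apply: ccontinuous_real; exact: coord_rV_continuous.
case: N => [|N]; first by [].
apply: (diffn_step (df := fun i x => (basis_rV i ord0 j)%:C)) => //.
  by move=> i x; exact: is_cderive_coord.
by move=> i; exact: diffn_cst.
Qed.

Lemma diffn_linform N a : diffn N (linform a).
Proof. by apply: diffn_sum => i _; apply: diffnZ; exact: diffn_coord. Qed.

Lemma diffn_smooth f : (forall N, diffn N f) -> smooth f.
Proof.
move=> h a.
suff: forall N, diffn N (partials a f).
  move=> H; split; first exact: diffn_cont (H 0%N).
  by move=> j x; have [_ /(_ j)[]] := H 1%N.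
elim: a => [|j a IH] N //=.
by have [] := diffn_der j (IH N.+1).
Qed.

(** The weighted [C^N] bounds which control a tempered distribution of order [N]. *)
Fixpoint dominated_upto N (B : R) (w : V -> R) f : Prop :=
  (forall x, normc (f x) <= B * w x) /\
  (if N is N'.+1 then forall j, dominated_upto N' B w (cpartial j f) else True).
Local Notation Bd := dominated_upto.

Lemma Bd0 N B w f : Bd N B w f -> forall x, normc (f x) <= B * w x.
Proof. by case: N => [|N] []. Qed.

Lemma Bd_step N B w f (df : 'I_d -> V -> R[i]) :
  (forall x, normc (f x) <= B * w x) ->
  (forall j x, is_cderive x (basis_rV j) f (df j x)) ->
  (forall j, Bd N B w (df j)) -> Bd N.+1 B w f.
Proof. by move=> h hd hB; split => // j; have [_ ->] := cpartialE (hd j). Qed.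

Lemma Bd_mono N B w B' w' f : (forall x, B * w x <= B' * w' x) ->
  Bd N B w f -> Bd N B' w' f.
Proof.
move=> h; elim: N f => [|N IH] f hf.
  by split => // x; exact: le_trans (Bd0 hf x) (h x).
split=> [x|j]; first exact: le_trans (Bd0 hf x) (h x).
by apply: IH; case: hf => _ /(_ j).
Qed.

Lemma BdS N B w f : Bd N.+1 B w f -> Bd N B w f.
Proof.
elim: N f => [|N IH] f [hf h]; first by [].
by split => // j; exact: IH.
Qed.

Lemma BdD N B B' w f g : diffn N f -> diffn N g -> Bd N B w f -> Bd N B' w g ->
  Bd N (B + B') w (fun x => f x + g x).
Proof.
elim: N f g => [|N IH] f g df dg hf hg.
  split => // x; rewrite mulrDl (le_trans (normcD _ _))// lerD//.
    exact: Bd0 hf _.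
  exact: Bd0 hg _.
apply: (Bd_step (df := fun j x => cpartial j f x + cpartial j g x)).
- move=> x; rewrite mulrDl (le_trans (normcD _ _))// lerD//.
    exact: Bd0 hf _.
  exact: Bd0 hg _.
- move=> j x; have [h1 _] := diffn_der j df; have [h2 _] := diffn_der j dg.
  exact: is_cderiveD.
- move=> j; have [_ h1] := diffn_der j df; have [_ h2] := diffn_der j dg.
  by apply: IH => //; [case: hf|case: hg] => _ /(_ j).
Qed.

Lemma BdZ N B w c f : diffn N f -> Bd N B w f -> Bd N (normc c * B) w (fun x => c * f x).
Proof.
elim: N f => [|N IH] f df hf.
  split => // x; rewrite normcM -mulrA ler_wpM2l ?normc_ge0//.
  exact: Bd0 hf _.
apply: (Bd_step (df := fun j x => c * cpartial j f x)).
- by move=> x; rewrite normcM -mulrA ler_wpM2l ?normc_ge0//; exact: Bd0 hf _.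
- by move=> j x; have [h1 _] := diffn_der j df; exact: is_cderiveZ.
- move=> j; have [_ h1] := diffn_der j df.
  by apply: IH => //; case: hf => _ /(_ j).
Qed.

(** Leibniz rule; [2 ^ N] counts its terms. *)
Lemma BdM N B B' w w' f g : 0 <= B -> 0 <= B' ->
  (forall x, 0 <= w x) -> (forall x, 0 <= w' x) ->
  diffn N f -> diffn N g -> Bd N B w f -> Bd N B' w' g ->
  Bd N (2 ^+ N * (B * B')) (fun x => w x * w' x) (fun x => f x * g x).
Proof.
move=> B0 B'0 w0 w'0.
have aux N' F G : Bd N' B w F -> Bd N' B' w' G -> forall x,
    normc (F x * G x) <= 2 ^+ N' * (B * B') * (w x * w' x).
  move=> hF hG x; rewrite normcM -mulrA.
  apply: (@le_trans _ _ (B * B' * (w x * w' x))).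
    by rewrite mulrACA ler_pM ?normc_ge0//; [exact: Bd0 hF _|exact: Bd0 hG _].
  by rewrite ler_peMl ?mulr_ge0 // exprn_ege1// ler1n.
elim: N f g => [|N IH] f g df dg hf hg; first by split => //; exact: aux.
apply: (Bd_step (df := fun j x => cpartial j f x * g x + f x * cpartial j g x)).
- exact: aux.
- move=> j x; have [h1 _] := diffn_der j df; have [h2 _] := diffn_der j dg.
  exact: is_cderiveM.
- move=> j; have [_ h1] := diffn_der j df; have [_ h2] := diffn_der j dg.
  rewrite exprS (_ : 2 * _ * _ = 2 ^+ N * (B * B') + 2 ^+ N * (B * B')); last by ring.
  have [_ /(_ j) hf'] := hf; have [_ /(_ j) hg'] := hg.
  apply: BdD; [| | |].
  + by apply: diffnM => //; exact: diffnW.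
  + by apply: diffnM => //; exact: diffnW.
  + by apply: IH => //; [exact: diffnW|exact: BdS].
  + by apply: IH => //; [exact: diffnW|exact: BdS].
Qed.

Lemma Bd_partials N B w f a : Bd N B w f -> (size a <= N)%N ->
  forall x, normc (partials a f x) <= B * w x.
Proof.
elim: N f a => [|N IH] f a hf.
  by rewrite leqn0 size_eq0 => /eqP -> x; exact: Bd0 hf x.
case/lastP: a => [_ x|a j]; first exact: Bd0 hf x.
rewrite size_rcons ltnS => ha x; rewrite /partials foldr_rcons.
by apply: IH => //; case: hf => _ /(_ j).
Qed.

End smooth_classes.

(** * Functions of exponential type *)

Lemma normc_nat (R : realType) k : normc (k%:R : R[i]) = k%:R.
Proof. by rewrite -(rmorph_nat (real_complex R)) normc_real normr_nat. Qed.

Section exponential_type.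
Context {R : realType} {d : nat}.
Local Notation V := 'rV[R]_d.
Local Notation diffn := differentiable_upto.
Local Notation Bd := dominated_upto.
Implicit Types (f g Q : V -> R[i]) (x v : V) (j : 'I_d) (N k : nat) (a : 'I_d -> R[i]).

Definition l1norm x : R := \sum_j `|x ord0 j|.
Definition expw (s : R) x : R := expR (s * l1norm x).

Lemma l1norm_ge0 x : 0 <= l1norm x. Proof. exact: sumr_ge0. Qed.
Lemma expw_ge0 s x : 0 <= expw s x. Proof. exact: expR_ge0. Qed.
Lemma expwD s t x : expw (s + t) x = expw s x * expw t x.
Proof. by rewrite /expw mulrDl expRD. Qed.
Lemma expw_ge1 s x : 0 <= s -> 1 <= expw s x.
Proof. by move=> s0; rewrite -expR0 ler_expR mulr_ge0 ?l1norm_ge0. Qed.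
Lemma expw_le s t x : s <= t -> expw s x <= expw t x.
Proof. by move=> st; rewrite ler_expR ler_wpM2r ?l1norm_ge0. Qed.

Lemma normc_linform a m x : (forall j, normc (a j) <= m) ->
  normc (linform a x) <= m * l1norm x.
Proof.
move=> h; rewrite /linform (le_trans (normc_sum _ _ _))// /l1norm mulr_sumr.
by apply: ler_sum => j _; rewrite normcM normc_real ler_wpM2r.
Qed.

Lemma Bd_cst N B w (c : R[i]) : (forall x, normc c <= B * w x) -> Bd N B w (fun _ : V => c).
Proof.
elim: N c => [|N IH] c h; first by split.
apply: (Bd_step (df := fun _ _ => 0)) => //.
  by move=> j x; exact: is_cderive_cst.
by move=> j; apply: IH => x; rewrite normc0 (le_trans (normc_ge0 c)).
Qed.

Lemma Bd_linform N a m : 0 <= m -> (forall j, normc (a j) <= m) ->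
  Bd N m (expw 1) (linform a).
Proof.
move=> m0 h.
have base x : normc (linform a x) <= m * expw 1 x.
  rewrite (le_trans (normc_linform x h))// ler_wpM2l// /expw mul1r.
  by rewrite (le_trans _ (expR_ge1Dx _))// lerDr.
case: N => [|N]; first by split.
apply: (Bd_step (df := fun j _ => a j)) => //.
  by move=> j x; rewrite -[X in is_cderive _ _ _ X]linform_basis; exact: is_cderive_linform.
by move=> j; apply: Bd_cst => x; rewrite (le_trans (h j))// ler_peMr// expw_ge1.
Qed.

Lemma diffn_cexp_linform N a : diffn N (fun x => cexp (linform a x)).
Proof. by apply: diffn_cexp; exact: diffn_linform. Qed.

Lemma is_cderive_cexp_linform a j x :
  is_cderive x (basis_rV j) (fun x => cexp (linform a x)) (a j * cexp (linform a x)).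
Proof.
by rewrite -{1}(linform_basis a j); apply: is_cderive_cexp; exact: is_cderive_linform.
Qed.

Lemma Bd_cexp_linform N a m Th : (forall j, normc (a j) <= m) -> 0 <= m ->
  1 <= Th -> m <= Th -> Bd N (Th ^+ N) (expw m) (fun x => cexp (linform a x)).
Proof.
move=> h m0 Th1 mTh.
have base k x : normc (cexp (linform a x)) <= Th ^+ k * expw m x.
  rewrite normc_cexp (@le_trans _ _ (expw m x))//.
    rewrite ler_expR (le_trans (ler_norm _))// (le_trans (Re_le_normc _))//.
    exact: normc_linform.
  by rewrite ler_peMl ?expw_ge0// exprn_ege1.
elim: N => [|N IH]; first by split.
apply: (Bd_step (df := fun j x => a j * cexp (linform a x))) => //.
  exact: is_cderive_cexp_linform.
move=> j; have := BdZ (a j) (diffn_cexp_linform N a) IH.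
apply: Bd_mono => x; rewrite ler_wpM2r ?expw_ge0// exprS ler_wpM2r//.
  by rewrite exprn_ge0// (le_trans ler01).
exact: le_trans (h j) _.
Qed.

Section one_variable_series.
Variables (a : 'I_d -> R[i]) (m : R) (v th rho Th : R).
Hypothesis am : forall j, normc (a j) <= m.
Hypothesis m0 : 0 <= m.
Hypothesis th0 : 0 < th.
Hypothesis th1 : th <= 1.
Hypothesis rho0 : 0 < rho.
Hypothesis Th1 : 1 <= Th.
Hypothesis rhoTh : rho * m <= Th.
Hypothesis vth : `|v| <= th * rho.

Let lf x := v%:C * linform a x.

Let dlf j x : is_cderive x (basis_rV j) lf (v%:C * a j).
Proof.
by rewrite -{1}(linform_basis a j); apply: is_cderiveZ; exact: is_cderive_linform.
Qed.

Let lf_le x : normc (lf x) <= th * (rho * m * l1norm x).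
Proof.
rewrite /lf normcM normc_real.
apply: (@le_trans _ _ (th * rho * (m * l1norm x))).
  by rewrite ler_pM ?normc_ge0//; exact: normc_linform.
by apply: le_of_eq; ring.
Qed.

Let coef_le j : normc (v%:C * a j) <= th * Th.
Proof.
rewrite normcM normc_real (@le_trans _ _ (th * rho * m))//.
  by rewrite ler_pM ?normc_ge0.
by rewrite -mulrA ler_wpM2l// ltW.
Qed.

Let Th0 : 0 <= Th. Proof. exact: le_trans ler01 _. Qed.

Let term_le k x : normc (cexp_term k (lf x)) <= th ^+ k * expw (rho * m) x.
Proof.
rewrite /cexp_term normcM normcX normcV.
rewrite normc_nat.
have L0 : 0 <= rho * m * l1norm x by rewrite !mulr_ge0 ?l1norm_ge0// ltW.
apply: (@le_trans _ _ (th ^+ k * ((rho * m * l1norm x) ^+ k / (k`!)%:R))).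
  rewrite mulrA -exprMn ler_wpM2r ?invr_ge0//.
  by rewrite lerXn2r ?nnegrE ?normc_ge0// mulr_ge0// ltW.
by rewrite ler_wpM2l ?exprn_ge0 ?(ltW th0)//; exact: expR_ge_term.
Qed.

Lemma diffn_term N k : diffn N (fun x => cexp_term k (lf x)).
Proof.
rewrite /cexp_term; rewrite (_ : (fun x => _) = fun x => (k`!)%:R^-1 * lf x ^+ k).
  by apply: diffnZ; apply: diffn_exp; apply: diffnZ; exact: diffn_linform.
by apply/funext => x; rewrite mulrC.
Qed.

Lemma diffn_cexp_sum N k : diffn N (fun x => cexp_sum k (lf x)).
Proof. by apply: diffn_sum => i _; exact: diffn_term. Qed.

Lemma diffn_cexp_lf N : diffn N (fun x => cexp (lf x)).
Proof. by apply: diffn_cexp; apply: diffnZ; exact: diffn_linform. Qed.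

Lemma diffn_tail N k : diffn N (fun x => cexp_tail k (lf x)).
Proof.
apply: diffnD; first exact: diffn_cexp_lf.
rewrite (_ : (fun x => _) = fun x => -1 * cexp_sum k (lf x)).
  by apply: diffnZ; exact: diffn_cexp_sum.
by apply/funext => x; rewrite mulN1r.
Qed.

Lemma Bd_term N k :
  Bd N (Th ^+ N * th ^+ k) (expw (rho * m)) (fun x => cexp_term k (lf x)).
Proof.
have base n l x : normc (cexp_term l (lf x)) <= Th ^+ n * th ^+ l * expw (rho * m) x.
  rewrite (le_trans (term_le _ _))// ler_wpM2r ?expw_ge0//.
  by rewrite ler_peMl ?exprn_ege1// exprn_ge0// ltW.
elim: N k => [|N IH] k; first by split.
case: k => [|k].
  rewrite (_ : (fun x => _) = fun=> 1); last by apply/funext => x; rewrite cexp_term0.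
  by apply: Bd_cst => x; have := base N.+1 0%N x; rewrite cexp_term0.
apply: (Bd_step (df := fun j x => v%:C * a j * cexp_term k (lf x))) => //.
  by move=> j x; exact: is_cderive_term.
move=> j; have := BdZ (v%:C * a j) (diffn_term N k) (IH k).
apply: Bd_mono => x; rewrite ler_wpM2r ?expw_ge0//.
rewrite (_ : Th ^+ N.+1 * th ^+ k.+1 = th * Th * (Th ^+ N * th ^+ k)); last first.
  by rewrite !exprS; ring.
by rewrite ler_wpM2r// mulr_ge0// exprn_ge0// ltW.
Qed.

(** Here [lf] is [v] times a linear form, [|v| <= th * rho]: each term of degree [k] gains the
   factor [th ^ k], uniformly in the derivatives, at the price of the exponential weight. *)
Lemma Bd_tail N k :
  Bd N (Th ^+ N * th ^+ k) (expw (2 * (rho * m))) (fun x => cexp_tail k (lf x)).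
Proof.
have base n l x : normc (cexp_tail l (lf x)) <=
    Th ^+ n * th ^+ l * expw (2 * (rho * m)) x.
  rewrite (le_trans (normc_cexp_tail _ _))//.
  rewrite mulrDl mul1r expwD mulrA ler_pM ?expR_ge0//.
  - by rewrite mulr_ge0 ?exprn_ge0 ?normc_ge0// invr_ge0.
  - rewrite (@le_trans _ _ (th ^+ l * expw (rho * m) x))//.
      rewrite (le_trans _ (term_le _ _))// /cexp_term normcM normcX normcV.
      by rewrite normc_nat.
    rewrite ler_wpM2r ?expw_ge0// ler_peMl ?exprn_ege1// exprn_ge0// ltW//.
  - rewrite ler_expR (le_trans (lf_le _))// ler_piMl//.
    by rewrite !mulr_ge0 ?l1norm_ge0// ltW.
elim: N k => [|N IH] k; first by split.
have tail0 x : cexp_tail 0 (lf x) = cexp (lf x).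
  by rewrite /cexp_tail /cexp_sum big_ord0 subr0.
apply: (Bd_step (df := fun j x => v%:C * a j * cexp_tail k.-1 (lf x))) => //.
  move=> j x; case: k => [|k] /=; last exact: is_cderive_tail.
  apply: is_cderive_ext (fun y => esym (tail0 y)).
  by rewrite tail0; exact: is_cderive_cexp.
move=> j; have := BdZ (v%:C * a j) (diffn_tail N k.-1) (IH k.-1).
apply: Bd_mono => x; rewrite ler_wpM2r ?expw_ge0//.
apply: (@le_trans _ _ (th * Th * (Th ^+ N * th ^+ k.-1))).
  by rewrite ler_wpM2r// mulr_ge0// exprn_ge0// ltW.
rewrite (_ : th * Th * (Th ^+ N * th ^+ k.-1) = Th ^+ N.+1 * th ^+ k.-1.+1); last first.
  by rewrite !exprS; ring.
rewrite ler_wpM2l ?exprn_ge0//.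
by case: k => [|k] //=; rewrite expr1 expr0.
Qed.

Lemma Bd_cexp_lf N : Bd N (Th ^+ N) (expw (2 * (rho * m))) (fun x => cexp (lf x)).
Proof.
have := Bd_tail N 0; rewrite expr0 mulr1.
rewrite (_ : (fun x => _) = fun x => cexp (lf x))//.
by apply/funext => x; rewrite /cexp_tail /cexp_sum big_ord0 subr0.
Qed.

Lemma Bd_cexp_sum N k :
  Bd N (2 * Th ^+ N) (expw (2 * (rho * m))) (fun x => cexp_sum k (lf x)).
Proof.
have dm : diffn N (fun x => -1 * cexp_tail k (lf x)) by apply: diffnZ; exact: diffn_tail.
have := BdD (diffn_cexp_lf N) dm (Bd_cexp_lf N)
  (BdZ (-1) (diffn_tail N k) (Bd_tail N k)).
rewrite (_ : (fun x => cexp (lf x) + _) = fun x => cexp_sum k (lf x)); last first.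
  by apply/funext => x; rewrite /cexp_tail; ring.
apply: Bd_mono => x; rewrite ler_wpM2r ?expw_ge0// normcN normc1 mul1r.
have : th ^+ k <= 1 by rewrite exprn_ile1// ltW.
have : 0 <= Th ^+ N by exact: exprn_ge0.
move: (th ^+ k) (Th ^+ N) => A B hB hA.
by rewrite (mulrDl 1 1) !mul1r lerD2l ler_piMr.
Qed.

End one_variable_series.

(** Stable under products and containing the exponentials of linear forms, yet such that a Gaussian
   times a function of exponential type is a Schwartz function. *)
Definition exp_type Q : Prop := (forall N, diffn N Q) /\
  (forall N, exists s B : R, [/\ 0 <= s, 0 <= B & Bd N B (expw s) Q]).

Lemma exp_typeD P Q : exp_type P -> exp_type Q -> exp_type (fun x => P x + Q x).
Proof.
move=> [dP hP] [dQ hQ]; split=> N; first exact: diffnD.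
have [s [B [s0 B0 h]]] := hP N; have [t [C [t0 C0 k]]] := hQ N.
exists (s + t), (B + C); split; rewrite ?addr_ge0//.
apply: BdD => //.
  by apply: Bd_mono h => x; rewrite ler_wpM2l// expw_le// lerDl.
by apply: Bd_mono k => x; rewrite ler_wpM2l// expw_le// lerDr.
Qed.

Lemma exp_typeM P Q : exp_type P -> exp_type Q -> exp_type (fun x => P x * Q x).
Proof.
move=> [dP hP] [dQ hQ]; split=> N; first exact: diffnM.
have [s [B [s0 B0 h]]] := hP N; have [t [C [t0 C0 k]]] := hQ N.
exists (s + t), (2 ^+ N * (B * C)); split; rewrite ?addr_ge0 ?mulr_ge0 ?exprn_ge0//.
have := BdM B0 C0 (expw_ge0 s) (expw_ge0 t) (dP N) (dQ N) h k.
by apply: Bd_mono => x; rewrite expwD.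
Qed.

Lemma exp_type_cst c : exp_type (fun=> c).
Proof.
split=> N; first exact: diffn_cst.
exists 0, (normc c); split; rewrite ?normc_ge0//.
by apply: Bd_cst => x; rewrite ler_peMr ?normc_ge0// expw_ge1.
Qed.

Lemma exp_typeZ c Q : exp_type Q -> exp_type (fun x => c * Q x).
Proof. by apply: exp_typeM; exact: exp_type_cst. Qed.

Lemma linform_bound a : exists2 m, 0 <= m & forall j, normc (a j) <= m.
Proof.
exists (\sum_j normc (a j)) => [|j]; first by apply: sumr_ge0 => j _; exact: normc_ge0.
by rewrite (bigD1 j)//= lerDl sumr_ge0// => i _; exact: normc_ge0.
Qed.

Lemma exp_type_linform a : exp_type (linform a).
Proof.
split=> N; first exact: diffn_linform.
by have [m m0 h] := linform_bound a; exists 1, m; split => //; exact: Bd_linform.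
Qed.

Lemma exp_type_cexp_linform a : exp_type (fun x => cexp (linform a x)).
Proof.
split=> N; first exact: diffn_cexp_linform.
have [m m0 h] := linform_bound a; exists m, ((m + 1) ^+ N); split => //.
  by rewrite exprn_ge0// addr_ge0.
by apply: Bd_cexp_linform => //; rewrite ?lerDl ?lerDr.
Qed.

Lemma exp_type_prod I (r : seq I) (P : pred I) (F : I -> V -> R[i]) :
  (forall i, P i -> exp_type (F i)) -> exp_type (fun x => \prod_(i <- r | P i) F i x).
Proof.
move=> h; elim: r => [|i r IH].
  rewrite (_ : (fun x => _) = fun=> 1); first exact: exp_type_cst.
  by apply/funext => x; rewrite big_nil.
rewrite (_ : (fun x => _) = fun x => (if P i then F i x else 1) * \prod_(i <- r | P i) F i x).
  apply: exp_typeM IH; case Pi: (P i) => //; [exact: h|exact: exp_type_cst].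
by apply/funext => x; rewrite big_cons; case: (P i); rewrite ?mul1r.
Qed.

Lemma exp_type_sum I (r : seq I) (P : pred I) (F : I -> V -> R[i]) :
  (forall i, P i -> exp_type (F i)) -> exp_type (fun x => \sum_(i <- r | P i) F i x).
Proof.
move=> h; elim: r => [|i r IH].
  rewrite (_ : (fun x => _) = fun=> 0); first exact: exp_type_cst.
  by apply/funext => x; rewrite big_nil.
rewrite (_ : (fun x => _) = fun x => (if P i then F i x else 0) + \sum_(i <- r | P i) F i x).
  apply: exp_typeD IH; case Pi: (P i) => //; [exact: h|exact: exp_type_cst].
by apply/funext => x; rewrite big_cons; case: (P i); rewrite ?add0r.
Qed.

Lemma exp_typeX Q k : exp_type Q -> exp_type (fun x => Q x ^+ k).
Proof.
move=> h; rewrite (_ : (fun x => _) = fun x => \prod_(i < k) Q x).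
  by apply: exp_type_prod.
by apply/funext => x; rewrite prodr_const card_ord.
Qed.

Lemma exp_type_term a k : exp_type (fun x => cexp_term k (linform a x)).
Proof.
rewrite /cexp_term; rewrite (_ : (fun x => _) = fun x => (k`!)%:R^-1 * linform a x ^+ k).
  by apply: exp_typeZ; apply: exp_typeX; exact: exp_type_linform.
by apply/funext => x; rewrite mulrC.
Qed.

(** The continuity inherited by [Q |-> <F, e^{-kappa |T|^2} Q>] from the continuity of a tempered
   distribution [F]. *)
Definition exp_bounded (L : (V -> R[i]) -> R[i]) : Prop :=
  (forall (a b : R[i]) P Q, exp_type P -> exp_type Q ->
     L (fun x => a * P x + b * Q x) = a * L P + b * L Q) /\
  (forall s, 0 <= s -> exists N (K : R), 0 <= K /\ forall B Q, 0 <= B -> exp_type Q ->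
     Bd N B (expw s) Q -> normc (L Q) <= K * B).

End exponential_type.

(** * Gaussians and tempered distributions *)

Section inner_product.
Context {R : realType} {d : nat}.
Local Notation V := 'rV[R]_d.
Implicit Types (x y v : V).

Lemma dotpC x y : dotp x y = dotp y x.
Proof. by apply: eq_bigr => j _; rewrite mulrC. Qed.
Lemma dotpDl x y v : dotp (x + y) v = dotp x v + dotp y v.
Proof. by rewrite -big_split; apply: eq_bigr => j _; rewrite mxE mulrDl. Qed.
Lemma dotpDr x y v : dotp v (x + y) = dotp v x + dotp v y.
Proof. by rewrite dotpC dotpDl !(dotpC v). Qed.
Lemma dotpZl t x v : dotp (t *: x) v = t * dotp x v.
Proof. by rewrite mulr_sumr; apply: eq_bigr => j _; rewrite mxE mulrA. Qed.
Lemma dotpZr t x v : dotp v (t *: x) = t * dotp v x.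
Proof. by rewrite dotpC dotpZl dotpC. Qed.
Lemma dotpNl x v : dotp (- x) v = - dotp x v.
Proof. by rewrite -scaleN1r dotpZl mulN1r. Qed.
Lemma dotpNr x v : dotp v (- x) = - dotp v x.
Proof. by rewrite dotpC dotpNl dotpC. Qed.
Lemma dotp_basis x j : dotp x (basis_rV j) = x ord0 j.
Proof.
rewrite /dotp (bigD1 j)//= big1 => [|i ij]; rewrite /basis_rV mxE ?eqxx /=.
  by rewrite mulr1 addr0.
by rewrite (negbTE ij) mulr0.
Qed.
Lemma sqnorm_ge0 x : 0 <= sqnorm x.
Proof. by apply: sumr_ge0 => j _; rewrite -expr2 sqr_ge0. Qed.
Lemma sqnormD x y : sqnorm (x + y) = sqnorm x + 2 * dotp x y + sqnorm y.
Proof. by rewrite /sqnorm dotpDl !dotpDr (dotpC y x); ring. Qed.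
Lemma sqnormB x y : sqnorm (x - y) = sqnorm x - 2 * dotp x y + sqnorm y.
Proof. by rewrite /sqnorm dotpDl !dotpDr !dotpNl !dotpNr (dotpC y x); ring. Qed.
Lemma sqnormZ t x : sqnorm (t *: x) = t ^+ 2 * sqnorm x.
Proof. by rewrite /sqnorm dotpZl dotpZr mulrA. Qed.
Lemma sqnormN x : sqnorm (- x) = sqnorm x.
Proof. by rewrite /sqnorm dotpNl dotpNr opprK. Qed.

Lemma is_derive_sqnorm x v : is_derive x v (@sqnorm R d) (2 * dotp x v).
Proof.
apply: (@is_derive_quad _ _ _ _ _ _ (sqnorm v) 1) => // t _.
rewrite sqnormD dotpZl sqnormZ dotpC.
rewrite (_ : _ - _ = sqnorm v * t ^+ 2); last by ring.
by rewrite ger0_norm// mulr_ge0 ?sqnorm_ge0// sqr_ge0.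
Qed.

End inner_product.

Section gaussian.
Context {R : realType} {d : nat}.
Local Notation V := 'rV[R]_d.
Local Notation diffn := differentiable_upto.
Local Notation Bd := dominated_upto.
Implicit Types (f g Q : V -> R[i]) (x v : V) (j : 'I_d) (N k : nat) (a : 'I_d -> R[i]).

Definition gaussian (kap : R) x : R[i] := (expR (- (kap * sqnorm x)))%:C.

Variable kap : R.
Hypothesis kap0 : 0 < kap.
Local Notation g := (gaussian kap).

Lemma gaussianE : g = fun x => cexp (- (kap * sqnorm x))%:C.
Proof. by apply/funext => x; rewrite cexp_real. Qed.

Lemma diffn_gaussian N : diffn N g.
Proof.
rewrite gaussianE; apply: diffn_cexp.
rewrite (_ : (fun x => _) = fun x : V =>
    \sum_j (- kap)%:C * ((x ord0 j)%:C * (x ord0 j)%:C)).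
  by apply: diffn_sum => j _; apply: diffnZ; apply: diffnM; exact: diffn_coord.
apply/funext => x; rewrite -mulNr rmorphM rmorph_sum mulr_sumr.
by apply: eq_bigr => j _; rewrite !rmorphM.
Qed.

Lemma is_cderive_gaussian j x :
  is_cderive x (basis_rV j) g ((- (2 * kap))%:C * (x ord0 j)%:C * g x).
Proof.
rewrite gaussianE.
apply: is_cderive_eq (is_cderive_cexp (is_cderive_real (f := fun x => - (kap * sqnorm x)) (l := - (2 * kap) * x ord0 j) _)) _.
  have -> : (fun y : V => - (kap * sqnorm y)) = (- kap) \*: (@sqnorm R d).
    by apply/funext => y; rewrite /= /GRing.scale /= mulNr.
  have := is_derive_sqnorm x (basis_rV j); rewrite dotp_basis => h.
  by apply: is_derive_eq; rewrite /GRing.scale /=; ring.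
by rewrite rmorphM.
Qed.

Lemma Bd_gaussian N : exists2 C : R, 0 <= C &
  Bd N C (fun x => expR (- (kap * sqnorm x)) * expw N%:R x) g.
Proof.
have base M x : normc (g x) <= expR (- (kap * sqnorm x)) * expw M%:R x.
  by rewrite normc_real ger0_norm ?expR_ge0// ler_peMr ?expR_ge0// expw_ge1.
elim: N => [|N [C C0 IH]].
  by exists 1 => //; split => // x; rewrite mul1r; exact: base.
pose C' := 1 + 2 ^+ N * (2 * kap * C).
have D0 : 0 <= 2 ^+ N * (2 * kap * C) by rewrite !mulr_ge0// ltW.
have C'0 : 0 <= C' by rewrite addr_ge0.
have W0 x : 0 <= expR (- (kap * sqnorm x)) * expw N.+1%:R x.
  by rewrite mulr_ge0 ?expR_ge0.
exists C' => //.
apply: (Bd_step (df := fun j x => ((- (2 * kap))%:C * (x ord0 j)%:C) * g x)).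
- move=> x; rewrite (le_trans (base N.+1 x))// ler_peMl//.
  by rewrite lerDl.
- by move=> j x; exact: is_cderive_gaussian.
move=> j.
have hc : Bd N (2 * kap) (expw 1) (fun x => (- (2 * kap))%:C * (x ord0 j)%:C).
  rewrite (_ : (fun x => _) = linform (fun i => if i == j then (- (2 * kap))%:C else 0)).
    apply: Bd_linform; first by rewrite mulr_ge0// ltW.
    move=> i; case: ifP => _; rewrite ?normc0 ?mulr_ge0 ?(ltW kap0)//.
    by rewrite normc_real normrN ger0_norm// mulr_ge0// ltW.
  apply/funext => x; rewrite /linform (bigD1 j)//= eqxx big1 ?addr0// => i ij.
  by rewrite (negbTE ij) mul0r.
have dc : diffn N (fun x => (- (2 * kap))%:C * (x ord0 j)%:C).
  by apply: diffnZ; exact: diffn_coord.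
have kk : 0 <= 2 * kap by rewrite mulr_ge0// ltW.
have := BdM kk C0 (expw_ge0 1) (fun x => mulr_ge0 (expR_ge0 _) (expw_ge0 _ x))
   dc (diffn_gaussian N) hc IH.
apply: Bd_mono => x.
rewrite (_ : expw 1 x * _ = expR (- (kap * sqnorm x)) * expw N.+1%:R x); last first.
  by rewrite -natr1 expwD; ring.
by rewrite ler_wpM2r// /C' lerDr.
Qed.

(** Coordinatewise, [s |t| - kap t^2 <= s^2 / (4 kap)]. *)
Lemma gaussian_dominates (s : R) x :
  expR (- (kap * sqnorm x)) * expw s x <= expR (d%:R * (s ^+ 2 / (4 * kap))).
Proof.
rewrite /expw -expRD ler_expR /sqnorm /dotp /l1norm !mulr_sumr -sumrN -big_split /=.
rewrite (_ : d%:R * _ = \sum_(j < d) (s ^+ 2 / (4 * kap))); last first.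
  by rewrite sumr_const card_ord mulr_natl.
apply: ler_sum => j _.
rewrite -expr2 -(real_normK (num_real (x ord0 j))); set y := `|_|.
rewrite -subr_ge0.
rewrite (_ : _ - _ = kap * (y - s / (2 * kap)) ^+ 2); last by field; rewrite gt_eqF.
by rewrite mulr_ge0 ?sqr_ge0// ltW.
Qed.

Lemma sqnorm_expw x : 1 + sqnorm x <= expw 2 x.
Proof.
have h : sqnorm x <= l1norm x ^+ 2.
  rewrite expr2 {1}/l1norm mulr_suml /sqnorm; apply: ler_sum => j _.
  rewrite -expr2 -(real_normK (num_real (x ord0 j))) expr2 ler_wpM2l//.
  by rewrite /l1norm (bigD1 j)//= lerDl sumr_ge0.
apply: (@le_trans _ _ ((1 + l1norm x) ^+ 2)).
  have l0 := l1norm_ge0 x.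
  rewrite (_ : (1 + l1norm x) ^+ 2 = 1 + 2 * l1norm x + l1norm x ^+ 2); last by ring.
  by rewrite lerD// lerDl mulr_ge0.
rewrite /expw mulr_natl -[_ *+ 2]/(_ + _) expRD -expr2.
by rewrite lerXn2r ?nnegrE ?expR_ge0 ?addr_ge0 ?l1norm_ge0// expR_ge1Dx.
Qed.

(** The Gaussian absorbs the polynomial weights, by [sqnorm_expw], and the exponential growth. *)
Lemma gaussian_seminorm N s : 0 <= s -> exists2 K : R, 0 <= K &
  forall B Q, 0 <= B -> exp_type Q -> Bd N B (expw s) Q ->
    (schwartz_seminorm N (fun x => g x * Q x)%R <= (K * B)%:E)%E.
Proof.
move=> s0; have [C C0 hC] := Bd_gaussian N.
pose t := N%:R * 2 + (N%:R + s).
exists (2 ^+ N * C * expR (d%:R * (t ^+ 2 / (4 * kap)))) => [|B Q B0 [dQ _] hQ].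
  by rewrite !mulr_ge0 ?expR_ge0.
apply: ge_ereal_sup => _ [a [x [aN ->]]]; rewrite lee_fin.
have h := Bd_partials (BdM C0 B0 (fun x => mulr_ge0 (expR_ge0 _) (expw_ge0 _ x))
  (expw_ge0 s) (diffn_gaussian N) (dQ N) hC hQ) aN x.
apply: (@le_trans _ _ (expw (N%:R * 2) x *
    (2 ^+ N * (C * B) * (expR (- (kap * sqnorm x)) * expw N%:R x * expw s x)))).
  apply: ler_pM => //; rewrite ?normc_ge0//.
    by rewrite exprn_ge0// addr_ge0 ?sqnorm_ge0.
  rewrite /expw -mulrA expRM_natl.
  by rewrite lerXn2r ?nnegrE ?expR_ge0 ?addr_ge0 ?sqnorm_ge0// sqnorm_expw.
rewrite (_ : _ * _ = 2 ^+ N * C * B * (expR (- (kap * sqnorm x)) * expw t x)); last first.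
  by rewrite /t !expwD; ring.
rewrite [leRHS]mulrAC ler_wpM2l ?gaussian_dominates//.
by rewrite !mulr_ge0.
Qed.

Lemma schwartz_gaussian Q : exp_type Q -> schwartz (fun x => g x * Q x).
Proof.
move=> eQ; split.
  by apply: diffn_smooth => N; apply: diffnM; [exact: diffn_gaussian|case: eQ].
move=> N; have [_ /(_ N)[s [B [s0 B0 h]]]] := eQ.
have [K K0 hK] := gaussian_seminorm N s0.
by apply: le_lt_trans (hK B Q B0 eQ h) _; rewrite ltry.
Qed.

Definition gaussian_pairing (F : (V -> R[i]) -> R[i]) Q : R[i] :=
  F (fun x => g x * Q x).

Lemma tempered_exp_bounded F : tempered F -> exp_bounded (gaussian_pairing F).
Proof.
move=> [lin [N [C hC]]]; split.
  move=> a b P Q eP eQ; rewrite /gaussian_pairing.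
  rewrite -lin; [|exact: schwartz_gaussian|exact: schwartz_gaussian].
  by congr F; apply/funext => x; ring.
move=> s s0; have [K K0 hK] := gaussian_seminorm N s0.
exists N, (`|C| * K); split; first by rewrite mulr_ge0.
move=> B Q B0 eQ hQ; rewrite -lee_fin.
apply: le_trans (hC _ (schwartz_gaussian eQ)) _.
rewrite -mulrA EFinM.
have S0 : (0 <= schwartz_seminorm N (fun x => g x * Q x)%R)%E.
  apply: (@le_trans _ _ ((1 + sqnorm (0 : V)) ^+ N *
     normc (partials [::] (fun x => g x * Q x) 0))%:E).
    by rewrite lee_fin mulr_ge0 ?normc_ge0// exprn_ge0// addr_ge0 ?sqnorm_ge0.
  by apply: ereal_sup_ubound; exists [::], 0.
apply: (@le_trans _ _ (`|C|%:E * schwartz_seminorm N (fun x => g x * Q x)%R)%E).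
  by rewrite lee_wpmul2r// lee_fin ler_norm.
by rewrite lee_wpmul2l ?lee_fin//; exact: hK.
Qed.

End gaussian.

(** * Limits of complex sequences *)

Section complex_limits.
Context {R : realType}.
Implicit Types (u w : nat -> R[i]) (l m : R[i]).

(** Convergence is phrased through the real-valued modulus, so that no topology on the complex
   numbers is involved. *)
Definition ccvg u l : Prop := normc (u N - l) @[N --> \oo] --> (0 : R).

Lemma ccvg_squeeze u l (e : nat -> R) : (forall N, normc (u N - l) <= e N) ->
  e N @[N --> \oo] --> (0 : R) -> ccvg u l.
Proof.
move=> h he; apply: (@squeeze_cvgr _ _ _ _ (fun=> 0) e); last 2 first.
- exact: cvg_cst.
- exact: he.
by near=> N; rewrite normc_ge0 h.
Unshelve. all: by end_near. Qed.

Lemma ccvg_close u w l (e : nat -> R) : ccvg u l -> (forall N, normc (w N - u N) <= e N) ->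
  e N @[N --> \oo] --> (0 : R) -> ccvg w l.
Proof.
move=> hu h he.
apply: (@ccvg_squeeze _ _ (fun N => e N + normc (u N - l))) => [N|].
  rewrite (_ : w N - l = (w N - u N) + (u N - l)); last by ring.
  by rewrite (le_trans (normcD _ _))// lerD2r.
by rewrite -[0]addr0; apply: cvgD.
Qed.

Lemma ccvg_le u l a B : ccvg u l -> (forall N, normc (u N - a) <= B) -> normc (l - a) <= B.
Proof.
move=> hl hB; rewrite leNgt; apply/negP => lt.
have e0 : 0 < normc (l - a) - B by rewrite subr_gt0.
have /cvgrPdist_lt /(_ _ e0) [N _ /(_ N (leqnn N))] := hl.
rewrite sub0r normrN ger0_norm ?normc_ge0// => h.
have := normcD (l - u N) (u N - a); rewrite addrA subrK normcB => h2.
have h3 := hB N.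
by have := lt_le_trans h (lexx _); lra.
Qed.

Lemma ccvg_unique u l m : ccvg u l -> ccvg u m -> l = m.
Proof.
move=> hl hm.
have : normc (l - m) <= 0.
  apply/ler_addgt0Pl => e e0; rewrite addr0.
  have /cvgrPdist_lt /(_ _ e0) [N _ hN] := hm.
  have hl' : ccvg (fun k => u (k + N)%N) l.
    by have := hl; rewrite /ccvg -(@cvg_shiftn N R^o (fun k => normc (u k - l))).
  apply: (ccvg_le hl') => k; have := hN (k + N)%N (leq_addl _ _).
  by rewrite sub0r normrN ger0_norm ?normc_ge0//; exact: ltW.
move=> h; apply/eqP; rewrite -subr_eq0; apply/eqP/normc_eq0/eqP.
by rewrite eq_le h normc_ge0.
Qed.

Lemma ccvg_norm_le u l B : ccvg u l -> (forall N, normc (u N) <= B) -> normc l <= B.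
Proof.
by move=> h hB; rewrite -(subr0 l); apply: (ccvg_le h) => N; rewrite subr0.
Qed.

Lemma ccvgD u w l m : ccvg u l -> ccvg w m -> ccvg (fun N => u N + w N) (l + m).
Proof.
move=> hu hw; apply: (@ccvg_squeeze _ _ (fun N => normc (u N - l) + normc (w N - m))).
  move=> N; rewrite (_ : _ - _ = (u N - l) + (w N - m)); last by ring.
  exact: normcD.
by rewrite -[0]addr0; apply: cvgD.
Qed.

Lemma ccvgZ c u l : ccvg u l -> ccvg (fun N => c * u N) (c * l).
Proof.
move=> hu; apply: (@ccvg_squeeze _ _ (fun N => normc c * normc (u N - l))).
  by move=> N; rewrite -mulrBr normcM.
by rewrite -(mulr0 (normc c)); apply: cvgMr.
Qed.

Lemma ccvg_cst l : ccvg (fun=> l) l.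
Proof. by rewrite /ccvg subrr normc0; exact: cvg_cst. Qed.

Lemma ccvg_bounded u l : ccvg u l -> exists2 B, 0 <= B & forall N, normc (u N) <= B.
Proof.
move=> h; have /cvg_seq_bounded [M [_ /(_ (M + 1)) hM]] : cvgn (fun N => normc (u N - l)).
  by apply/cvg_ex; exists 0.
exists (`|M + 1| + normc l) => [|N]; first by rewrite addr_ge0 ?normc_ge0.
have h2 : normc (u N - l) <= M + 1.
  have /hM/(_ N I) : M < M + 1 by rewrite ltrDl.
  exact: le_trans (ler_norm _).
rewrite -{1}(subrK l (u N)) (le_trans (normcD _ _))// lerD2r.
exact: le_trans h2 (ler_norm _).
Qed.

Lemma ccvgM u w l m : ccvg u l -> ccvg w m -> ccvg (fun N => u N * w N) (l * m).
Proof.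
move=> hu hw; have [B B0 hB] := ccvg_bounded hw.
apply: (@ccvg_squeeze _ _ (fun N => B * normc (u N - l) + normc l * normc (w N - m))).
  move=> N; rewrite (_ : _ - _ = w N * (u N - l) + l * (w N - m)); last by ring.
  rewrite (le_trans (normcD _ _))// !normcM lerD2r ler_wpM2r ?normc_ge0//.
by rewrite -[0]addr0; apply: cvgD; [rewrite -(mulr0 B)|rewrite -(mulr0 (normc l))];
  apply: cvgMr.
Qed.

(** Criterion of absolute convergence: [n] is the sequence of partial sums of the moduli. *)
Lemma cauchy_ccvg u (n : nat -> R) (A : R) : (forall N, n N <= A) ->
  (forall (m M : nat), (m <= M)%N -> normc (u M - u m) <= n M - n m) ->
  exists l, ccvg u l.
Proof.
move=> nA hc.
have nd : nondecreasing_seq n.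
  by move=> m M mM; rewrite -subr_ge0 (le_trans (normc_ge0 _) (hc _ _ mM)).
have cn : cvgn n.
  by apply: nondecreasing_is_cvgn => //; exists A => _ [N _ <-].
have real_case (v : nat -> R) :
    (forall (m M : nat), (m <= M)%N -> `|v M - v m| <= n M - n m) -> cvgn v.
  move=> hv.
  (* [v + n] is nondecreasing and bounded. *)
  have c : cvgn (fun N => v N + n N).
    apply: nondecreasing_is_cvgn.
      move=> m M mM; have := hv _ _ mM; rewrite ler_norml => /andP[+ _].
      by rewrite opprB; lra.
    exists (v 0%N - n 0%N + A + A) => _ [N _ <-].
    have := hv _ _ (leq0n N); rewrite ler_norml => /andP[_].
    have := nA N; lra.
  rewrite (_ : v = (fun N => v N + n N - n N)).
    exact: is_cvgB.
  by apply/funext => N; rewrite addrK.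
have c1 : cvgn (fun N => Re (u N)).
  apply: real_case => m M mM; apply: le_trans (hc _ _ mM).
  by rewrite (le_trans _ (Re_le_normc _))// cReD cReN.
have c2 : cvgn (fun N => Im (u N)).
  apply: real_case => m M mM; apply: le_trans (hc _ _ mM).
  by rewrite (le_trans _ (Im_le_normc _))// cImD cImN.
exists (limn (fun N => Re (u N)) +i* limn (fun N => Im (u N))).
apply: (@ccvg_squeeze _ _ (fun N => `|Re (u N) - limn (fun N => Re (u N))| +
   `|Im (u N) - limn (fun N => Im (u N))|)).
  by move=> N; rewrite (le_trans (normc_le _))// !(cReD, cImD, cReN, cImN).
rewrite -[0]addr0; apply: cvgD; rewrite -(@normr0 _ R); apply: cvg_norm.
  by rewrite -[0](subrr (limn (fun N => Re (u N)))); apply: cvgB => //; exact: cvg_cst.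
by rewrite -[0](subrr (limn (fun N => Im (u N)))); apply: cvgB => //; exact: cvg_cst.
Qed.

End complex_limits.

(** * Sums over cubes of multi-indices *)

Lemma perm_sum (I : eqType) (A : nmodType) (s1 s2 : seq I) (P1 P2 : pred I) (F : I -> A) :
  uniq s1 -> uniq s2 -> (forall x, (x \in s1) && P1 x = (x \in s2) && P2 x) ->
  \sum_(x <- s1 | P1 x) F x = \sum_(x <- s2 | P2 x) F x.
Proof.
move=> u1 u2 h; rewrite -[LHS]big_filter -[RHS]big_filter; apply: perm_big.
apply: uniq_perm; rewrite ?filter_uniq// => x.
by rewrite !mem_filter andbC h andbC.
Qed.

Lemma nonneg_subsum (R : realType) (I : eqType) (s : seq I) (P Q : pred I) (F : I -> R) :
  (forall x, 0 <= F x) -> (forall x, Q x -> P x) ->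
  \sum_(x <- s | Q x) F x <= \sum_(x <- s | P x) F x.
Proof.
move=> F0 QP; rewrite [leRHS](bigID Q) /=.
rewrite (eq_bigl Q); first by rewrite lerDl sumr_ge0.
by move=> x; case Qx: (Q x); rewrite ?andbF // (QP x).
Qed.

Section multi_indices.
Context {D : nat}.
Local Notation idx := {ffun 'I_D -> nat}.
Implicit Types (x y : idx) (i : 'I_D) (N : nat).

(** Multi-indices as finite functions, so that sums over cubes are sums over duplicate-free
   sequences which can be compared and reindexed. *)
Definition cube N : seq idx := [seq [ffun j => (a j : nat)] | a : {ffun 'I_D -> 'I_N}].

Lemma mem_cube N x : (x \in cube N) = [forall j, x j < N]%N.
Proof.
apply/idP/forallP => [/mapP[a _ ->] j|h]; first by rewrite ffunE.
apply/mapP; exists [ffun j => Ordinal (h j)]; first by rewrite mem_enum.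
by apply/ffunP => j; rewrite !ffunE.
Qed.

Lemma cube_uniq N : uniq (cube N).
Proof.
rewrite map_inj_uniq ?enum_uniq// => a b /ffunP h; apply/ffunP => j.
by apply/val_inj; have := h j; rewrite !ffunE.
Qed.

Lemma sum_cube (A : nmodType) N (t : ('I_D -> nat) -> A) :
  \sum_(a : {ffun 'I_D -> 'I_N}) t (fun j => a j) = \sum_(x <- cube N) t x.
Proof.
rewrite /cube big_map big_enum /=; apply: eq_bigr => a _; congr t.
by apply/funext => j; rewrite ffunE.
Qed.

Lemma cube_leq m N x : (m <= N)%N -> x \in cube m -> x \in cube N.
Proof.
rewrite !mem_cube => mN /forallP h; apply/forallP => j; exact: leq_trans (h j) mN.
Qed.

Lemma sum_cube_sub (A : nmodType) m N (F : idx -> A) : (m <= N)%N ->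
  \sum_(x <- cube m) F x = \sum_(x <- cube N | x \in cube m) F x.
Proof.
move=> mN; apply: perm_sum; rewrite ?cube_uniq// => x; rewrite andbT.
by case h: (x \in cube m); rewrite ?andbF// (cube_leq mN h).
Qed.

Definition mshift i x : idx := [ffun j => (x j + (j == i))%N].

Lemma mshift_inj i : injective (mshift i).
Proof.
move=> x y /ffunP h; apply/ffunP => j; have := h j; rewrite !ffunE.
exact: addIn.
Qed.

Lemma mshiftC i j x : mshift i (mshift j x) = mshift j (mshift i x).
Proof. by apply/ffunP => k; rewrite !ffunE addnAC. Qed.

Lemma sum_cube_shift (A : nmodType) N i (F : idx -> A) :
  \sum_(x <- cube N | (0 < x i)%N) F x =
  \sum_(x <- cube N | ((x i).+1 < N)%N) F (mshift i x).
Proof.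
rewrite -[RHS]big_filter -(big_map (mshift i) xpredT F).
apply: perm_sum; rewrite ?cube_uniq//.
  by rewrite map_inj_uniq ?filter_uniq ?cube_uniq//; exact: mshift_inj.
move=> y; rewrite andbT mem_cube; apply/andP/mapP => [[/forallP h y0]|[x]].
  exists [ffun j => (y j - (j == i))%N].
    rewrite mem_filter mem_cube ffunE eqxx subn1 prednK// h /=.
    by apply/forallP => j; rewrite ffunE (leq_ltn_trans (leq_subr _ _)).
  apply/ffunP => j; rewrite !ffunE subnK//.
  by case: eqVneq => // ->.
rewrite mem_filter mem_cube => /andP[xN /forallP h] ->; split.
  apply/forallP => j; rewrite ffunE; case: eqVneq => [->|_]; first by rewrite addn1.
  by rewrite addn0.
by rewrite ffunE eqxx addn1.
Qed.


Lemma sum_cube_shift_le (R : realType) N i (F : idx -> R) : (forall x, 0 <= F x) ->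
  \sum_(x <- cube N) F (mshift i x) <= \sum_(x <- cube N.+1) F x.
Proof.
move=> F0.
apply: (@le_trans _ _ (\sum_(x <- cube N.+1 | ((x i).+1 < N.+1)%N) F (mshift i x))).
  rewrite (sum_cube_sub _ (leqnSn N)); apply: nonneg_subsum => // x.
  by rewrite mem_cube => /forallP /(_ i); rewrite ltnS.
rewrite -(sum_cube_shift N.+1 i F); exact: nonneg_subsum.
Qed.

End multi_indices.

Section dominated_cube_sums.
Context {R : realType} {D : nat}.
Local Notation idx := {ffun 'I_D -> nat}.
Implicit Types (t : idx -> R[i]).

Lemma dominated_cube_le t (P : pred idx) m N : (m <= N)%N ->
  (forall x, x \in cube m -> P x) ->
  normc (\sum_(x <- cube N | P x) t x - \sum_(x <- cube m) t x) <=
  \sum_(x <- cube N) normc (t x) - \sum_(x <- cube m) normc (t x).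
Proof.
move=> mN hP; rewrite !(sum_cube_sub _ mN).
rewrite (bigID (fun x => x \in cube m) P) /=.
rewrite (eq_bigl (fun x => x \in cube m)); last first.
  by move=> x; case h: (x \in cube m); rewrite ?andbF// (hP x h).
rewrite addrAC subrr add0r (bigID (fun x => x \in cube m) predT) /= addrAC subrr add0r.
rewrite (le_trans (normc_sum _ _ _))//; apply: nonneg_subsum => [x|x /andP[]//].
exact: normc_ge0.
Qed.

Lemma dominated_cube_cvg t (A : R) : (forall N, \sum_(x <- cube N) normc (t x) <= A) ->
  exists l, ccvg (fun N => \sum_(x <- cube N) t x) l.
Proof.
move=> hA; apply: (cauchy_ccvg hA) => m M mM.
by have := @dominated_cube_le t predT m M mM (fun _ _ => isT).
Qed.

Lemma cube_mass_cvg t (A : R) : (forall N, \sum_(x <- cube N) normc (t x) <= A) ->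
  cvgn (fun N => \sum_(x <- cube N) normc (t x)).
Proof.
move=> hA; apply: nondecreasing_is_cvgn; last by exists A => _ [N _ <-].
move=> m N mN; rewrite (sum_cube_sub _ mN); apply: nonneg_subsum => // x.
exact: normc_ge0.
Qed.

(** Sums over finite sets squeezed between two growing cubes converge to the same limit: the
   difference is bounded by the mass of a difference of cubes. *)
Lemma dominated_exhaustion t (A : R) (P : nat -> pred idx) (m : nat -> nat) l :
  (forall N, \sum_(x <- cube N) normc (t x) <= A) ->
  (forall N, m N <= N)%N -> m N @[N --> \oo] --> \oo ->
  (forall N x, x \in cube (m N) -> P N x) ->
  ccvg (fun N => \sum_(x <- cube N) t x) l <->
  ccvg (fun N => \sum_(x <- cube N | P N x) t x) l.
Proof.
move=> hA mN moo hP.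
pose nn N := \sum_(x <- cube N) normc (t x).
have cn : cvgn nn := cube_mass_cvg hA.
have e0 : nn N - nn (m N) @[N --> \oo] --> (0 : R).
  rewrite -[0](subrr (limn nn)); apply: cvgB => //.
  exact: (@cvg_comp _ _ _ m nn _ _ _ moo cn).
have close1 N : normc (\sum_(x <- cube N | P N x) t x - \sum_(x <- cube N) t x) <=
    nn N - nn (m N).
  have hA' : forall x, x \in cube (m N) -> P N x by exact: hP.
  rewrite normcB [X in normc (X - _)](bigID (P N)) /= addrAC subrr add0r.
  rewrite (le_trans (normc_sum _ _ _))// /nn (sum_cube_sub _ (mN N)).
  rewrite [X in X - _](bigID (fun x => x \in cube (m N))) /= addrAC subrr add0r.
  apply: nonneg_subsum => x; first exact: normc_ge0.
  by apply: contra; exact: hP.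
split=> h; apply: (ccvg_close h) e0 => N; first exact: close1.
by rewrite normcB; exact: close1.
Qed.

End dominated_cube_sums.

(** * Power series in several real variables *)

Section monomial_estimates.
Context {R : realType} {D : nat}.
Local Notation V := 'rV[R]_D.
Local Notation idx := {ffun 'I_D -> nat}.
Implicit Types (x : idx) (v p : V) (i j : 'I_D).

(** The derivative of [y ^ k] for [|y| <= r0] is paid for by enlarging the radius. *)
Lemma pow_first_order (k : nat) (r0 dl : R) : 0 <= r0 -> 0 < dl ->
  k%:R * r0 ^+ k.-1 <= (r0 + dl) ^+ k / dl.
Proof.
move=> r00 dl0; rewrite ler_pdivlMr//.
have mono l : r0 ^+ l <= (r0 + dl) ^+ l.
  by rewrite lerXn2r ?nnegrE ?addr_ge0 ?lerDl// ltW.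
elim: k => [|k IH]; first by rewrite !mul0r exprn_ge0// addr_ge0// ltW.
rewrite [leRHS]exprS mulrDl.
apply: (@le_trans _ _ (r0 * (k%:R * r0 ^+ k.-1 * dl) + dl * r0 ^+ k)).
  apply: le_of_eq; case: k {IH} => [|k] /=; first by rewrite expr0; ring.
  by rewrite -(natr1 k.+1) exprS; ring.
by rewrite lerD// ler_wpM2l// ltW.
Qed.

(** Binomial expansion: the terms of degree at least two in [t] are compared with those of
   [(r0 + dl) ^ k]. *)
Lemma pow_second_order (k : nat) (y t r0 dl : R) : 0 < dl -> `|y| <= r0 -> `|t| <= dl ->
  `|(y + t) ^+ k - y ^+ k - t * (k%:R * y ^+ k.-1)| <= t ^+ 2 / dl ^+ 2 * (r0 + dl) ^+ k.
Proof.
move=> dl0 yr tdl.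
have r00 : 0 <= r0 by exact: le_trans yr.
have RHS0 l : 0 <= t ^+ 2 / dl ^+ 2 * (r0 + dl) ^+ l.
  by rewrite mulr_ge0 ?divr_ge0 ?sqr_ge0// exprn_ge0// addr_ge0// ltW.
case: k => [|[|k]].
- rewrite [X in `|X|](_ : _ = 0) ?normr0; first exact: (RHS0 0%N).
  by rewrite !expr0; ring.
- rewrite [X in `|X|](_ : _ = 0) ?normr0; first exact: (RHS0 1%N).
  by rewrite !expr1 expr0; ring.
have E : (y + t) ^+ k.+2 - y ^+ k.+2 - t * (k.+2%:R * y ^+ k.+1) =
    \sum_(i < k.+1) (y ^+ (k - i) * t ^+ i.+2) *+ 'C(k.+2, i.+2).
  rewrite exprDn 2!big_ord_recl /= !bin0 bin1 subn0 !expr0 subSS subn0 !expr1 /bump /=.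
  rewrite mulr1 mulr1n -[_ *+ k.+2]mulr_natl.
  under eq_bigr => i _ do rewrite !add1n subSS subSS.
  by ring.
rewrite E (le_trans (ler_norm_sum _ _ _))//.
rewrite exprDn mulr_sumr [leRHS]big_ord_recl [X in _ <= _ + X]big_ord_recl /= addrA.
rewrite ler_wpDl//.
  rewrite -mulrDr mulr_ge0 ?divr_ge0 ?sqr_ge0//.
  by rewrite addr_ge0// mulrn_wge0// mulr_ge0// exprn_ge0// ltW.
apply: ler_sum => i _; rewrite /bump /= !add1n !subSS.
rewrite normrMn [leRHS]mulrnAr ler_wMn2r// normrM !normrX.
rewrite (_ : t ^+ 2 / dl ^+ 2 * (r0 ^+ (k - i) * dl ^+ i.+2) =
    r0 ^+ (k - i) * (`|t| ^+ 2 * dl ^+ i)); last first.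
  rewrite real_normK ?num_real// (exprD dl 2 i).
  by move: (r0 ^+ _) (dl ^+ i) => a b; field; rewrite gt_eqF.
rewrite ler_pM ?exprn_ge0//; first by rewrite lerXn2r ?nnegrE.
by rewrite (exprD `|t| 2 i) ler_wpM2l ?exprn_ge0// lerXn2r ?nnegrE// ltW.
Qed.

Definition monomial_rest i x v : R := \prod_(j | j != i) v ord0 j ^+ x j.

Lemma monomialE i x v : monomial x v = v ord0 i ^+ x i * monomial_rest i x v.
Proof. by rewrite /monomial (bigD1 i). Qed.

Lemma monomial_shift i x v (t : R) :
  monomial x (v + t *: basis_rV i) = (v ord0 i + t) ^+ x i * monomial_rest i x v.
Proof.
rewrite (monomialE i) /basis_rV !mxE !eqxx /= mulr1; congr (_ * _).
by apply: eq_bigr => j ji; rewrite !mxE (negbTE ji) andbF mulr0 addr0.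
Qed.

Definition dmonomial i x v : R := (x i)%:R * v ord0 i ^+ (x i).-1 * monomial_rest i x v.

Lemma dmonomial_shift i x v :
  dmonomial i (mshift i x) v = (x i).+1%:R * monomial x v.
Proof.
rewrite (monomialE i) /dmonomial /mshift ffunE eqxx addn1 /= -mulrA; congr (_ * (_ * _)).
by apply: eq_bigr => j ji; rewrite ffunE (negbTE ji) addn0.
Qed.

Lemma dmonomial_eq0 i x v : x i = 0%N -> dmonomial i x v = 0.
Proof. by rewrite /dmonomial => ->; rewrite !mul0r. Qed.

Definition weight (r : R) x : R := \prod_j r ^+ x j.

Lemma weightE i r x : weight r x = r ^+ x i * \prod_(j | j != i) r ^+ x j.
Proof. by rewrite /weight (bigD1 i). Qed.

Lemma weight_ge0 r x : 0 <= r -> 0 <= weight r x.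
Proof. by move=> r0; apply: prodr_ge0 => j _; exact: exprn_ge0. Qed.

Lemma monomial_const r x : monomial x (const_mx r : V) = weight r x.
Proof. by apply: eq_bigr => j _; rewrite mxE. Qed.

Variables (r0 dl : R).
Hypothesis dl0 : 0 < dl.

Lemma rest_le i x v : (forall j, `|v ord0 j| <= r0) ->
  `|monomial_rest i x v| <= \prod_(j | j != i) (r0 + dl) ^+ x j.
Proof.
move=> h; rewrite normr_prod; apply: ler_prod => j _; rewrite normr_ge0 normrX.
have r00 : 0 <= r0 by exact: le_trans (h j).
by rewrite lerXn2r ?nnegrE ?addr_ge0 ?(ltW dl0)// (le_trans (h j))// lerDl ltW.
Qed.

Lemma dmonomial_le i x v : (forall j, `|v ord0 j| <= r0) ->
  `|dmonomial i x v| <= weight (r0 + dl) x / dl.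
Proof.
move=> h; have r00 : 0 <= r0 by exact: le_trans (h i).
rewrite (weightE i) mulrAC /dmonomial normrM ler_pM ?rest_le//.
apply: le_trans (pow_first_order _ r00 dl0).
by rewrite normrM normr_nat normrX ler_wpM2l// lerXn2r ?nnegrE.
Qed.

Lemma monomial_second_order i x v t : (forall j, `|v ord0 j| <= r0) -> `|t| <= dl ->
  `|monomial x (v + t *: basis_rV i) - monomial x v - t * dmonomial i x v| <=
  t ^+ 2 / dl ^+ 2 * weight (r0 + dl) x.
Proof.
move=> h tdl; rewrite monomial_shift (monomialE i x v) /dmonomial.
set m := monomial_rest i x v.
rewrite (_ : _ - _ = ((v ord0 i + t) ^+ x i - v ord0 i ^+ x i -
   t * ((x i)%:R * v ord0 i ^+ (x i).-1)) * m); last by ring.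
rewrite (weightE i) [leRHS]mulrA normrM ler_pM ?rest_le//.
exact: pow_second_order.
Qed.

End monomial_estimates.

Section power_series.
Context {R : realType} {D : nat}.
Local Notation V := 'rV[R]_D.
Local Notation idx := {ffun 'I_D -> nat}.
Implicit Types (x : idx) (v p : V) (i j : 'I_D) (f g : V -> R[i]) (c : idx -> R[i]).

(** The expansion demanded by [real_analytic], with coefficients indexed by finite functions. *)
Definition has_series f p c (r : R) : Prop := 0 < r /\
  forall v, (forall j, `|v ord0 j| < r) ->
    (exists B : R, forall N, \sum_(x <- cube N) normc (c x) * `|monomial x v| <= B) /\
    ccvg (fun N => \sum_(x <- cube N) c x * (monomial x v)%:C) (f (p + v)).

Lemma real_analyticP f : real_analytic f <-> forall p, exists c r, has_series f p c r.
Proof.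
have E (c : ('I_D -> nat) -> R[i]) N v :
    \sum_(a : {ffun 'I_D -> 'I_N}) Normc.normc (c (fun j => a j)) * `|monomial (fun j => a j) v| =
    \sum_(x <- cube N) normc (c x) * `|monomial x v|.
  exact: (sum_cube N (fun a => normc (c a) * `|monomial a v|)).
have E' (c : ('I_D -> nat) -> R[i]) N v :
    \sum_(a : {ffun 'I_D -> 'I_N}) c (fun j => a j) * (monomial (fun j => a j) v)%:C =
    \sum_(x <- cube N) c x * (monomial x v)%:C.
  exact: (sum_cube N (fun a => c a * (monomial a v)%:C)).
split=> h p.
  have [c [r [r0 hr]]] := h p; exists (fun x => c x), r; split => // v hv.
  have [[B hB] hc] := hr v hv; split; first by exists B => N; rewrite -E.
  by move: hc; rewrite /ccvg; under eq_fun do rewrite E'.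
have [c [r [r0 hr]]] := h p.
pose c' (a : 'I_D -> nat) := c [ffun j => a j].
have cc' x : c' x = c x by congr c; apply/ffunP => j; rewrite ffunE.
exists c', r; split => // v hv; have [[B hB] hc] := hr v hv; split.
  exists B => N; rewrite E; have := hB N.
  by under eq_bigr do rewrite -cc'.
move: hc; rewrite /ccvg.
rewrite (_ : (fun N => _) = (fun N => normc
  (\sum_(a : {ffun 'I_D -> 'I_N}) c' (fun j => a j) * (monomial (fun j => a j) v)%:C -
     f (p + v))))//.
apply/funext => N; rewrite E'; congr (normc (_ - _)).
by apply: eq_bigr => x _; rewrite cc'.
Qed.

Lemma has_series_restrict f p c r s : has_series f p c r -> 0 < s -> s <= r ->
  has_series f p c s.
Proof.
by move=> [_ h] s0 sr; split => // v hv; apply: h => j; exact: lt_le_trans (hv j) sr.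
Qed.

(** The coefficients of the [i]-th partial derivative. *)
Definition dcoef i c : idx -> R[i] := fun x => (x i).+1%:R * c (mshift i x).

Lemma dcoefC i j c : dcoef i (dcoef j c) = dcoef j (dcoef i c).
Proof.
apply/funext => x; rewrite /dcoef mshiftC !mulrA; congr (_ * _); rewrite !ffunE.
have [->|ij] := eqVneq i j; first by [].
by rewrite !addn0 mulrC.
Qed.

(** Termwise differentiation with a quadratic error: the second-order estimate of each monomial is
   summable because the series converges absolutely on the larger box of radius [r0 + dl]. *)
Lemma series_first_order f p c r r0 dl : has_series f p c r -> 0 <= r0 -> 0 < dl ->
  r0 + dl < r -> exists2 A, 0 <= A &
  forall i v, (forall j, `|v ord0 j| <= r0) -> exists L, [/\
    ccvg (fun N => \sum_(x <- cube N) dcoef i c x * (monomial x v)%:C) L,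
    (forall N, \sum_(x <- cube N) normc (dcoef i c x) * `|monomial x v| <= A / dl) &
    forall t : R, `|t| <= dl ->
      normc (f (p + (v + t *: basis_rV i)) - f (p + v) - t%:C * L) <= A / dl ^+ 2 * t ^+ 2].
Proof.
move=> [r_gt0 hr] r00 dl0 rr.
have rho0 : 0 <= r0 + dl by rewrite addr_ge0// ltW.
have [|[A hA] _] := hr (const_mx (r0 + dl)).
  by move=> j; rewrite mxE ger0_norm.
have W0 x := weight_ge0 x rho0.
have {}hA N : \sum_(x <- cube N) normc (c x) * weight (r0 + dl) x <= A.
  apply: le_trans (hA N); apply: ler_sum => x _.
  by rewrite monomial_const ger0_norm.
have A0 : 0 <= A.
  apply: le_trans (hA 0%N); apply: sumr_ge0 => x _; exact: mulr_ge0 (normc_ge0 _) (W0 x).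
exists A => // i v hv.
have box s (w : V) : s <= r0 + dl -> (forall j, `|w ord0 j| <= s) ->
    forall j, `|w ord0 j| < r.
  by move=> sr hw j; rewrite (le_lt_trans (hw j))// (le_lt_trans sr).
have vr : forall j, `|v ord0 j| < r by apply: (box r0) => //; rewrite lerDl ltW.
pose t0 x := dcoef i c x * (monomial x v)%:C.
pose T x := c x * (dmonomial i x v)%:C.
have tT x : t0 x = T (mshift i x).
  by rewrite /t0 /T dmonomial_shift rmorphM rmorph_nat /dcoef; ring.
have Tle x : normc (T x) <= normc (c x) * weight (r0 + dl) x / dl.
  by rewrite normcM normc_real -mulrA ler_wpM2l ?normc_ge0// dmonomial_le.
have TA N : \sum_(x <- cube N) normc (T x) <= A / dl.
  rewrite (le_trans (ler_sum _ (fun x _ => Tle x)))// -mulr_suml.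
  by rewrite ler_wpM2r// invr_ge0 ltW.
have t0A N : \sum_(x <- cube N) normc (t0 x) <= A / dl.
  apply: le_trans (TA N.+1).
  under eq_bigr do rewrite tT.
  by apply: sum_cube_shift_le => x; exact: normc_ge0.
(* The termwise derivative is summed over shifted cubes; both families exhaust the indices. *)
have [L hL] := dominated_cube_cvg t0A.
have hTL : ccvg (fun N => \sum_(x <- cube N) T x) L.
  have pred_oo : predn N @[N --> \oo] --> \oo.
    apply/cvgnyPge => k; near=> N; rewrite -ltnS; apply: leq_trans (leqSpred _).
    by near: N; exists k.+1.
  have hP N x : x \in cube N.-1 -> ((x i).+1 < N)%N.
    by case: N => [|N]; rewrite mem_cube => /forallP /(_ i).
  have := (@dominated_exhaustion _ _ t0 _ (fun N x => (x i).+1 < N)%N predn L t0A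
     leq_pred pred_oo hP).1 hL.
  rewrite /ccvg; under eq_fun => N.
    under eq_bigr do rewrite tT.
    rewrite -sum_cube_shift.
    rewrite (_ : \sum_(x <- cube N | _) _ = \sum_(x <- cube N) T x); last first.
      rewrite [RHS](bigID (fun x : idx => 0 < x i)%N) /= [X in _ + X]big1 ?addr0//.
      by move=> x; rewrite -eqn0Ngt => /eqP h; rewrite /T dmonomial_eq0// mulr0.
    over.
  exact.
exists L; split => //.
  move=> N; apply: le_trans (t0A N); apply: ler_sum => x _.
  by rewrite /t0 normcM normc_real.
move=> t tdl.
have vtr : forall j, `|(v + t *: basis_rV i) ord0 j| < r.
  apply: (box (r0 + dl)) => // j; rewrite !mxE (le_trans (ler_normD _ _))// lerD//.
  rewrite normrM (le_trans _ tdl)// ler_piMr//.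
  by case: (_ && _); rewrite ?normr1 ?normr0.
have [_ c1] := hr _ vtr; have [_ c2] := hr _ vr.
have := ccvgD (ccvgD c1 (ccvgZ (-1) c2)) (ccvgZ (- t%:C) hTL).
rewrite mulN1r mulNr => /ccvg_norm_le; apply => N.
rewrite !mulr_sumr -!big_split /=.
rewrite (le_trans (normc_sum _ _ _))//.
apply: (@le_trans _ _ (\sum_(x <- cube N) t ^+ 2 / dl ^+ 2 * (normc (c x) * weight (r0 + dl) x))).
  apply: ler_sum => x _.
  rewrite (_ : _ + _ = c x * (monomial x (v + t *: basis_rV i) - monomial x v -
      t * dmonomial i x v)%:C); last first.
    rewrite /T; move: (monomial x (v + _)) (monomial x v) (dmonomial i x v) => m1 m2 m3.
    by rewrite !rmorphB rmorphM; ring.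
  by rewrite normcM normc_real [leRHS]mulrCA ler_wpM2l ?normc_ge0// monomial_second_order.
rewrite -mulr_sumr (le_trans (ler_wpM2l _ (hA N)))//.
  by rewrite divr_ge0 ?sqr_ge0.
by apply: le_of_eq; ring.
Unshelve. all: by end_near. Qed.

Lemma box_radius v r : 0 < r -> (forall j, `|v ord0 j| < r) ->
  exists r0 dl, [/\ 0 <= r0, 0 < dl, r0 + dl < r & forall j, `|v ord0 j| <= r0].
Proof.
move=> r_gt0 hv; pose M := \big[Num.max/0]_j `|v ord0 j|.
have Mr : M < r by apply: bigmax_lt => // j _; exact: hv.
have M0 : 0 <= M by exact: bigmax_ge_id.
exists M, ((r - M) / 2); split => //; try lra.
by move=> j; exact: le_bigmax.
Qed.

Lemma series_derive f p c r i : has_series f p c r ->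
  (forall v, (forall j, `|v ord0 j| < r) ->
    is_cderive (p + v) (basis_rV i) f (cpartial i f (p + v))) /\
  has_series (cpartial i f) p (dcoef i c) r.
Proof.
move=> h; have r_gt0 : 0 < r by case: h.
have main v : (forall j, `|v ord0 j| < r) -> [/\
   is_cderive (p + v) (basis_rV i) f (cpartial i f (p + v)),
   (exists B : R, forall N, \sum_(x <- cube N) normc (dcoef i c x) * `|monomial x v| <= B) &
   ccvg (fun N => \sum_(x <- cube N) dcoef i c x * (monomial x v)%:C) (cpartial i f (p + v))].
  move=> hv; have [r0 [dl [r00 dl0 rr hv']]] := box_radius r_gt0 hv.
  have [A A0 /(_ i v hv')[L [cL bL dL]]] := series_first_order h r00 dl0 rr.
  have D1 : is_cderive (p + v) (basis_rV i) f L.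
    apply: (is_cderive_quad (K := A / dl ^+ 2) dl0) => t tdl.
    by rewrite addrCA [t *: _ + v]addrC; apply: dL; exact: ltW.
  have [_ EL] := cpartialP D1.
  by split; [rewrite EL|exists (A / dl)|rewrite EL].
split=> [v hv|]; first by have [] := main v hv.
by split => // v hv; have [] := main v hv.
Qed.

End power_series.

(** * Products of power series *)

Section cauchy_product.
Context {D : nat} {A : comNzRingType}.
Local Notation idx := {ffun 'I_D -> nat}.
Implicit Types (x y z : idx) (c b F : idx -> A).

Definition madd x y : idx := [ffun j => (x j + y j)%N].
Definition msub x y : idx := [ffun j => (x j - y j)%N].
Definition mle x y : bool := [forall j, x j <= y j]%N.

Lemma maddKr y z : msub (madd y z) y = z.
Proof. by apply/ffunP => j; rewrite !ffunE addKn. Qed.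
Lemma mle_add y z : mle y (madd y z).
Proof. by apply/forallP => j; rewrite ffunE leq_addr. Qed.
Lemma msubKC y x : mle y x -> madd y (msub x y) = x.
Proof. by move=> /forallP h; apply/ffunP => j; rewrite !ffunE subnKC. Qed.
Lemma madd_inj y : injective (madd y).
Proof. by move=> z z' /(congr1 (msub^~ y)); rewrite !maddKr. Qed.
Lemma cube_mle N y x : mle y x -> x \in cube N -> y \in cube N.
Proof.
move=> /forallP h; rewrite !mem_cube => /forallP k; apply/forallP => j.
exact: leq_ltn_trans (h j) (k j).
Qed.
Lemma cube_max x : x \in cube (\max_j x j).+1.
Proof. by rewrite mem_cube; apply/forallP => j; rewrite ltnS leq_bigmax. Qed.

(** The convolution of coefficients; the sum is taken over a cube large enough to contain every
   index below [x]. *)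
Definition conv c b x : A :=
  \sum_(y <- cube (\max_j x j).+1 | mle y x) c y * b (msub x y).

Lemma conv_cube N c b x : x \in cube N ->
  conv c b x = \sum_(y <- cube N | mle y x) c y * b (msub x y).
Proof.
move=> xN; apply: perm_sum; rewrite ?cube_uniq// => y.
case yx: (mle y x); rewrite ?andbF// !andbT.
by rewrite (cube_mle yx xN) (cube_mle yx (cube_max x)).
Qed.

Lemma sum_conv N c b F : (forall y z, F (madd y z) = F y * F z) ->
  \sum_(x <- cube N) conv c b x * F x =
  \sum_(y <- cube N) \sum_(z <- cube N | madd y z \in cube N) (c y * F y) * (b z * F z).
Proof.
move=> Fm.
rewrite big_seq_cond (eq_bigr (fun x => \sum_(y <- cube N | mle y x)
    c y * b (msub x y) * F x)); last first.
  by move=> x; rewrite andbT => xN; rewrite (conv_cube _ _ xN) mulr_suml.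
rewrite -big_seq_cond (exchange_big_dep predT)//=; apply: eq_bigr => y _.
rewrite -[RHS]big_filter.
rewrite [RHS](eq_bigr (fun z => c y * b (msub (madd y z) y) * F (madd y z))); last first.
  by move=> z _; rewrite maddKr Fm mulrACA.
rewrite -(big_map (madd y) xpredT (fun x => c y * b (msub x y) * F x)).
apply: perm_sum; rewrite ?cube_uniq//.
  by rewrite map_inj_uniq ?filter_uniq ?cube_uniq//; exact: madd_inj.
move=> x; rewrite andbT; apply/andP/mapP => [[xN yx]|[z]].
  exists (msub x y); last by rewrite msubKC.
  rewrite mem_filter msubKC// xN /= (cube_mle _ xN)//.
  by apply/forallP => j; rewrite ffunE leq_subr.
by rewrite mem_filter => /andP[h _] ->; rewrite mle_add.
Qed.

End cauchy_product.

Section series_closure.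
Context {R : realType} {D : nat}.
Local Notation V := 'rV[R]_D.
Local Notation idx := {ffun 'I_D -> nat}.
Implicit Types (x y z : idx) (v p : V) (i j : 'I_D) (f g : V -> R[i]) (c b : idx -> R[i]).

Lemma has_series_lin f g p c b r (k l : R[i]) : has_series f p c r -> has_series g p b r ->
  has_series (fun v => k * f v + l * g v) p (fun x => k * c x + l * b x) r.
Proof.
move=> [r0 hf] [_ hg]; split => // v hv.
have [[A hA] cf] := hf v hv; have [[B hB] cg] := hg v hv; split.
  exists (normc k * A + normc l * B) => N.
  apply: (@le_trans _ _ (normc k * (\sum_(x <- cube N) normc (c x) * `|monomial x v|) +
     normc l * (\sum_(x <- cube N) normc (b x) * `|monomial x v|))).
    rewrite !mulr_sumr -big_split /=; apply: ler_sum => x _.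
    by rewrite !mulrA -mulrDl ler_wpM2r// (le_trans (normcD _ _))// !normcM.
  by rewrite lerD// ler_wpM2l ?normc_ge0.
have := ccvgD (ccvgZ k cf) (ccvgZ l cg); rewrite /ccvg.
under eq_fun => N.
  rewrite !mulr_sumr -big_split /=.
  under eq_bigr do rewrite !mulrA -mulrDl.
  over.
exact.
Qed.

Lemma has_series_cst p (k : R[i]) :
  has_series (fun=> k) p (fun x => if [forall j, x j == 0%N] then k else 0) 1.
Proof.
split => // v _; pose x0 : idx := [ffun=> 0%N].
have x0P x : [forall j, x j == 0%N] = (x == x0).
  apply/forallP/eqP => [h|-> j]; last by rewrite ffunE.
  by apply/ffunP => j; rewrite ffunE; exact/eqP.
have E (A : nmodType) N (F : idx -> A) : (forall x, x != x0 -> F x = 0) ->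
    \sum_(x <- cube N) F x = if x0 \in cube N then F x0 else 0.
  move=> h; case: ifPn => hx.
    by rewrite (bigD1_seq x0) ?cube_uniq//= big1 ?addr0.
  rewrite big1_seq// => x /= xN; apply: h; apply: contraNneq hx => <- //.
have m0 : monomial x0 v = 1 by rewrite /monomial big1// => j _; rewrite ffunE expr0.
split.
  exists (normc k) => N; rewrite (E R) => [|x /negbTE h]; last first.
    by rewrite x0P h normc0 mul0r.
  by rewrite x0P eqxx m0 normr1 mulr1; case: ifP => // _; exact: normc_ge0.
rewrite /ccvg; apply: cvg_near_cst.
near=> N; rewrite E => [|x /negbTE h]; last by rewrite x0P h mul0r.
rewrite x0P eqxx m0 mulr1 ifT ?subrr ?normc0//.
rewrite mem_cube; apply/forallP => j; rewrite ffunE.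
by near: N; exists 1%N.
Unshelve. all: by end_near. Qed.

Lemma monomial_add x y v : monomial (madd x y) v = monomial x v * monomial y v.
Proof. by rewrite /monomial -big_split; apply: eq_bigr => j _; rewrite ffunE exprD. Qed.

(** Cauchy product: the pairs left out of the cube of side [N] have one index outside the cube of
   side [N / 2], so their mass is a tail. *)
Lemma has_series_mul f g p c b r : has_series f p c r -> has_series g p b r ->
  has_series (fun v => f v * g v) p (conv c b) r.
Proof.
move=> [r0 hf] [_ hg]; split => // v hv.
have [[A hA] cf] := hf v hv; have [[B hB] cg] := hg v hv.
pose ta x := c x * (monomial x v)%:C; pose tb x := b x * (monomial x v)%:C.
have na x : normc (ta x) = normc (c x) * `|monomial x v| by rewrite normcM normc_real.
have nb x : normc (tb x) = normc (b x) * `|monomial x v| by rewrite normcM normc_real.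
have {}hA N : \sum_(x <- cube N) normc (ta x) <= A.
  by under eq_bigr do rewrite na.
have {}hB N : \sum_(x <- cube N) normc (tb x) <= B.
  by under eq_bigr do rewrite nb.
pose a N := \sum_(x <- cube N) normc (ta x).
pose a' N := \sum_(x <- cube N) normc (tb x).
have a0 N : 0 <= a N by apply: sumr_ge0 => x _; exact: normc_ge0.
have a'0 N : 0 <= a' N by apply: sumr_ge0 => x _; exact: normc_ge0.
have prodE (T : comNzRingType) N (F G : idx -> T) :
    (\sum_(x <- cube N) F x) * (\sum_(x <- cube N) G x) =
    \sum_(y <- cube N) \sum_(z <- cube N) F y * G z.
  by rewrite mulr_suml; apply: eq_bigr => y _; rewrite mulr_sumr.
split.
  exists (A * B) => N.
  pose ac x := normc (c x); pose ab x := normc (b x).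
  apply: (@le_trans _ _ (\sum_(x <- cube N) conv ac ab x * `|monomial x v|)).
    apply: ler_sum => x _; rewrite ler_wpM2r// (le_trans (normc_sum _ _ _))//.
    by apply: ler_sum => y _; rewrite normcM.
  rewrite sum_conv; last by move=> y z; rewrite monomial_add normrM.
  apply: (@le_trans _ _ (a N * a' N)); last by apply: ler_pM; rewrite ?a0 ?a'0 ?hA ?hB.
  rewrite prodE; apply: ler_sum => y _.
  rewrite na; under [leRHS]eq_bigr do rewrite nb.
  apply: (@nonneg_subsum _ _ _ predT) => // z.
  by rewrite !mulr_ge0 ?normc_ge0.
apply: (ccvg_close (ccvgM cf cg)).
  move=> N; rewrite sum_conv; last by move=> y z; rewrite monomial_add rmorphM.
  rewrite prodE -sumrB (le_trans (normc_sum _ _ _))//.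
  have : (N./2 <= N)%N by rewrite -{2}(odd_double_half N) -addnn addnA leq_addl.
  move=> mN.
  apply: (@le_trans _ _ (a N * a' N - a (N./2) * a' (N./2))); last exact: lexx.
  rewrite prodE [a (N./2) * _]prodE (sum_cube_sub _ mN).
  under [X in _ - X]eq_bigr do rewrite (sum_cube_sub _ mN).
  rewrite [X in _ - X]big_mkcond -sumrB; apply: ler_sum => y _.
  rewrite normcB [X in normc (X - _)](bigID (fun z => madd y z \in cube N)) /=.
  rewrite addrAC subrr add0r (le_trans (normc_sum _ _ _))//.
  have T0 z : 0 <= normc (ta y) * normc (tb z) by rewrite mulr_ge0 ?normc_ge0.
  case: ifPn => ym; last first.
    rewrite subr0; under [leLHS]eq_bigr do rewrite normcM.
    exact: (@nonneg_subsum _ _ _ predT).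
  rewrite [X in _ <= X - _](bigID (fun z => z \in cube N./2)) /= addrAC subrr add0r.
  under [leLHS]eq_bigr do rewrite normcM.
  apply: nonneg_subsum => // z; apply: contra => zm.
  move: ym zm; rewrite !mem_cube => /forallP hy /forallP hz; apply/forallP => j.
  rewrite ffunE; apply: (@leq_trans (N./2 + N./2)%N).
    by rewrite -addSn leq_add// ltnW.
  by rewrite addnn -{2}(odd_double_half N) leq_addl.
have ca : cvgn a := cube_mass_cvg hA.
have cb : cvgn a' := cube_mass_cvg hB.
have hoo : N./2 @[N --> \oo] --> \oo.
  apply/cvgnyPge => k; near=> N.
  have : (k.*2 <= N)%N by near: N; exists k.*2.
  by move/half_leq; rewrite doubleK.
rewrite -[0](subrr (limn a * limn a')); apply: cvgB; apply: cvgM => //.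
  exact: (@cvg_comp _ _ _ _ a _ _ _ hoo ca).
exact: (@cvg_comp _ _ _ _ a' _ _ _ hoo cb).
Unshelve. all: by end_near. Qed.

Definition analytic_at f p : Prop := exists c r, has_series f p c r.

Lemma analytic_at_cst k p : analytic_at (fun=> k) p.
Proof. by eexists; eexists; exact: has_series_cst. Qed.

Lemma analytic_at_lin f g p k l : analytic_at f p -> analytic_at g p ->
  analytic_at (fun v => k * f v + l * g v) p.
Proof.
move=> [c [r h]] [b [s h']].
have r0 : 0 < r by case: h. have s0 : 0 < s by case: h'.
have m0 : 0 < Num.min r s by rewrite lt_min r0.
eexists; exists (Num.min r s); apply: has_series_lin.
  by apply: has_series_restrict h _ _ => //; rewrite ge_min lexx.
by apply: has_series_restrict h' _ _ => //; rewrite ge_min lexx orbT.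
Qed.

Lemma analytic_at_mul f g p : analytic_at f p -> analytic_at g p ->
  analytic_at (fun v => f v * g v) p.
Proof.
move=> [c [r h]] [b [s h']].
have r0 : 0 < r by case: h. have s0 : 0 < s by case: h'.
have m0 : 0 < Num.min r s by rewrite lt_min r0.
eexists; exists (Num.min r s); apply: has_series_mul.
  by apply: has_series_restrict h _ _ => //; rewrite ge_min lexx.
by apply: has_series_restrict h' _ _ => //; rewrite ge_min lexx orbT.
Qed.

Lemma analytic_at_prod I (s : seq I) (P : pred I) (F : I -> V -> R[i]) p :
  (forall k, P k -> analytic_at (F k) p) ->
  analytic_at (fun v => \prod_(k <- s | P k) F k v) p.
Proof.
move=> h; elim: s => [|e s IH].
  rewrite (_ : (fun v => _) = fun=> 1); first exact: analytic_at_cst.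
  by apply/funext => v; rewrite big_nil.
rewrite (_ : (fun v => _) = fun v => (if P e then F e v else 1) * \prod_(k <- s | P k) F k v).
  apply: analytic_at_mul IH; case Pe: (P e) => //; [exact: h|exact: analytic_at_cst].
by apply/funext => v; rewrite big_cons; case: (P e); rewrite ?mul1r.
Qed.

Lemma normc_cexp_term k (w : R[i]) : normc (cexp_term k w) = normc w ^+ k / (k`!)%:R.
Proof. by rewrite /cexp_term normcM normcX normcV normc_nat. Qed.

Lemma cexp_sum_norm_le N (w : R[i]) :
  \sum_(k < N) normc (cexp_term k w) <= expR (normc w).
Proof.
under eq_bigr do rewrite normc_cexp_term.
have := @nondecreasing_cvgn_le R (series (exp_coeff (normc w))).
have nd : nondecreasing_seq (series (exp_coeff (normc w))).
  apply/nondecreasing_seqP => k; rewrite seriesSr lerDl /exp_coeff /=.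
  by rewrite divr_ge0 ?exprn_ge0 ?normc_ge0.
move=> /(_ nd (is_cvg_series_exp_coeff _) N).
by rewrite /series /= big_mkord.
Qed.

Lemma cexp_sum_cvg (w : R[i]) : ccvg (fun N => cexp_sum N w) (cexp w).
Proof.
apply: (@ccvg_squeeze _ _ _ (fun N => exp_coeff (normc w) N * expR (normc w))).
  by move=> N; rewrite normcB; exact: normc_cexp_tail.
rewrite -(mul0r (expR (normc w))); apply: cvgM; last exact: cvg_cst.
exact/cvg_series_cvg_0/is_cvg_series_exp_coeff.
Qed.

(** The monomial being square-free, the exponential series is already a power series: its [k]-th
   term sits at the multi-index equal to [k] on [S] and to [0] elsewhere. *)
Lemma analytic_at_cexp_monomial (S : {set 'I_D}) (kap : R[i]) p (i0 : 'I_D) : i0 \in S ->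
  analytic_at (fun v => cexp (kap * (\prod_(j in S) (v - p) ord0 j)%:C)) p.
Proof.
move=> i0S.
pose ray k : idx := [ffun j => if j \in S then k else 0%N].
pose c x := if x == ray (x i0) then kap ^+ x i0 / ((x i0)`!)%:R else 0.
exists c, 1; split => // v _.
pose w := kap * (\prod_(j in S) v ord0 j)%:C.
have rayi0 k : ray k i0 = k by rewrite ffunE i0S.
have mray k : monomial (ray k) v = (\prod_(j in S) v ord0 j) ^+ k.
  rewrite -prodrXl /monomial [RHS]big_mkcond; apply: eq_bigr => j _; rewrite ffunE.
  by case: ifP; rewrite ?expr0.
have E (A : nmodType) N (F : idx -> A) : (forall x, x != ray (x i0) -> F x = 0) ->
    \sum_(x <- cube N) F x = \sum_(k < N) F (ray k).
  move=> h; rewrite (bigID (fun x => x == ray (x i0))) /= [X in _ + X]big1 ?addr0//.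
  rewrite -(big_mkord xpredT (fun k => F (ray k))) -(big_map ray xpredT F).
  apply: perm_sum; rewrite ?cube_uniq//.
    rewrite map_inj_uniq ?iota_uniq// => k l /(congr1 (fun x : idx => x i0)).
    by rewrite !rayi0.
  move=> x; rewrite andbT; apply/andP/mapP => [[xN /eqP xr]|[k]].
    exists (x i0) => //; rewrite mem_index_iota /=.
    by move: xN; rewrite mem_cube => /forallP.
  rewrite mem_index_iota /= => kN ->; rewrite rayi0; split => //.
  rewrite mem_cube; apply/forallP => j; rewrite ffunE; case: ifP => // _.
  exact: leq_ltn_trans kN.
have term k : c (ray k) * (monomial (ray k) v)%:C = cexp_term k w.
  by rewrite /c rayi0 eqxx mray /cexp_term /w exprMn rmorphXn mulrAC.
split.
  exists (expR (normc w)) => N.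
  rewrite E => [|x /negbTE h]; last by rewrite /c h normc0 mul0r.
  apply: le_trans (cexp_sum_norm_le N w); apply: ler_sum => k _.
  by rewrite -term normcM normc_real.
rewrite addrC addKr -/w; have := cexp_sum_cvg w; rewrite /ccvg.
rewrite (_ : (fun N => normc (cexp_sum N w - _)) = (fun N => normc
   (\sum_(x <- cube N) c x * (monomial x v)%:C - cexp w)))//.
apply/funext => N; rewrite E => [|x /negbTE h]; last by rewrite /c h mul0r.
by under eq_bigr do rewrite term.
Qed.

End series_closure.

(** * Laplace transforms of functionals *)

Section laplace_transform.
Context {R : realType} {d D : nat}.
Local Notation V := 'rV[R]_d.
Local Notation W := 'rV[R]_D.
Local Notation idx := {ffun 'I_D -> nat}.
Local Notation diffn := differentiable_upto.
Local Notation Bd := dominated_upto.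

Lemma exp_bounded_sum (L : (V -> R[i]) -> R[i]) I (s : seq I) (F : I -> V -> R[i]) (k : I -> R[i]) :
  exp_bounded L -> (forall i, exp_type (F i)) ->
  L (fun T => \sum_(i <- s) k i * F i T) = \sum_(i <- s) k i * L (F i).
Proof.
move=> [lin _] hF; elim: s => [|i s IH].
  have L0 : L (fun=> 0) = 0.
    have := lin 0 0 _ _ (exp_type_cst 0) (exp_type_cst 0).
    by rewrite !mul0r addr0.
  rewrite big_nil -[RHS]L0; congr L; apply/funext => T.
  by rewrite big_nil.
rewrite big_cons -IH -[X in _ + X]mul1r -lin//.
  by congr L; apply/funext => T; rewrite big_cons mul1r.
by apply: exp_type_sum => j _; exact: exp_typeZ.
Qed.

Lemma exp_boundedZ (L : (V -> R[i]) -> R[i]) k Q : exp_bounded L -> exp_type Q ->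
  L (fun T => k * Q T) = k * L Q.
Proof.
move=> hL hQ; have := @exp_bounded_sum L unit [:: tt] (fun=> Q) (fun=> k) hL (fun=> hQ).
by rewrite big_seq1 => <-; congr L; apply/funext => T; rewrite big_seq1.
Qed.

Section products.
Variables (N : nat) (s : R).
Hypothesis s0 : 0 <= s.

Lemma Bd_prod I (r : seq I) (F : I -> V -> R[i]) (b : I -> R) :
  (forall i, 0 <= b i) -> (forall i, diffn N (F i)) -> (forall i, Bd N (b i) (expw s) (F i)) ->
  Bd N (\prod_(i <- r) (2 ^+ N * b i)) (expw ((size r)%:R * s))
    (fun T => \prod_(i <- r) F i T).
Proof.
move=> b0 dF hF; elim: r => [|i r IH].
  rewrite (_ : (fun T => _) = fun=> 1); last by apply/funext => T; rewrite big_nil.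
  by apply: Bd_cst => x; rewrite big_nil mul1r normc1 expw_ge1// mulr_ge0.
rewrite (_ : (fun T => _) = fun T => F i T * \prod_(i <- r) F i T); last first.
  by apply/funext => T; rewrite big_cons.
have p0 : 0 <= \prod_(i <- r) (2 ^+ N * b i).
  by apply: prodr_ge0 => j _; rewrite mulr_ge0// exprn_ge0.
have := BdM (b0 i) p0 (expw_ge0 s) (expw_ge0 ((size r)%:R * s)) (dF i)
  (diffn_prod r (P := xpredT) (fun j _ => dF j)) (hF i) IH.
apply: Bd_mono => x; rewrite big_cons /= -[(size r).+1%:R]natr1 mulrDl mul1r addrC expwD.
by apply: le_of_eq; ring.
Qed.

(** Telescoping: a product of nearly equal factors is nearly equal. *)
Lemma Bd_prod_diff I (r : seq I) (E S : I -> nat -> V -> R[i]) (b th : R) :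
  0 <= b -> 0 <= th ->
  (forall i k, [/\ diffn N (E i k), diffn N (S i k), Bd N b (expw s) (E i k),
    Bd N b (expw s) (S i k) &
    Bd N (b * th ^+ k) (expw s) (fun T => S i k T - E i k T)]) ->
  exists2 M, 0 <= M & forall k, Bd N (M * th ^+ k) (expw ((size r)%:R * s))
     (fun T => \prod_(i <- r) S i k T - \prod_(i <- r) E i k T).
Proof.
move=> b0 th0 h; elim: r => [|i r [M M0 IH]].
  exists 0 => // k; rewrite (_ : (fun T => _) = fun=> 0).
    by apply: Bd_cst => x; rewrite mul0r mul0r normc0.
  by apply/funext => T; rewrite !big_nil subrr.
set P := \prod_(i <- r) (2 ^+ N * b).
have P0 : 0 <= P by apply: prodr_ge0 => j _; rewrite mulr_ge0// exprn_ge0.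
exists (2 ^+ N * (b * P) + 2 ^+ N * (b * M)) => [|k].
  by rewrite addr_ge0// !mulr_ge0 ?exprn_ge0.
have tk : 0 <= th ^+ k by exact: exprn_ge0.
rewrite (_ : (fun T => _) = fun T => (S i k T - E i k T) * \prod_(i <- r) S i k T +
    E i k T * (\prod_(i <- r) S i k T - \prod_(i <- r) E i k T)); last first.
  by apply/funext => T; rewrite !big_cons; ring.
have dN f : diffn N f -> diffn N (fun T => - f T).
  move=> hf; rewrite (_ : (fun T => _) = fun T => -1 * f T); first exact: diffnZ.
  by apply/funext => T; rewrite mulN1r.
have dS : diffn N (fun T => \prod_(i <- r) S i k T).
  by apply: diffn_prod => j _; have [] := h j k.
have dE : diffn N (fun T => \prod_(i <- r) E i k T).
  by apply: diffn_prod => j _; have [] := h j k.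
have [dEi dSi hEi hSi hd] := h i k.
have dd : diffn N (fun T => S i k T - E i k T) by apply: diffnD => //; exact: dN.
have dd' : diffn N (fun T => \prod_(i <- r) S i k T - \prod_(i <- r) E i k T).
  by apply: diffnD => //; exact: dN.
rewrite [X in Bd _ X](_ : _ = 2 ^+ N * (b * th ^+ k * P) + 2 ^+ N * (b * (M * th ^+ k))); last by ring.
have Q0 : 0 <= b * th ^+ k by exact: mulr_ge0.
have Q1 : 0 <= M * th ^+ k by exact: mulr_ge0.
have hP : Bd N P (expw ((size r)%:R * s)) (fun T => \prod_(i <- r) S i k T).
  by apply: Bd_prod => // j; have [] := h j k.
apply: BdD; [exact: diffnM|exact: diffnM| |].
  have := BdM Q0 P0 (expw_ge0 s) (expw_ge0 ((size r)%:R * s)) dd dS hd hP.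
  by apply: Bd_mono => x; rewrite /= -[(size r).+1%:R]natr1 mulrDl mul1r addrC expwD.
have := BdM b0 Q1 (expw_ge0 s) (expw_ge0 ((size r)%:R * s)) dEi dd' hEi (IH k).
by apply: Bd_mono => x; rewrite /= -[(size r).+1%:R]natr1 mulrDl mul1r addrC expwD.
Qed.

End products.

Variables (L : (V -> R[i]) -> R[i]) (mu : 'I_D -> 'I_d -> R[i]).
Hypothesis hL : exp_bounded L.

(** When [L] is integration against a measure, [laplace] is its Laplace transform along the linear
   forms [mu i]. *)
Definition expkernel (Z : W) (T : V) : R[i] := cexp (\sum_i (Z ord0 i)%:C * linform (mu i) T).
Definition laplace (Z : W) : R[i] := L (expkernel Z).

Lemma expkernelD Z v T : expkernel (Z + v) T = expkernel Z T * expkernel v T.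
Proof.
rewrite /expkernel -cexpD -big_split /=; congr cexp; apply: eq_bigr => i _.
by rewrite mxE rmorphD mulrDl.
Qed.

Lemma expkernelE Z : expkernel Z =
  fun T => cexp (linform (fun j => \sum_i (Z ord0 i)%:C * mu i j) T).
Proof.
apply/funext => T; congr cexp; rewrite /linform.
under [RHS]eq_bigr do rewrite mulr_suml.
rewrite exchange_big /=; apply: eq_bigr => i _; rewrite mulr_sumr.
by apply: eq_bigr => j _; rewrite mulrA.
Qed.

Lemma exp_type_expkernel Z : exp_type (expkernel Z).
Proof. by rewrite expkernelE; exact: exp_type_cexp_linform. Qed.

Definition laplace_coef (Z : W) (x : idx) : R[i] :=
  L (fun T => expkernel Z T * \prod_i cexp_term (x i) (linform (mu i) T)).

Lemma cexp_term_scale (t : R[i]) k w : cexp_term k (t * w) = t ^+ k * cexp_term k w.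
Proof. by rewrite /cexp_term exprMn mulrA. Qed.

Lemma prod_sum_cube N (F : 'I_D -> nat -> R[i]) :
  \prod_i \sum_(k < N) F i k = \sum_(x <- cube N) \prod_i F i (x i).
Proof.
rewrite (bigA_distr_bigA (fun i (k : 'I_N) => F i k)) /=.
exact: (sum_cube N (fun a => \prod_i F i (a i))).
Qed.

Lemma prod_sum_cubeR N (F : 'I_D -> nat -> R) :
  \prod_i \sum_(k < N) F i k = \sum_(x <- cube N) \prod_i F i (x i).
Proof.
rewrite (bigA_distr_bigA (fun i (k : 'I_N) => F i k)) /=.
exact: (sum_cube N (fun a => \prod_i F i (a i))).
Qed.

(** In [L(exp((p + v).mu))], expand the exponential of each [v_i mu_i] for [|v_i| < 1]. The weight
   [expw] is chosen for the radius [2], so that the terms and the remainders of degree [k] carry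
   a factor [2 ^ -k], in seminorms for which [L] is continuous. *)
Theorem laplace_series p : has_series laplace p (laplace_coef p) 1.
Proof.
split => // v hv.
pose m := \sum_i \sum_j normc (mu i j).
have m0 : 0 <= m by apply: sumr_ge0 => i _; apply: sumr_ge0 => j _; exact: normc_ge0.
have mum i j : normc (mu i j) <= m.
  rewrite /m (bigD1 i)//= (bigD1 j)//= -addrA lerDl addr_ge0//.
    by apply: sumr_ge0 => k _; exact: normc_ge0.
  by apply: sumr_ge0 => k _; apply: sumr_ge0 => l _; exact: normc_ge0.
(* [2] is the radius [rho] of the previous estimates, and [th = 1/2]. *)
pose Th := 2 * m + 1.
have Th1 : 1 <= Th by rewrite lerDr mulr_ge0.
have Th0 : 0 <= Th by exact: le_trans Th1.
have mTh : 2 * m <= Th by rewrite lerDl.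
have h0 : (0 : R) < 2^-1 by [].
have h1 : (2^-1 : R) <= 1 by lra.
have h2 : (0 : R) < 2 by [].
have vle i : `|v ord0 i| <= 2^-1 * 2 by rewrite mulVf// ltW.
pose s := 2 * (2 * m).
have s0 : 0 <= s by rewrite !mulr_ge0.
pose lam j : R[i] := \sum_i (p ord0 i)%:C * mu i j.
have [m' m'0 hm'] := linform_bound lam.
pose st := m' + (size (index_enum 'I_D))%:R * s.
have st0 : 0 <= st by rewrite addr_ge0// mulr_ge0.
have [_ /(_ st st0)[N [K [K0 hK]]]] := hL.
pose E0 := (m' + 1) ^+ N.
have E00 : 0 <= E0 by rewrite exprn_ge0// addr_ge0.
have hE0 : Bd N E0 (expw m') (expkernel p).
  by rewrite expkernelE; apply: Bd_cexp_linform => //; rewrite ?lerDl ?lerDr.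
have dE0 : diffn N (expkernel p) by case: (exp_type_expkernel p).
pose lf i T := (v ord0 i)%:C * linform (mu i) T.
have eterm (k : 'I_D -> nat) : exp_type (fun T => \prod_i cexp_term (k i) (linform (mu i) T)).
  by apply: exp_type_prod => i _; exact: exp_type_term.
have LE (Q : V -> R[i]) (B : R) : 0 <= B -> exp_type Q ->
    Bd N B (expw ((size (index_enum 'I_D))%:R * s)) Q ->
    normc (L (fun T => expkernel p T * Q T)) <= K * (2 ^+ N * (E0 * B)).
  move=> B0 eQ hQ; apply: hK.
  - by rewrite !mulr_ge0// exprn_ge0.
  - by apply: exp_typeM => //; exact: exp_type_expkernel.
  - have dQ : diffn N Q by case: eQ.
    have := BdM E00 B0 (expw_ge0 m') (expw_ge0 ((size (index_enum 'I_D))%:R * s)) dE0 dQ hE0 hQ.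
    by apply: Bd_mono => x; rewrite /st expwD.
have coefv (x : idx) : laplace_coef p x * (monomial x v)%:C =
    L (fun T => expkernel p T * \prod_i cexp_term (x i) (lf i T)).
  rewrite mulrC /laplace_coef -exp_boundedZ//; last first.
    by apply: exp_typeM; [exact: exp_type_expkernel|exact: eterm].
  congr L; apply/funext => T; rewrite mulrCA; congr (_ * _).
  rewrite /monomial rmorph_prod -big_split; apply: eq_bigr => i _.
  by rewrite /lf cexp_term_scale rmorphXn.
split.
  pose C := K * (2 ^+ N * (E0 * \prod_(i < D) (2 ^+ N * Th ^+ N))).
  have C0 : 0 <= C.
    have P0 : 0 <= \prod_(i < D) (2 ^+ N * Th ^+ N).
      by apply: prodr_ge0 => i _; rewrite mulr_ge0 ?exprn_ge0.
    by apply: mulr_ge0 => //; apply: mulr_ge0; rewrite ?exprn_ge0// mulr_ge0.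
  have bnd (x : idx) : normc (laplace_coef p x) * `|monomial x v| <=
      C * \prod_i (2^-1 : R) ^+ x i.
    rewrite -normc_real -normcM coefv.
    rewrite /C -!mulrA -big_split /=.
    apply: LE.
    - by apply: prodr_ge0 => i _; rewrite !mulr_ge0 ?exprn_ge0.
    - have h := eterm x.
      rewrite (_ : (fun T => _) = fun T => (monomial x v)%:C *
         \prod_i cexp_term (x i) (linform (mu i) T)); first exact: exp_typeZ.
      apply/funext => T; rewrite /monomial rmorph_prod -big_split; apply: eq_bigr => i _.
      by rewrite /lf cexp_term_scale rmorphXn.
    - under eq_bigr do rewrite -mulrA.
      apply: Bd_prod => //.
      + by move=> i; rewrite !mulr_ge0 ?exprn_ge0.
      + by move=> i; exact: diffn_term.
      + move=> i; have := Bd_term (mum i) m0 h0 h2 Th1 mTh (vle i) N (x i).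
        apply: Bd_mono => y; rewrite ler_wpM2l ?mulr_ge0 ?exprn_ge0// expw_le//.
        by rewrite /s ler_peMl ?ler1n ?mulr_ge0.
  exists (C * 2 ^+ D) => M.
  apply: (@le_trans _ _ (\sum_(x <- cube M) C * \prod_i (2^-1 : R) ^+ x i)).
    by apply: ler_sum => x _.
  rewrite -mulr_sumr -(prod_sum_cubeR M (fun _ k => 2^-1 ^+ k)) ler_wpM2l//.
  have S0 : 0 <= \sum_(k < M) (2^-1 : R) ^+ k.
    by apply: sumr_ge0 => k _; rewrite exprn_ge0.
  rewrite prodr_const card_ord lerXn2r ?nnegrE//.
  have : \sum_(k < M) (2^-1 : R) ^+ k = 2 - 2 * 2^-1 ^+ M.
    elim: M {S0} => [|M IH]; first by rewrite big_ord0 expr0; ring.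
    by rewrite big_ord_recr /= IH exprS; field.
  by move=> ->; rewrite gerBl mulr_ge0// exprn_ge0.
have sumL M : \sum_(x <- cube M) laplace_coef p x * (monomial x v)%:C =
    L (fun T => expkernel p T * \prod_i cexp_sum M (lf i T)).
  under eq_bigr do rewrite mulrC.
  rewrite -exp_bounded_sum//; last first.
    by move=> x; apply: exp_typeM; [exact: exp_type_expkernel|exact: eterm].
  congr L; apply/funext => T.
  rewrite /cexp_sum (prod_sum_cube M (fun i k => cexp_term k (lf i T))) mulr_sumr.
  apply: eq_bigr => x _; rewrite mulrCA; congr (_ * _).
  rewrite /monomial rmorph_prod -big_split; apply: eq_bigr => i _.
  by rewrite /lf cexp_term_scale rmorphXn.
pose b := 2 * Th ^+ N.
have b0 : 0 <= b by rewrite mulr_ge0 ?exprn_ge0.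
have hth0 : (0 : R) <= 2^-1 by [].
have [|M M0 hM] := @Bd_prod_diff N s s0 'I_D (index_enum 'I_D)
   (fun i k T => cexp (lf i T)) (fun i k T => cexp_sum k (lf i T)) b 2^-1 b0 hth0.
  move=> i k; split.
  - exact: diffn_cexp_lf.
  - exact: diffn_cexp_sum.
  - have := Bd_cexp_lf (mum i) m0 h0 h1 h2 Th1 mTh (vle i) N.
    apply: Bd_mono => x; rewrite ler_wpM2r ?expw_ge0// /b mulr_natl mulr2n lerDl.
    by rewrite exprn_ge0.
  - exact: (Bd_cexp_sum (mum i) m0 h0 h1 h2 Th1 mTh (vle i) N k).
  - have := BdZ (-1) (diffn_tail _ _ N k) (Bd_tail (mum i) m0 h0 h1 h2 Th1 mTh (vle i) N k).
    rewrite (_ : (fun x => -1 * _) = fun T => cexp_sum k (lf i T) - cexp (lf i T)).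
      apply: Bd_mono => x; rewrite ler_wpM2r ?expw_ge0// normcN normc1 mul1r.
      rewrite ler_wpM2r ?exprn_ge0// /b mulr_natl mulr2n lerDl.
      by rewrite exprn_ge0.
    by apply/funext => T; rewrite /cexp_tail; ring.
apply: (@ccvg_squeeze _ _ _ (fun k => K * (2 ^+ N * (E0 * (M * 2^-1 ^+ k))))).
  move=> k; rewrite sumL /laplace.
  have [lin _] := hL.
  have e1 : exp_type (fun T => expkernel p T * \prod_i cexp_sum k (lf i T)).
    apply: exp_typeM; first exact: exp_type_expkernel.
    apply: exp_type_prod => i _; apply: exp_type_sum => l _.
    rewrite (_ : (fun T => _) = fun T => (v ord0 i)%:C ^+ l * cexp_term l (linform (mu i) T)).
      by apply: exp_typeZ; exact: exp_type_term.
    by apply/funext => T; rewrite -cexp_term_scale.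
  have := lin 1 (-1) _ _ e1 (exp_type_expkernel (p + v)).
  rewrite mul1r mulN1r => <-.
  have E T : expkernel v T = \prod_i cexp (lf i T) by rewrite /expkernel cexp_bigsum.
  rewrite (_ : (fun T => _) = fun T => expkernel p T *
     (\prod_i cexp_sum k (lf i T) - \prod_i cexp (lf i T))); last first.
    by apply/funext => T; rewrite expkernelD E; ring.
  apply: LE => //; first by rewrite mulr_ge0// exprn_ge0.
  rewrite (_ : (fun T => _) = fun T => \prod_i cexp_sum k (lf i T) + -1 * expkernel v T).
    apply: exp_typeD.
      apply: exp_type_prod => i _; apply: exp_type_sum => l _.
      rewrite (_ : (fun T => _) = fun T => (v ord0 i)%:C ^+ l * cexp_term l (linform (mu i) T)).
        by apply: exp_typeZ; exact: exp_type_term.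
      by apply/funext => T; rewrite -cexp_term_scale.
    by apply: exp_typeZ; exact: exp_type_expkernel.
  by apply/funext => T; rewrite E; ring.
rewrite -[0](mulr0 (K * (2 ^+ N * (E0 * M)))).
under eq_fun do rewrite !mulrA.
rewrite !mulrA; apply: cvgMr.
by apply: cvg_expr; rewrite ger0_norm//; lra.
Qed.

Lemma laplace_coef1 p (i : 'I_D) :
  dcoef i (laplace_coef p) [ffun=> 0%N] = L (fun T => expkernel p T * linform (mu i) T).
Proof.
rewrite /dcoef ffunE mul1r; congr L; apply/funext => T; congr (_ * _).
rewrite (bigD1 i)//= big1 => [|j ji]; rewrite !ffunE.
  by rewrite eqxx /cexp_term expr1 factS fact0 divr1 mulr1.
by rewrite (negbTE ji) cexp_term0.
Qed.

(** Differentiation under the bracket, read off the power series. *)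
Lemma is_cderive_laplace p (i : 'I_D) :
  is_cderive p (basis_rV i) laplace (L (fun T => expkernel p T * linform (mu i) T)).
Proof.
have [h hs] := series_derive i (laplace_series p).
have z j : `|(0 : W) ord0 j| < 1 by rewrite mxE normr0.
have := h 0 z; rewrite addr0 => h'; apply: is_cderive_eq h' _.
have [_ /(_ 0 z)[_ c]] := hs; rewrite addr0 in c.
apply: (ccvg_unique c); rewrite -laplace_coef1.
rewrite /ccvg; apply: cvg_near_cst; near=> N.
rewrite (bigD1_seq [ffun=> 0%N]) ?cube_uniq//=; last first.
  rewrite mem_cube; apply/forallP => j; rewrite ffunE.
  by near: N; exists 1%N.
rewrite [X in _ * X]( _ : _ = 1); last first.
  by rewrite /monomial big1// => j _; rewrite ffunE expr0.
rewrite big1 ?mulr1 ?addr0 ?subrr ?normc0// => x x0.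
suff -> : monomial x (0 : W) = 0 by rewrite mulr0.
have [j xj] : exists j, x j != 0%N.
  apply/existsP; apply: contraR x0; rewrite negb_exists => /forallP h0.
  by apply/eqP/ffunP => j; rewrite ffunE; apply/eqP; have := h0 j; rewrite negbK.
by rewrite (monomialE j) mxE expr0n (negbTE xj) mul0r.
Unshelve. all: by end_near. Qed.

End laplace_transform.

(** * Analytic continuation *)

Section analytic_functions.
Context {R : realType} {D : nat}.
Local Notation W := 'rV[R]_D.
Local Notation idx := {ffun 'I_D -> nat}.
Implicit Types (f g : W -> R[i]) (p v w : W) (i j : 'I_D) (c : idx -> R[i]).

Lemma real_analytic_at f : real_analytic f <-> forall p, analytic_at f p.
Proof. exact: real_analyticP. Qed.

Lemma real_analytic_lin f g k l : real_analytic f -> real_analytic g ->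
  real_analytic (fun v => k * f v + l * g v).
Proof.
rewrite !real_analytic_at => hf hg p; exact: analytic_at_lin.
Qed.

Lemma real_analytic_cpartial i f : real_analytic f -> real_analytic (cpartial i f).
Proof.
rewrite !real_analytic_at => hf p; have [c [r h]] := hf p.
by have [_ h'] := series_derive i h; exists (dcoef i c), r.
Qed.

Lemma real_analytic_partials a f : real_analytic f -> real_analytic (partials a f).
Proof. by move=> hf; elim: a => //= i a IH; exact: real_analytic_cpartial. Qed.

Lemma real_analytic_cderive f p i : real_analytic f ->
  is_cderive p (basis_rV i) f (cpartial i f p).
Proof.
rewrite real_analytic_at => /(_ p)[c [r h]].
have [h' _] := series_derive i h; have r0 : 0 < r by case: h.
by have := h' 0; rewrite addr0; apply => j; rewrite mxE normr0.
Qed.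

Lemma series_at0 f p c r : has_series f p c r -> f p = c [ffun=> 0%N].
Proof.
move=> [r0 h]; have z j : `|(0 : W) ord0 j| < r by rewrite mxE normr0.
have [_ cv] := h 0 z; rewrite addr0 in cv.
apply: (ccvg_unique cv); rewrite /ccvg; apply: cvg_near_cst; near=> N.
rewrite (bigD1_seq [ffun=> 0%N]) ?cube_uniq//=; last first.
  rewrite mem_cube; apply/forallP => j; rewrite ffunE.
  by near: N; exists 1%N.
rewrite [X in _ * X]( _ : _ = 1); last first.
  by rewrite /monomial big1// => j _; rewrite ffunE expr0.
rewrite big1 ?mulr1 ?addr0 ?subrr ?normc0// => x x0.
suff -> : monomial x (0 : W) = 0 by rewrite mulr0.
have [j xj] : exists j, x j != 0%N.
  apply/existsP; apply: contraR x0; rewrite negb_exists => /forallP h0.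
  by apply/eqP/ffunP => j; rewrite ffunE; apply/eqP; have := h0 j; rewrite negbK.
by rewrite (monomialE j) mxE expr0n (negbTE xj) mul0r.
Unshelve. all: by end_near. Qed.

Lemma cpartialC i j f : real_analytic f ->
  cpartial i (cpartial j f) = cpartial j (cpartial i f).
Proof.
rewrite real_analytic_at => hf; apply/funext => p; have [c [r h]] := hf p.
have [_ hj] := series_derive j h; have [_ hij] := series_derive i hj.
have [_ hi] := series_derive i h; have [_ hji] := series_derive j hi.
by rewrite (series_at0 hij) (series_at0 hji) dcoefC.
Qed.

Lemma analytic_first_order f p : real_analytic f -> exists dl C : R, [/\ 0 < dl, 0 <= C &
  forall i v (t : R), (forall j, `|v ord0 j| <= dl) -> `|t| <= dl ->
    normc (f (p + (v + t *: basis_rV i)) - f (p + v) - t%:C * cpartial i f (p + v))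
      <= C * t ^+ 2].
Proof.
move=> hf; have [c [r h]] := (real_analytic_at f).1 hf p.
have r0 : 0 < r by case: h.
pose dl := r / 4.
have dl0 : 0 < dl by rewrite divr_gt0.
have dlr : dl + dl < r by rewrite /dl; lra.
have [A A0 hA] := series_first_order h (ltW dl0) dl0 dlr.
exists dl, (A / dl ^+ 2); split => //; first by rewrite divr_ge0 ?sqr_ge0.
move=> i v t hv ht; have [L [_ _ hL]] := hA i v hv.
suff -> : cpartial i f (p + v) = L by exact: hL.
suff D1 : is_cderive (p + v) (basis_rV i) f L by have [_ ->] := cpartialP D1.
apply: (is_cderive_quad (K := A / dl ^+ 2) dl0) => s sdl.
by rewrite addrCA [s *: _ + v]addrC; apply: hL; exact: ltW.
Qed.

(** Partial derivatives do not control a derivative along [e_i + e_j] in general; the quadratic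
   remainders, uniform near [p], do. *)
Lemma analytic_derive_two f p i j : real_analytic f ->
  is_cderive p (basis_rV i + basis_rV j) f (cpartial i f p + cpartial j f p).
Proof.
move=> hf.
have [d1 [C1 [d10 C10 h1]]] := analytic_first_order p hf.
have [d2 [C2 [d20 C20 h2]]] := analytic_first_order p (real_analytic_cpartial i hf).
pose M := normc (cpartial j (cpartial i f) p).
have M0 : 0 <= M by exact: normc_ge0.
pose dl := Num.min d1 (Num.min d2 1).
have dl0 : 0 < dl by rewrite !lt_min d10 d20 ltr01.
apply: (is_cderive_quad (K := C1 + C1 + C2 + M) dl0) => t.
rewrite !lt_min => /andP[t1 /andP[t2 t3]].
have vj (e : R) : `|t| < e -> forall k, `|(t *: basis_rV j : W) ord0 k| <= e.
  move=> te k; rewrite !mxE normrM (le_trans _ (ltW te))// ler_piMr//.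
  by case: (_ && _); rewrite ?normr1 ?normr0.
have v0 (e : R) : `|t| < e -> forall k, `|(0 : W) ord0 k| <= e.
  by move=> te k; rewrite mxE normr0 (le_trans _ (ltW te)).
have e1 := h1 i _ t (vj _ t1) (ltW t1).
have := h1 j _ t (v0 _ t1) (ltW t1); rewrite add0r addr0 => e2.
have := h2 j _ t (v0 _ t2) (ltW t2); rewrite add0r addr0 => e3.
rewrite (_ : t *: (basis_rV i + basis_rV j) + p = p + (t *: basis_rV j + t *: basis_rV i)); last first.
  by rewrite scalerDr addrC; congr (_ + _); rewrite addrC.
move: e1 e2 e3.
set a := f (p + (_ + _)); set b := f (p + _); set a0 := f p.
set ci := cpartial i f (p + _); set c0 := cpartial i f p; set cj := cpartial j f p.
move=> e1 e2 e3.
rewrite (_ : a - a0 - t%:C * (c0 + cj) = (a - b - t%:C * ci) + (b - a0 - t%:C * cj) +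
   (t%:C * (ci - c0 - t%:C * cpartial j (cpartial i f) p) +
    t%:C * (t%:C * cpartial j (cpartial i f) p))); last by ring.
rewrite [leRHS](_ : _ = (C1 * t ^+ 2 + C1 * t ^+ 2) + (C2 * t ^+ 2 + M * t ^+ 2)); last by ring.
rewrite (le_trans (normcD _ _))// lerD//.
  by rewrite (le_trans (normcD _ _))// lerD.
rewrite (le_trans (normcD _ _))// !normcM !normc_real -/M.
have tt : `|t| * `|t| = t ^+ 2 by rewrite -expr2 real_normK ?num_real.
rewrite [`|t| * (`|t| * M)]mulrA tt [_ * M]mulrC lerD//.
rewrite (@le_trans _ _ (1 * (C2 * t ^+ 2)))//; last by rewrite mul1r.
by rewrite ler_pM ?normc_ge0// ltW.
Qed.

(** Each coefficient is, up to a factorial, the constant term of an iterated derivative. *)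
Lemma foldr_dcoef_eq0 c : (forall a, foldr dcoef c a [ffun=> 0%N] = 0) -> forall x, c x = 0.
Proof.
move=> + x; have [m] := ubnP (\sum_j x j)%N.
elim: m c x => // m IH c x xm hc.
have [/existsP[i xi]|] := boolP [exists i, x i != 0%N]; last first.
  rewrite negb_exists => /forallP h; have := hc [::] => /=.
  by congr (c _ = 0); apply/ffunP => j; rewrite ffunE; apply/esym/eqP; have := h j; rewrite negbK.
pose y : idx := [ffun j => (x j - (j == i))%N].
have xy : x = mshift i y.
  apply/ffunP => j; rewrite !ffunE subnK//.
  by case: eqVneq => // ->; rewrite lt0n.
have ym : (\sum_j y j < m)%N.
  move: xm; rewrite xy (bigD1 i)//= ffunE eqxx addn1 addSn ltnS.
  rewrite (_ : (y i + _)%N = (\sum_j y j)%N)// [RHS](bigD1 i)//=; congr addn.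
  by apply: eq_bigr => j ji; rewrite ffunE (negbTE ji) addn0.
have : dcoef i c y = 0.
  by apply: (IH (dcoef i c)) => // a; have := hc (rcons a i); rewrite foldr_rcons.
rewrite /dcoef -xy => /eqP; rewrite mulf_eq0 => /orP[|/eqP//].
by rewrite pnatr_eq0.
Qed.

(** The Taylor coefficients are, up to factorials, the derivatives at [p]. *)
Lemma flat_series_eq0 f p c r : has_series f p c r ->
  (forall a, partials a f p = 0) -> forall v, (forall j, `|v ord0 j| < r) -> f (p + v) = 0.
Proof.
move=> h flat v hv.
have hs a : has_series (partials a f) p (foldr dcoef c a) r.
  by elim: a => [|i a IH] //=; have [] := series_derive i IH.
have c0 : forall x, c x = 0.
  by apply: foldr_dcoef_eq0 => a; rewrite -(series_at0 (hs a)).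
have [_ /(_ v hv)[_ cv]] := h.
apply: (ccvg_unique cv); rewrite /ccvg.
under eq_fun do (rewrite big1 ?subrr ?normc0; last by move=> x _; rewrite c0 mul0r).
exact: cvg_cst.
Qed.

(** Homogeneity: shrinking the box by [e <= 1] multiplies each nonconstant term by at most [e]. *)
Lemma series_lipschitz f p c r : has_series f p c r -> exists A rho : R, [/\ 0 <= A, 0 < rho &
  forall (e : R) v, 0 <= e <= 1 -> (forall j, `|v ord0 j| <= e * rho) ->
    normc (f (p + v) - f p) <= e * A].
Proof.
move=> h; have [r0 hr] := h; pose rho := r / 2.
have rho0 : 0 < rho by rewrite divr_gt0.
have rhor : rho < r by rewrite /rho; lra.
have [|[A hA] _] := hr (const_mx rho).
  by move=> j; rewrite mxE ger0_norm// ltW.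
have W0 (x : idx) := weight_ge0 x (ltW rho0).
have {}hA N : \sum_(x <- cube N) normc (c x) * weight rho x <= A.
  apply: le_trans (hA N); apply: ler_sum => x _.
  by rewrite monomial_const ger0_norm.
have A0 : 0 <= A.
  apply: le_trans (hA 0%N); apply: sumr_ge0 => x _; exact: mulr_ge0 (normc_ge0 _) (W0 x).
exists A, rho; split => // e v /andP[e0 e1] hv.
have hv' j : `|v ord0 j| <= rho.
  by rewrite (le_trans (hv j))// ler_piMl// ltW.
have [_ cv] := hr v (fun j => le_lt_trans (hv' j) rhor).
pose x0 : idx := [ffun=> 0%N].
have cv' : ccvg (fun N => \sum_(x <- cube N) (if x == x0 then 0 else c x * (monomial x v)%:C)) (f (p + v) - f p).
  have cc := ccvgD cv (ccvg_cst (- f p)).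
  rewrite /ccvg in cc *; apply: cvg_trans cc; apply: near_eq_cvg; near=> N.
  congr (normc (_ - _)).
  have x0N : x0 \in cube N.
    rewrite mem_cube; apply/forallP => j; rewrite ffunE.
    by near: N; exists 1%N.
  rewrite (bigD1_seq x0) ?cube_uniq//= [in RHS](bigD1_seq x0) ?cube_uniq//= eqxx add0r.
  rewrite (series_at0 h) [X in c x0 * X](_ : _ = 1); last first.
    by rewrite /monomial big1// => j _; rewrite ffunE expr0.
  rewrite mulr1 addrAC subrr add0r; apply: eq_bigr => x /negbTE ->//.
apply: (ccvg_norm_le cv') => N.
rewrite (le_trans (normc_sum _ _ _))//.
apply: (@le_trans _ _ (\sum_(x <- cube N) e * (normc (c x) * weight rho x))); last first.
  by rewrite -mulr_sumr ler_wpM2l.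
apply: ler_sum => x _; case: ifPn => xx0.
  by rewrite normc0 !mulr_ge0 ?normc_ge0.
rewrite normcM normc_real mulrCA ler_wpM2l ?normc_ge0//.
have [j xj] : exists j, x j != 0%N.
  apply/existsP; apply: contraR xx0; rewrite negb_exists => /forallP h0.
  by apply/eqP/ffunP => j; rewrite ffunE; apply/eqP; have := h0 j; rewrite negbK.
rewrite (monomialE j) (weightE j) normrM mulrA; apply: ler_pM => //.
  rewrite normrX; apply: (@le_trans _ _ ((e * rho) ^+ x j)).
    by rewrite lerXn2r ?nnegrE ?mulr_ge0// ltW.
  rewrite exprMn ler_wpM2r ?exprn_ge0 ?(ltW rho0)//.
  by case: (x j) xj => // k _; rewrite exprS ler_piMr// exprn_ile1.
rewrite normr_prod; apply: ler_prod => k _; rewrite normr_ge0 normrX.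
by rewrite lerXn2r ?nnegrE// ltW.
Unshelve. all: by end_near. Qed.

Lemma real_analytic_continuous f : real_analytic f -> ccontinuous f.
Proof.
move=> hf.
have near_ball p e : 0 < e -> \forall w \near p, normc (f p - f w) <= e.
  move=> e0; have [c [r h]] := (real_analytic_at f).1 hf p.
  have [A [rho [A0 rho0 hA]]] := series_lipschitz h.
  pose ep := Num.min 1 (e / (A + 1)).
  have A1 : 0 < A + 1 by rewrite ltr_wpDl.
  have ep0 : 0 < ep by rewrite lt_min ltr01 divr_gt0.
  have : \forall w \near p, ball p (ep * rho) w by apply: nbhsx_ballx; rewrite mulr_gt0.
  apply: filterS => w pw.
  have hw j : `|(w - p) ord0 j| <= ep * rho.
    by have [_ /(_ ord0 j)] := pw; rewrite /ball /= !mxE distrC => /ltW.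
  have ep01 : 0 <= ep <= 1 by rewrite ltW//= ge_min lexx.
  have := hA ep _ ep01 hw; rewrite [p + _]addrC subrK normcB => /le_trans; apply.
  apply: (@le_trans _ _ (e / (A + 1) * (A + 1))); last by rewrite divfK// gt_eqF.
  apply: ler_pM => //; first exact: ltW.
    by rewrite ge_min lexx orbT.
  by rewrite lerDl.
have cont (g : R[i] -> R) : (forall z z0, `|g z - g z0| <= normc (z - z0)) ->
    continuous (fun x => g (f x)).
  move=> hg p; suff : (fun x => g (f x)) @ nbhs p --> g (f p) by [].
  apply/cvgrPdist_le => e e0; apply: filterS (near_ball p e e0) => w.
  exact: le_trans (hg _ _).
split; apply: cont => z w.
  by rewrite -cReN -cReD Re_le_normc.
by rewrite -cImN -cImD Im_le_normc.
Qed.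

(** The parameters [t] of [[0, 1]] at which all derivatives vanish at [q + t w] form a set which is
   open, by the power series, and closed, by continuity of the derivatives. *)
Lemma flat_continuation f q w : real_analytic f ->
  (forall a, partials a f q = 0) -> f (q + w) = 0.
Proof.
move=> hf flat0.
pose flat (t : R) := forall a, partials a f (q + t *: w) = 0.
pose M := 1 + \sum_j `|w ord0 j|.
have M0 : 0 < M by rewrite ltr_wpDr// sumr_ge0.
have wM j : `|w ord0 j| < M.
  rewrite /M ltr_pwDl//.
  by rewrite (bigD1 j)//= lerDl sumr_ge0.
have step (t s : R) : q + s *: w = q + t *: w + (s - t) *: w.
  by rewrite -addrA -scalerDl addrCA subrr addr0.
have local (t : R) : flat t -> exists2 e : R, 0 < e & forall s, `|s - t| < e -> flat s.
  move=> ft; have [c [r h]] := (real_analytic_at f).1 hf (q + t *: w).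
  have r0 : 0 < r by case: h.
  exists (r / M) => [|s st a]; first by rewrite divr_gt0.
  have hs : has_series (partials a f) (q + t *: w) (foldr dcoef c a) r.
    by elim: a => [|i a IH] //=; have [] := series_derive i IH.
  rewrite (step t s); apply: (flat_series_eq0 hs).
    by move=> b; rewrite /partials -foldr_cat; exact: ft.
  move=> j; rewrite mxE normrM.
  apply: (@le_lt_trans _ _ (`|s - t| * M)); first by rewrite ler_wpM2l// ltW.
  by rewrite -ltr_pdivlMr.
have limit (t : R) : 0 < t -> (forall s, 0 <= s < t -> flat s) -> flat t.
  move=> t0 h a; have [c [r hs]] :=
    (real_analytic_at _).1 (real_analytic_partials a hf) (q + t *: w).
  have [A [rho [A0 rho0 hA]]] := series_lipschitz hs.
  apply/normc_eq0/le_anti; rewrite normc_ge0 andbT; apply/ler_addgt0Pl => e e0.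
  rewrite addr0.
  have A1 : 0 < A + 1 by rewrite ltr_wpDl.
  pose ep := Num.min 1 (e / (A + 1)).
  have ep0 : 0 < ep by rewrite lt_min ltr01 divr_gt0.
  have ep01 : 0 <= ep <= 1 by rewrite ltW//= ge_min lexx.
  pose s := t - Num.min t (ep * rho / M).
  have m0 : 0 < Num.min t (ep * rho / M) by rewrite lt_min t0/= divr_gt0// mulr_gt0.
  have s0 : 0 <= s < t.
    apply/andP; split; first by rewrite /s subr_ge0 ge_min lexx.
    by rewrite /s gtrBl.
  have := hA ep ((s - t) *: w) ep01.
  rewrite -(step t s) (h s s0 a) sub0r normcN => H.
  apply: (@le_trans _ _ (ep * A)).
    apply: H => j; rewrite mxE normrM /s addrC addKr normrN (gtr0_norm m0).
    apply: (@le_trans _ _ (ep * rho / M * M)).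
      apply: ler_pM => //; rewrite ?(ltW m0) ?(ltW (wM j))//.
      by rewrite ge_min lexx orbT.
    by rewrite divfK// gt_eqF.
  apply: (@le_trans _ _ (e / (A + 1) * (A + 1))); last by rewrite divfK// gt_eqF.
  apply: ler_pM => //; first exact: ltW.
    by rewrite ge_min lexx orbT.
  by rewrite lerDl.
pose E := [set t : R | 0 <= t <= 1 /\ forall s, 0 <= s <= t -> flat s].
have f0 : flat 0 by move=> a; rewrite scale0r addr0.
have E0 : E 0.
  split; first by rewrite lexx ler01.
  by move=> s /andP[s0 s1]; have -> : s = 0 by apply/le_anti; rewrite s0 s1.
have E1 : ubound E 1 by move=> t [/andP[]].
have supE : has_sup E by split; [exists 0|exists 1].
pose t := sup E.
have t0 : 0 <= t by apply: ub_le_sup => //; case: supE.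
have t1 : t <= 1 by apply: ge_sup; [exists 0|exact: E1].
have below s : 0 <= s < t -> flat s.
  move=> /andP[s0 st]; have [u [_ hu] su] := sup_gt (proj1 supE) st.
  by apply: hu; rewrite s0 ltW.
have ft : flat t.
  have [t00|t00] := ltP 0 t; first exact: limit.
  by have -> : t = 0 by apply/le_anti; rewrite t00.
have [e e0 he] := local t ft.
have flat1 : flat 1.
  have [tl|] := ltP t 1; last by move=> h; have <- : t = 1 by apply/le_anti; rewrite t1.
  pose u := Num.min 1 (t + e / 2).
  have tu : t < u by rewrite lt_min tl ltrDl divr_gt0.
  have : E u.
    split; first by rewrite (le_trans t0 (ltW tu))/= ge_min lexx.
    move=> s /andP[s0 su].
    have [st|st] := ltP s t; first by apply: below; rewrite s0.
    apply: he; rewrite ger0_norm ?subr_ge0//.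
    have : u <= t + e / 2 by rewrite ge_min lexx orbT.
    by move: su e0; lra.
  by move=> /(ub_le_sup (proj2 supE)); rewrite leNgt tu.
by have := flat1 [::]; rewrite scale1r.
Qed.

End analytic_functions.

(** * Uniqueness of sesqui-holomorphic extensions *)

Section sesqui_uniqueness.
Context {R : realType} {n : nat}.
Local Notation V := 'rV[R]_(n + n).
Local Notation W := 'rV[R]_((n + n) + (n + n)).
Implicit Types (X Y : V) (Z : W) (H : W -> R[i]).

Definition on_pairs (G : V -> V -> R[i]) : W -> R[i] :=
  fun Z => G (lsubmx Z) (rsubmx Z).

Lemma basis_lshift (j : 'I_(n + n)) : basis_rV (lshift (n + n) j) = row_mx (basis_rV j) 0 :> W.
Proof.
apply/rowP => k; rewrite /basis_rV !mxE eqxx /=.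
by case: (split_ordP k) => i ->; rewrite ?row_mxEl ?row_mxEr !mxE ?eqxx/= ?eq_shift.
Qed.

Lemma basis_rshift (j : 'I_(n + n)) : basis_rV (rshift (n + n) j) = row_mx 0 (basis_rV j) :> W.
Proof.
apply/rowP => k; rewrite /basis_rV !mxE eqxx /=.
by case: (split_ordP k) => i ->; rewrite ?row_mxEl ?row_mxEr !mxE ?eqxx/= ?eq_shift.
Qed.

Lemma cpartial_lshift G X Y j :
  cpartial j (fun X' => G X' Y) X = cpartial (lshift _ j) (on_pairs G) (row_mx X Y).
Proof.
rewrite /cpartial /derive; congr (lim _ +i* lim _).
  apply: (congr1 (fun u : R -> R => u @ 0^')); apply/funext => t /=; rewrite basis_lshift scale_row_mx scaler0.
  by rewrite add_row_mx add0r /on_pairs !row_mxKl !row_mxKr.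
apply: (congr1 (fun u : R -> R => u @ 0^')); apply/funext => t /=; rewrite basis_lshift scale_row_mx scaler0.
by rewrite add_row_mx add0r /on_pairs !row_mxKl !row_mxKr.
Qed.

Lemma cpartial_rshift G X Y j :
  cpartial j (fun Y' => G X Y') Y = cpartial (rshift _ j) (on_pairs G) (row_mx X Y).
Proof.
rewrite /cpartial /derive; congr (lim _ +i* lim _).
  apply: (congr1 (fun u : R -> R => u @ 0^')); apply/funext => t /=; rewrite basis_rshift scale_row_mx scaler0.
  by rewrite add_row_mx add0r /on_pairs !row_mxKl !row_mxKr.
apply: (congr1 (fun u : R -> R => u @ 0^')); apply/funext => t /=; rewrite basis_rshift scale_row_mx scaler0.
by rewrite add_row_mx add0r /on_pairs !row_mxKl !row_mxKr.
Qed.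

Local Notation xl j := (lshift (n + n) (lshift n j)).
Local Notation xr j := (lshift (n + n) (rshift n j)).
Local Notation yl j := (rshift (n + n) (lshift n j)).
Local Notation yr j := (rshift (n + n) (rshift n j)).
Local Notation ii := ((0 : R) +i* 1).

Definition sesqui_holomorphic H : Prop := [/\ real_analytic H,
  (forall Z (j : 'I_n), cpartial (xl j) H Z + ii * cpartial (xr j) H Z = 0) &
  (forall Z (j : 'I_n), cpartial (yl j) H Z - ii * cpartial (yr j) H Z = 0)].

Lemma cpartial_lin H1 H2 (k l : R[i]) i : real_analytic H1 -> real_analytic H2 ->
  cpartial i (fun Z : W => k * H1 Z + l * H2 Z) =
  fun Z => k * cpartial i H1 Z + l * cpartial i H2 Z.
Proof.
move=> h1 h2; have [] // := @cpartialE _ _ i (fun Z => k * H1 Z + l * H2 Z)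
  (fun Z => k * cpartial i H1 Z + l * cpartial i H2 Z).
by move=> Z; apply: is_cderiveD; apply: is_cderiveZ; exact: real_analytic_cderive.
Qed.

Lemma sesqui_holomorphic_cpartial H k : sesqui_holomorphic H ->
  sesqui_holomorphic (cpartial k H).
Proof.
move=> [aH hx hy]; split; first exact: real_analytic_cpartial.
- move=> Z j; rewrite !(cpartialC _ k aH).
  have -> : cpartial (xl j) H = fun Z => - ii * cpartial (xr j) H Z + 0 * H Z.
    apply/funext => Z'; apply/eqP; rewrite mul0r addr0 mulNr -addr_eq0.
    by rewrite hx.
  rewrite cpartial_lin//; last exact: real_analytic_cpartial.
  by rewrite mul0r addr0 mulNr addNr.
- move=> Z j; rewrite !(cpartialC _ k aH).
  have -> : cpartial (yl j) H = fun Z => ii * cpartial (yr j) H Z + 0 * H Z.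
    apply/funext => Z'; apply/eqP; rewrite mul0r addr0 -subr_eq0.
    by rewrite hy.
  rewrite cpartial_lin//; last exact: real_analytic_cpartial.
  by rewrite mul0r addr0 subrr.
Qed.

Lemma sqr_ii : ii * ii = -1.
Proof. by apply: eq_cplx => /=; ring. Qed.

(** On the diagonal, the derivative along [(e, e)] vanishes for every coordinate vector [e]; with the
   two systems of Cauchy-Riemann equations this kills every first derivative. *)
Lemma diagonal_cpartial H k : sesqui_holomorphic H -> (forall X, H (row_mx X X) = 0) ->
  forall X, cpartial k H (row_mx X X) = 0.
Proof.
move=> [aH hx hy] h0 X; set p := row_mx X X.
have diag (j : 'I_(n + n)) : cpartial (lshift _ j) H p + cpartial (rshift _ j) H p = 0.
  have h := analytic_derive_two p (lshift _ j) (rshift _ j) aH.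
  move/is_cderive_line : h.
  rewrite (_ : (fun t => _) = fun=> 0).
    by move=> [[_ r1] [_ r2]]; have [[_ z1] [_ z2]] := is_cderive_cst (V := R) 0 1 (0 : R[i]);
      apply: eq_cplx; [rewrite -r1 z1|rewrite -r2 z2].
  apply/funext => t; rewrite basis_lshift basis_rshift add_row_mx addr0 add0r.
  by rewrite scale_row_mx add_row_mx h0.
have base (j : 'I_n) : cpartial (xl j) H p = 0 /\ cpartial (xr j) H p = 0 /\
    cpartial (yl j) H p = 0 /\ cpartial (yr j) H p = 0.
  have d1 := diag (lshift n j); have d2 := diag (rshift n j).
  have c1 := hx p j; have c2 := hy p j.
  move: d1 d2 c1 c2; move: (cpartial (xl j) H p) (cpartial (xr j) H p)
    (cpartial (yl j) H p) (cpartial (yr j) H p) => a b c d d1 d2 c1 c2.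
  have cE : c = - a by apply/eqP; rewrite -addr_eq0 addrC d1.
  have dE : d = - b by apply/eqP; rewrite -addr_eq0 addrC d2.
  have aE : a = - (ii * b) by apply/eqP; rewrite -addr_eq0 c1.
  have b0 : ii * b + ii * b = 0.
    by move: c2; rewrite cE dE aE mulrN !opprK.
  have ib : ii * b = 0.
    by move/eqP: b0; rewrite -mulr2n mulrn_eq0 /= => /eqP.
  have bz : b = 0.
    by have := congr1 (fun z => ii * z) ib; rewrite mulrA sqr_ii mulN1r mulr0 => /eqP;
      rewrite oppr_eq0 => /eqP.
  by rewrite dE cE aE ib bz !oppr0.
case: (split_ordP k) => i ->; case: (split_ordP i) => j ->; have := base j; tauto.
Qed.

(** By induction every derivative vanishes on the diagonal, and [(X, Y)] lies on a segment issued
   from the diagonal point at the midpoint of [X] and [Y]. *)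
Lemma sesqui_holomorphic_eq0 H : sesqui_holomorphic H -> (forall X, H (row_mx X X) = 0) ->
  forall Z, H Z = 0.
Proof.
move=> hH h0 Z.
have main a : sesqui_holomorphic (partials a H) /\ forall X, partials a H (row_mx X X) = 0.
  elim: a => [|k a [IH1 IH2]] //=.
  by split; [exact: sesqui_holomorphic_cpartial|exact: diagonal_cpartial].
pose X := lsubmx Z; pose Y := rsubmx Z.
pose M := 2^-1 *: (X + Y); pose dl := 2^-1 *: (X - Y).
have E : Z = row_mx M M + row_mx dl (- dl).
  have h : (2^-1 : R) + 2^-1 = 1 by rewrite -div1r -splitr.
  rewrite add_row_mx -[LHS]hsubmxK -/X -/Y /M /dl -scalerN -!scalerDr; congr row_mx.
    by rewrite addrACA subrr addr0 scalerDr -scalerDl h scale1r.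
  by rewrite opprB [X + Y]addrC addrACA subrr addr0 scalerDr -scalerDl h scale1r.
rewrite E; apply: flat_continuation; first by case: hH.
by move=> a; have [_] := main a.
Qed.

Lemma sesqui_ext_holomorphic (F : V -> R[i]) G : is_sesqui_ext F G -> sesqui_holomorphic (on_pairs G).
Proof.
move=> [aG [hx [hy _]]]; split => // Z j; rewrite -[Z]hsubmxK.
  by rewrite -!cpartial_lshift; exact: hx.
by rewrite -!cpartial_rshift; exact: hy.
Qed.

(** The difference of two extensions vanishes on the diagonal, hence everywhere. *)
Theorem sesqui_ext_unique (F : V -> R[i]) G : is_sesqui_ext F G -> sesqui_ext F = G.
Proof.
move=> hG; have hG' : is_sesqui_ext F (sesqui_ext F).
  by apply: (@xgetPex _ (fun _ _ => 0) [set G | is_sesqui_ext F G]); exists G.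
have [a1 x1 y1] := sesqui_ext_holomorphic hG.
have [a2 x2 y2] := sesqui_ext_holomorphic hG'.
pose H Z := 1 * on_pairs (sesqui_ext F) Z + -1 * on_pairs G Z.
have hH : sesqui_holomorphic H.
  split; first exact: real_analytic_lin.
    move=> Z j; rewrite /H !cpartial_lin//.
    rewrite [LHS](_ : _ = 1 * (cpartial (xl j) (on_pairs (sesqui_ext F)) Z +
        ii * cpartial (xr j) (on_pairs (sesqui_ext F)) Z) +
       -1 * (cpartial (xl j) (on_pairs G) Z + ii * cpartial (xr j) (on_pairs G) Z)); last by move: ii => u; ring.
    by rewrite x1 x2 !mulr0 addr0.
  move=> Z j; rewrite /H !cpartial_lin//.
  rewrite [LHS](_ : _ = 1 * (cpartial (yl j) (on_pairs (sesqui_ext F)) Z -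
      ii * cpartial (yr j) (on_pairs (sesqui_ext F)) Z) +
     -1 * (cpartial (yl j) (on_pairs G) Z - ii * cpartial (yr j) (on_pairs G) Z)); last by move: ii => u; ring.
  by rewrite y1 y2 !mulr0 addr0.
apply/funext => X; apply/funext => Y.
have : H (row_mx X Y) = 0.
  apply: sesqui_holomorphic_eq0 => // X'; rewrite /H /on_pairs row_mxKl row_mxKr.
  have [_ [_ [_ ->]]] := hG; have [_ [_ [_ ->]]] := hG'.
  by ring.
rewrite /H /on_pairs row_mxKl row_mxKr mul1r mulN1r => /eqP.
by rewrite subr_eq0 => /eqP.
Qed.

End sesqui_uniqueness.

(** * Borel sets and Lebesgue measure in several variables *)

Section borel_rV.
Context {R : realType} {d : nat}.
Local Notation V := 'rV[R]_d.
Implicit Types (x y : V).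

Definition box (A : 'I_d -> set R) : set V := [set x : V | forall i, A i (x ord0 i)].

Lemma measurable_box (A : 'I_d -> set R) : (forall i, measurable (A i)) -> measurable (box A).
Proof.
move=> mA; have -> : box A = \bigcap_(i in [set: 'I_d]) ((fun x : V => x ord0 i) @^-1` A i).
  by apply/seteqP; split => [x Ax i _|x Ax i]; [exact: Ax|exact: Ax].
apply: fin_bigcap_measurable => // i _.
by rewrite -[X in measurable X]setTI; apply: measurable_coord_rV.
Qed.

(** An open set is the union of the rational cubes it contains. *)
Lemma open_measurable_rV (U : set V) : open U -> measurable U.
Proof.
move=> oU.
pose C (q : {ffun 'I_d -> rat} * nat) : set V :=
  box (fun i => `]ratr (q.1 i) - q.2.+1%:R^-1, ratr (q.1 i) + q.2.+1%:R^-1[%classic).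
pose B q := if `[< C q `<=` U >] then C q else set0.
have -> : U = \bigcup_q B q.
  apply/seteqP; split => [x Ux|x [q _]]; last first.
    by rewrite /B; case: ifPn => // /asboolP h /h.
  have : nbhs x U by exact: open_nbhs_nbhs.
  move=> /nbhs_ballP[e /= e0 xeU].
  have [k ke] : exists k : nat, 2 * (k.+1%:R^-1 : R) < e.
    have h0 : 0 <= 2 / e by rewrite divr_ge0// ltW.
    exists (Num.bound (2 / e)); rewrite ltr_pdivrMr// mulrC -ltr_pdivrMr//.
    by rewrite (lt_le_trans (archi_boundP h0))// ler_nat.
  have k0 : 0 < (k.+1%:R^-1 : R) by rewrite invr_gt0.
  have hq i : exists q : rat, x ord0 i - k.+1%:R^-1 < ratr q < x ord0 i + k.+1%:R^-1.
    have [|q] := @rat_in_itvoo R (x ord0 i - k.+1%:R^-1) (x ord0 i + k.+1%:R^-1).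
      by rewrite ltrD2l (lt_trans _ k0)// oppr_lt0.
    by rewrite in_itv /=; exists q.
  pose q := [ffun i => sval (cid (hq i))].
  have hq' i : x ord0 i - k.+1%:R^-1 < ratr (q i) < x ord0 i + k.+1%:R^-1.
    by rewrite ffunE; case: (cid _).
  have CU : C (q, k) `<=` U.
    move=> y Cy; apply: xeU; split => // i j; have -> : i = ord0 := ord1 i; rewrite /ball /=.
    have := Cy j; rewrite /= in_itv /= => /andP[y1 y2].
    have /andP[q1 q2] := hq' j.
    rewrite ltr_norml; move: y1 y2 q1 q2 ke; clear.
    move: (ratr (q j) : R) (x ord0 j) (y ord0 j) (k.+1%:R^-1 : R) => a b c d0 h1 h2 h3 h4 h5.
    by apply/andP; split; lra.
  exists (q, k) => //; rewrite /B asboolT//= => i; rewrite /= in_itv /=.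
  have /andP[q1 q2] := hq' i; move: q1 q2; clear.
  move: (ratr (q i) : R) (x ord0 i) (k.+1%:R^-1 : R) => a b c h1 h2.
  by apply/andP; split; lra.
apply: countable_bigcupT_measurable; first exact: countableP.
move=> q; rewrite /B; case: ifP => _ //.
by apply: measurable_box.
Qed.

Lemma continuous_measurable_rV (f : V -> R) : continuous f -> measurable_fun setT f.
Proof.
move=> /continuousP cf; apply: (measurability _ (RGenOpens.measurableE R)).
move=> _ [_ [a [b ->] <-]]; rewrite setTI; apply: open_measurable_rV.
by apply: cf; exact: interval_open.
Qed.

Lemma ccontinuous_cmeasurable (f : V -> R[i]) : ccontinuous f -> cmeasurable f.
Proof. by move=> [h1 h2]; split; exact: continuous_measurable_rV. Qed.

End borel_rV.

(** The measurability of the map is part of the term, as it is not inferred. *)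
Definition image_measure d1 d2 (T1 : measurableType d1) (T2 : measurableType d2)
    (R : realType) (m : {measure set T1 -> \bar R}) (f : T1 -> T2)
    (mf : measurable_fun setT f) : {measure set T2 -> \bar R} :=
  measure_function_pushforward__canonical__measure_function_Measure m mf.

Section affine_change.
Context {R : realType}.

(** Both sides, rescaled, are measures which agree on intervals. *)
Lemma lebesgue_measure_affine (c b : R) (A : set R) : (c != 0)%R -> measurable A ->
  lebesgue_measure ((fun y : R => c * y + b) @^-1` A) = ((`|c|^-1)%:E * lebesgue_measure A)%E.
Proof.
move=> c0 mA.
have n0 : (0 <= `|c|)%R by [].
pose k : {nonneg R} := NngNum n0.
pose f (y : measurableTypeR R) : measurableTypeR R := (c * y + b)%R.
have mf : measurable_fun setT f.
  by apply: measurable_funD => //; exact: measurable_funM.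
have main : mscale k (image_measure lebesgue_measure mf) A = lebesgue_measure A.
  apply/esym/lebesgue_measure_unique => //= _ [[x y]] _ <-.
  change (lebesgue_measure `]x, y]%classic =
    (`|c|%:E * lebesgue_measure (f @^-1` `]x, y]%classic))%E).
  have [c_lt0|c_gt0|c00] := ltgtP c 0%R; last by rewrite c00 eqxx in c0.
  - rewrite (_ : f @^-1` _ = `[(y - b) / c, (x - b) / c[%classic); last first.
      apply/seteqP; split => t /=; rewrite !in_itv/= /f.
        by rewrite ler_ndivrMr// ltr_ndivlMr// => /andP[h1 h2]; apply/andP; split; lra.
      by rewrite ler_ndivrMr// ltr_ndivlMr// => /andP[h1 h2]; apply/andP; split; lra.
    rewrite !lebesgue_measure_itv/= !lte_fin ltr_ndivlMr// divfK// ltrBlDr subrK.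
    case: ifPn => _; last by rewrite mule0.
    by rewrite -!EFinB -EFinM ltr0_norm//; congr EFin; field.
  - rewrite (_ : f @^-1` _ = `](x - b) / c, (y - b) / c]%classic); last first.
      apply/seteqP; split => t /=; rewrite !in_itv/= /f.
        by rewrite ler_pdivlMr// ltr_pdivrMr// => /andP[h1 h2]; apply/andP; split; lra.
      by rewrite ler_pdivlMr// ltr_pdivrMr// => /andP[h1 h2]; apply/andP; split; lra.
    rewrite !lebesgue_measure_itv/= !lte_fin ltr_pdivlMr// divfK// ltrBlDr subrK.
    case: ifPn => _; last by rewrite mule0.
    by rewrite -!EFinB -EFinM gtr0_norm//; congr EFin; field.
rewrite -main /mscale /pushforward /= muleA -EFinM mulVf ?mul1e//.
by rewrite normr_eq0.
Qed.

(** Boxes form a generating pi-system, exhausting the space with finite measure. *)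
Lemma rV_measure_unique (d : nat) (m : {measure set 'rV[R]_d -> \bar R}) :
  (forall A : 'I_d -> set R, (forall i, measurable (A i)) ->
     m (box A) = (\prod_(i < d) lebesgue_measure (A i))%E) ->
  forall E, measurable E -> m E = lebesgue_rV d E.
Proof.
move=> hm E mE.
pose G := [set B : set 'rV[R]_d | exists2 A : 'I_d -> set R, (forall i, measurable (A i)) & B = box A].
pose g k : set 'rV[R]_d := box (fun=> `[- (k%:R), k%:R]%classic).
apply/esym; apply: (measure_unique G g).
- apply/seteqP; split => [B|B].
    move=> mB; apply: mB; split; first exact: smallest_sigma_algebra.
    move=> C; rewrite -bigcup_seq => -[i _ [A mA <-]]; rewrite setTI.
    apply: sub_sigma_algebra; exists (fun j => if j == i then A else setT).
      by move=> j; case: ifP.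
    apply/seteqP; split => [x /= Ax j|x /= h]; first by case: eqVneq => // ->.
    by have := h i; rewrite eqxx.
  move=> h; apply: h; split.
    split.
    + exact: measurable0.
    + by move=> C mC; rewrite setTD; exact: measurableC.
    + by move=> F mF; exact: bigcupT_measurable.
  by move=> C [A mA ->]; exact: measurable_box.
- move=> _ _ [A mA ->] [B mB ->]; exists (fun i => A i `&` B i).
    by move=> i; exact: measurableI.
  apply/seteqP; split => [x [h1 h2] i|x h]; first by split; [exact: h1|exact: h2].
  by split=> i; have [] := h i.
- by move=> k; exists (fun=> `[- (k%:R), k%:R]%classic).
- apply/seteqP; split => // x _.
  pose M := (\sum_i `|x ord0 i|)%R.
  have M0 : (0 <= M)%R by exact: sumr_ge0.
  exists (Num.bound M) => // i; rewrite /= in_itv /= -ler_norml.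
  rewrite (le_trans _ (ltW (archi_boundP M0)))// /M (bigD1 i)//= lerDl.
  exact: sumr_ge0.
- by move=> _ [A mA ->]; rewrite hm//; exact: lebesgue_rV_box.
- move=> k; pose J : set R := `[- (k%:R), k%:R]%classic.
  have [r Jr] : exists r : R, lebesgue_measure J = r%:E.
    by rewrite /J lebesgue_measure_itv/=; case: ifP => _; rewrite -?EFinB; eexists.
  have E2 : lebesgue_rV d (g k) = (\prod_(i < d) lebesgue_measure J)%E.
    by apply: (lebesgue_rV_box (A := fun=> J)) => i; exact: measurable_itv.
  apply: (@le_lt_trans _ _ (\prod_(i < d) r%:E)%E); last by rewrite prodEFin ltry.
  under [leRHS]eq_bigr do rewrite -Jr.
  by rewrite -E2.
- exact: mE.
Qed.

End affine_change.

(** * Changes of variables and complex-valued integrals *)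

Section change_of_variables.
Context {R : realType}.
Local Open Scope ereal_scope.

Lemma integral_image d1 d2 (T1 : measurableType d1) (T2 : measurableType d2)
    (m1 : {measure set T1 -> \bar R}) (m2 : {measure set T2 -> \bar R}) (phi : T1 -> T2)
    (k : {nonneg R}) (f : T2 -> \bar R) :
  measurable_fun setT phi ->
  (forall A, measurable A -> m1 (phi @^-1` A) = k%:num%:E * m2 A) ->
  measurable_fun setT f -> (forall y, 0 <= f y) ->
  \int[m1]_x f (phi x) = k%:num%:E * \int[m2]_y f y.
Proof.
move=> mphi h mf f0.
have e1 := @ge0_integral_pushforward _ _ _ _ _ phi mphi m1 setT f measurableT mf (fun y _ => f0 y).
rewrite preimage_setT in e1; rewrite -[LHS]e1.
have <- : \int[mscale k m2]_y f y = k%:num%:E * \int[m2]_y f y.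
  exact: ge0_integral_mscale.
by apply: (@eq_measure_integral _ _ _ setT (mscale k m2) (image_measure m1 mphi)) => A mA _; exact: h.
Qed.

Lemma integral_image1 d1 d2 (T1 : measurableType d1) (T2 : measurableType d2)
    (m1 : {measure set T1 -> \bar R}) (m2 : {measure set T2 -> \bar R}) (phi : T1 -> T2)
    (f : T2 -> \bar R) :
  measurable_fun setT phi ->
  (forall A, measurable A -> m1 (phi @^-1` A) = m2 A) ->
  measurable_fun setT f ->
  \int[m1]_x f (phi x) = \int[m2]_y f y.
Proof.
move=> mphi h mf.
have h' A : measurable A -> m1 (phi @^-1` A) = (1%:nng : {nonneg R})%:num%:E * m2 A.
  by move=> mA; rewrite mul1e h.
have main g : measurable_fun setT g -> (forall y, 0 <= g y) ->
    \int[m1]_x g (phi x) = \int[m2]_y g y.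
  by move=> mg g0; rewrite (integral_image mphi h' mg g0) mul1e.
rewrite integralE [RHS]integralE; congr (_ - _).
- rewrite (_ : (fun x => f (phi x))^\+ = fun x => f^\+ (phi x)); last by rewrite unlock.
  by apply: main => //; exact: measurable_funepos.
- rewrite (_ : (fun x => f (phi x))^\- = fun x => f^\- (phi x)); last by rewrite unlock.
  by apply: main => //; exact: measurable_funeneg.
Qed.

Variable d : nat.
Local Notation V := 'rV[R]_d.
Implicit Types (x : V).

(** Permuting the coordinates is allowed besides rescaling and translating them: the complex
   structure of phase space exchanges positions and momenta. *)
Definition affine_coord (s : 'I_d -> 'I_d) (c b : 'I_d -> R) x : V :=
  \row_i (c i * x ord0 (s i) + b i)%R.

Lemma measurable_affine_coord s c b : measurable_fun setT (affine_coord s c b).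
Proof.
apply: measurable_fun_rVP => i; under eq_fun do rewrite mxE.
by apply: measurable_funD => //; apply: measurable_funM => //; exact: measurable_coord_rV.
Qed.

Lemma lebesgue_affine_coord s s' c b A : cancel s s' -> cancel s' s ->
  (forall i, c i != 0%R) -> measurable A ->
  lebesgue_rV d (affine_coord s c b @^-1` A) =
  (\prod_i `|c i|^-1)%R%:E * lebesgue_rV d A.
Proof.
move=> sK s'K c0 mA.
have mT := measurable_affine_coord s c b.
have n0 : (0 <= \prod_i `|c i|)%R by apply: prodr_ge0.
pose k : {nonneg R} := NngNum n0.
have kk : (\prod_i `|c i|^-1 * \prod_i `|c i| = 1)%R.
  by rewrite -big_split big1//= => i _; rewrite mulVf// normr_eq0.
have main : forall E, measurable E ->
    mscale k (image_measure (lebesgue_rV d) mT) E = lebesgue_rV d E.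
  apply: rV_measure_unique => {}A {}mA.
  pose A' j : set R := (fun y : R => c (s' j) * y + b (s' j))%R @^-1` A (s' j).
  have E1 : affine_coord s c b @^-1` box A = box A'.
    apply/seteqP; split => x h j.
      by have := h (s' j); rewrite /A' /affine_coord /= mxE s'K.
    by have := h (s j); rewrite /A' /affine_coord /= mxE sK.
  have mA' j : measurable (A' j).
    rewrite /A' -[X in measurable X]setTI.
    have : measurable_fun setT (fun y : R => c (s' j) * y + b (s' j))%R.
      by apply: measurable_funD => //; exact: measurable_funM.
    by apply.
  change (k%:num%:E * lebesgue_rV d (affine_coord s c b @^-1` box A) =
     \prod_(i < d) lebesgue_measure (A i)).
  rewrite E1 [lebesgue_rV d (box A')](lebesgue_rV_box mA').
  rewrite (reindex_inj (can_inj sK)) /=.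
  rewrite (eq_bigr (fun i => (`|c i|^-1)%R%:E * lebesgue_measure (A i))); last first.
    by move=> i _; rewrite /A' /= sK lebesgue_measure_affine.
  have P (I : Type) (r : seq I) (F : I -> R) (G : I -> \bar R) :
      \prod_(i <- r) ((F i)%:E * G i) = (\prod_(i <- r) F i)%:E * \prod_(i <- r) G i.
    by rewrite big_split/= prodEFin.
  by rewrite P muleA -EFinM /= mulrC kk mul1e.
by rewrite -(main A mA) /mscale /= muleA -EFinM kk mul1e.
Qed.

Lemma integral_affine_coord s s' c b (f : V -> \bar R) : cancel s s' -> cancel s' s ->
  (forall i, c i != 0%R) ->
  measurable_fun setT f -> (forall y, 0 <= f y) ->
  \int[lebesgue_rV d]_x f (affine_coord s c b x) =
  (\prod_i `|c i|^-1)%R%:E * \int[lebesgue_rV d]_x f x.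
Proof.
move=> sK s'K c0 mf f0.
have n0 : (0 <= \prod_i `|c i|^-1)%R by apply: prodr_ge0 => i _; rewrite invr_ge0.
apply: (@integral_image _ _ _ _ _ _ _ (NngNum n0)) => //.
  exact: measurable_affine_coord.
by move=> A mA /=; exact: (lebesgue_affine_coord _ sK s'K).
Qed.

Lemma integral_translate (a : V) (f : V -> \bar R) : measurable_fun setT f ->
  \int[lebesgue_rV d]_x f (x + a)%R = \int[lebesgue_rV d]_x f x.
Proof.
move=> mf; have E x : (x + a)%R = affine_coord id (fun=> 1%R) (fun i => a ord0 i) x.
  by apply/rowP => i; rewrite !mxE mul1r.
under eq_integral do rewrite E.
apply: integral_image1 => //; first exact: measurable_affine_coord.
move=> A mA; etransitivity.
  by apply: (lebesgue_affine_coord (s' := id)) => // i; rewrite oner_eq0.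
by rewrite big1 ?mul1e// => i _; rewrite normr1 invr1.
Qed.

Lemma integral_reflect (a : V) (f : V -> \bar R) : measurable_fun setT f ->
  \int[lebesgue_rV d]_x f (a - x)%R = \int[lebesgue_rV d]_x f x.
Proof.
move=> mf; have E x : (a - x)%R = affine_coord id (fun=> (-1)%R) (fun i => a ord0 i) x.
  by apply/rowP => i; rewrite !mxE mulN1r addrC.
under eq_integral do rewrite E.
apply: integral_image1 => //; first exact: measurable_affine_coord.
move=> A mA; etransitivity.
  by apply: (lebesgue_affine_coord (s' := id)) => // i; rewrite oppr_eq0 oner_eq0.
by rewrite big1 ?mul1e// => i _; rewrite normrN normr1 invr1.
Qed.

End change_of_variables.

Section complex_integral.
Context {R : realType} d (T : measurableType d) (mu : {measure set T -> \bar R}).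
Implicit Types (f g : T -> R[i]) (k : R[i]).

Lemma cmeasurableD f g : cmeasurable f -> cmeasurable g -> cmeasurable (fun x => f x + g x).
Proof.
move=> [f1 f2] [g1 g2]; split.
  by under eq_fun do rewrite cReD; exact: measurable_funD.
by under eq_fun do rewrite cImD; exact: measurable_funD.
Qed.

Lemma cmeasurableM f g : cmeasurable f -> cmeasurable g -> cmeasurable (fun x => f x * g x).
Proof.
move=> [f1 f2] [g1 g2]; split.
  by under eq_fun do rewrite cReM; apply: measurable_funB; exact: measurable_funM.
by under eq_fun do rewrite cImM; apply: measurable_funD; exact: measurable_funM.
Qed.

Lemma cmeasurable_cst k : cmeasurable (fun _ : T => k).
Proof. by split; exact: measurable_cst. Qed.

Lemma cmeasurableZ k f : cmeasurable f -> cmeasurable (fun x => k * f x).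
Proof. by apply: cmeasurableM; exact: cmeasurable_cst. Qed.

Lemma cmeasurable_conj f : cmeasurable f -> cmeasurable (fun x => conjc (f x)).
Proof.
move=> [f1 f2]; split.
  by rewrite (_ : (fun x => _) = (fun x => Re (f x)))//; apply/funext => x; case: (f x).
rewrite (_ : (fun x => _) = (fun x => - Im (f x))); first exact: measurable_funN.
by apply/funext => x; case: (f x).
Qed.

Lemma cmeasurable_norm f : cmeasurable f -> measurable_fun setT (fun x => normc (f x)).
Proof.
move=> [f1 f2].
rewrite (_ : (fun x => _) = (fun x => Num.sqrt (Re (f x) ^+ 2 + Im (f x) ^+ 2))).
  have ms : measurable_fun setT (fun x : R => Num.sqrt x).
    by apply: continuous_measurable_fun; exact: sqrt_continuous.
  apply: (measurableT_comp ms).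
  by apply: measurable_funD; exact: measurable_funX.
by apply/funext => x; case: (f x).
Qed.

Lemma cmeasurable_real (f : T -> R) : measurable_fun setT f -> cmeasurable (fun x => (f x)%:C).
Proof. by move=> mf; split => //; exact: measurable_cst. Qed.

Lemma cmeasurable_cexp f : cmeasurable f -> cmeasurable (fun x => cexp (f x)).
Proof.
move=> [f1 f2].
have mc : measurable_fun setT (@cos R).
  by apply: continuous_measurable_fun; exact: continuous_cos.
have ms : measurable_fun setT (@sin R).
  by apply: continuous_measurable_fun; exact: continuous_sin.
have me : measurable_fun setT (fun x => expR (Re (f x))).
  by apply: measurableT_comp => //; exact: measurable_expR.
split.
  under eq_fun do rewrite Re_cexp; apply: measurable_funM => //.
  exact: (measurableT_comp mc).
under eq_fun do rewrite Im_cexp; apply: measurable_funM => //.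
exact: (measurableT_comp ms).
Qed.

Lemma cintegrableP f : cintegrable mu f <->
  cmeasurable f /\ (\int[mu]_x (normc (f x))%:E < +oo)%E.
Proof.
split=> [[/integrableP[f1 i1] /integrableP[f2 i2]]|[[f1 f2] i]].
  have mf : cmeasurable f by split; exact/measurable_EFinP.
  split => //.
  apply: (@le_lt_trans _ _ (\int[mu]_x (`|(Re (f x))%:E| + `|(Im (f x))%:E|))%E).
    apply: ge0_le_integral => //.
    - by move=> x _; rewrite lee_fin normc_ge0.
    - by apply/measurable_EFinP; exact: cmeasurable_norm.
    - by apply: emeasurable_funD; exact: measurableT_comp.
    - by move=> x _; rewrite -EFinD lee_fin normc_le.
  rewrite ge0_integralD//; last 2 first.
    exact: measurableT_comp.
    exact: measurableT_comp.
  exact: lte_add_pinfty.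
have mf : cmeasurable f by [].
have mn : measurable_fun setT (fun x => (normc (f x))%:E).
  by apply/measurable_EFinP; exact: cmeasurable_norm.
split; apply/integrableP; split; (try exact/measurable_EFinP);
  apply: le_lt_trans i; apply: ge0_le_integral => //.
- by apply: measurableT_comp => //; exact/measurable_EFinP.
- by move=> x _; rewrite lee_fin Re_le_normc.
- by apply: measurableT_comp => //; exact/measurable_EFinP.
- by move=> x _; rewrite lee_fin Im_le_normc.
Qed.

Lemma cintegrable_measurable f : cintegrable mu f -> cmeasurable f.
Proof. by move=> /cintegrableP[]. Qed.

Lemma cintegrable_le f (g : T -> R) : cmeasurable f -> measurable_fun setT g ->
  (forall x, normc (f x) <= g x) -> (\int[mu]_x (g x)%:E < +oo)%E -> cintegrable mu f.
Proof.
move=> mf mg fg ig; apply/cintegrableP; split => //; apply: le_lt_trans ig.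
apply: ge0_le_integral => //.
- by move=> x _; rewrite lee_fin normc_ge0.
- by apply/measurable_EFinP; exact: cmeasurable_norm.
- exact/measurable_EFinP.
- by move=> x _; rewrite lee_fin.
Qed.

Lemma cintegrableD f g : cintegrable mu f -> cintegrable mu g ->
  cintegrable mu (fun x => f x + g x).
Proof.
move=> [f1 f2] [g1 g2]; split.
  by under eq_fun do rewrite cReD EFinD; exact: integrableD.
by under eq_fun do rewrite cImD EFinD; exact: integrableD.
Qed.

Lemma cintegrableZ k f : cintegrable mu f -> cintegrable mu (fun x => k * f x).
Proof.
move=> /cintegrableP[mf fi]; apply/cintegrableP; split; first exact: cmeasurableZ.
under eq_integral do rewrite normcM EFinM.
rewrite ge0_integralZl_EFin//.
- by apply: lte_mul_pinfty => //; rewrite ?lee_fin ?normc_ge0.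
- by move=> x _; rewrite lee_fin normc_ge0.
- by apply/measurable_EFinP; exact: cmeasurable_norm.
- exact: normc_ge0.
Qed.

Lemma cintegralD f g : cintegrable mu f -> cintegrable mu g ->
  cintegral mu (fun x => f x + g x) = cintegral mu f + cintegral mu g.
Proof.
move=> [f1 f2] [g1 g2]; apply: eq_cplx; rewrite /cintegral /=.
  by under eq_Rintegral do rewrite cReD; rewrite RintegralD.
by under eq_Rintegral do rewrite cImD; rewrite RintegralD.
Qed.

Lemma cintegralZ k f : cintegrable mu f ->
  cintegral mu (fun x => k * f x) = k * cintegral mu f.
Proof.
move=> [f1 f2].
have Z (r : R) (h : T -> R) : mu.-integrable setT (fun x => (h x)%:E) ->
   mu.-integrable setT (fun x => (r * h x)%:E).
  by move=> hi; under eq_fun do rewrite EFinM; exact: integrableZl.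
apply: eq_cplx; rewrite /cintegral /=.
  under eq_Rintegral do rewrite cReM.
  by rewrite RintegralB ?RintegralZl ?cReM //; exact: Z.
under eq_Rintegral do rewrite cImM.
by rewrite RintegralD ?RintegralZl ?cImM //; exact: Z.
Qed.

Lemma cintegral_conj f : cintegrable mu f ->
  cintegral mu (fun x => conjc (f x)) = conjc (cintegral mu f).
Proof.
move=> [f1 f2]; apply: eq_cplx; rewrite /cintegral /=.
  by apply: eq_Rintegral => x _; case: (f x).
rewrite -mulN1r -RintegralZl//; apply: eq_Rintegral => x _; rewrite mulN1r.
by case: (f x).
Qed.

Lemma eq_cintegral f g : f =1 g -> cintegral mu f = cintegral mu g.
Proof. by move=> /funext ->. Qed.

(** Multiplying by the conjugate of the integral makes it a real integral. *)
Lemma normc_cintegral f : cintegrable mu f ->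
  ((normc (cintegral mu f))%:E <= \int[mu]_x (normc (f x))%:E)%E.
Proof.
move=> fi; set al := cintegral mu f.
have [->|al0] := eqVneq (normc al) 0.
  by apply: integral_ge0 => x _; rewrite lee_fin normc_ge0.
have al_gt0 : 0 < normc al by rewrite lt_neqAle normc_ge0 eq_sym al0.
have [mf finf] := (cintegrableP f).1 fi.
have E1 : (normc al ^+ 2)%:E = (\int[mu]_x (Re (conjc al * f x))%:E)%E.
  have [h1 h2] := cintegrableZ (conjc al) fi.
  have := cintegralZ (conjc al) fi; rewrite -/al mulrC mulcJ => /(congr1 (@Re R)) /=.
  rewrite /Rintegral => <-; rewrite fineK//.
  exact: integrable_fin_num.
have E2 : ((normc al ^+ 2)%:E <= (normc al)%:E * \int[mu]_x (normc (f x))%:E)%E.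
  rewrite E1; have [h1 h2] := cintegrableZ (conjc al) fi.
  apply: (@le_trans _ _ (\int[mu]_x `|(Re (conjc al * f x))%:E|)%E).
    apply: le_trans (lee_abs _) _.
    by apply: le_abse_integral => //; case/integrableP: h1.
  rewrite -ge0_integralZl_EFin ?normc_ge0//; last 2 first.
    by move=> x _; rewrite lee_fin normc_ge0.
    by apply/measurable_EFinP; exact: cmeasurable_norm.
  apply: ge0_le_integral => //.
  - by apply: measurableT_comp => //; case/integrableP: h1.
  - apply/measurable_EFinP; apply: measurable_funM => //; exact: cmeasurable_norm.
  - by move=> x _; rewrite -EFinM lee_fin (le_trans (Re_le_normc _))// normcM normcJ.
have I0 : (0 <= \int[mu]_x (normc (f x))%:E)%E.
  by apply: integral_ge0 => x _; rewrite lee_fin normc_ge0.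
move: E2 finf I0; case: (integral _ _ _) => // r; rewrite -EFinM !lee_fin => E2 _ _.
by move: E2; rewrite expr2 ler_pM2l.
Qed.

End complex_integral.

(** * Gaussian integrals *)

Section gaussian_integral.
Context {R : realType}.

Lemma integral_gaussian1 (kap : R) : 0 < kap ->
  (\int[lebesgue_measure]_(t in [set: R]) (expR (- (kap * (t * t))))%:E = (Num.sqrt (pi / kap))%:E)%E.
Proof.
move=> kap0.
have s0 : 0 < Num.sqrt kap by rewrite sqrtr_gt0.
have n0 : 0 <= `|Num.sqrt kap|^-1 by rewrite invr_ge0.
have := @integral_image R _ _ _ _ (@lebesgue_measure R) (@lebesgue_measure R)
  (fun y : R => Num.sqrt kap * y + 0) (NngNum n0) (EFin \o gauss_fun).
rewrite integralT_gauss => H.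
transitivity (\int[lebesgue_measure]_x (EFin \o gauss_fun) (Num.sqrt kap * x + 0)%R)%E.
  apply: eq_integral => x _; rewrite /= /gauss_fun addr0 exprMn sqr_sqrtr ?(ltW kap0)//.
rewrite H.
- rewrite -EFinM /= ger0_norm ?(ltW s0)// sqrtrM ?pi_ge0// sqrtrV ?(ltW kap0)//.
  by rewrite mulrC.
- by apply: measurable_funD => //; exact: measurable_funM.
- by move=> A mA; apply: lebesgue_measure_affine; rewrite ?gt_eqF.
- by apply/measurable_EFinP; exact: measurable_gauss_fun.
- by move=> y; rewrite /= lee_fin gauss_fun_ge0.
Qed.

Lemma integral_rV_cons d (f : 'rV[R]_d.+1 -> \bar R) :
  measurable_fun setT f -> (forall x, 0 <= f x)%E ->
  (\int[lebesgue_rV d.+1]_x f x =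
   \int[lebesgue_measure]_t \int[lebesgue_rV d]_v f (rV_cons (t, v)))%E.
Proof.
move=> mf f0.
have mc := @measurable_rV_cons R d.
have e1 := @integral_image1 R _ _ _ _ (@lebesgue_measure R \x lebesgue_rV d)%E
  (lebesgue_rV d.+1) (@rV_cons R d) f mc (fun A _ => erefl) mf.
rewrite -[LHS]e1 fubini_tonelli1//.
exact: measurableT_comp.
Qed.

Definition gaussian_mass (kap : R) d : R := Num.sqrt (pi / kap) ^+ d.

Lemma gaussian_mass_gt0 kap d : 0 < kap -> 0 < gaussian_mass kap d.
Proof. by move=> k0; rewrite exprn_gt0// sqrtr_gt0 divr_gt0// pi_gt0. Qed.

Lemma measurable_sqnorm d : measurable_fun setT (@sqnorm R d).
Proof.
rewrite (_ : sqnorm = fun x : 'rV[R]_d => \sum_i x ord0 i * x ord0 i)//.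
by apply: measurable_sum => i; apply: measurable_funM; exact: measurable_coord_rV.
Qed.

Lemma measurable_gauss (kap : R) d :
  measurable_fun setT (fun x : 'rV[R]_d => expR (- (kap * sqnorm x))).
Proof.
apply: (measurableT_comp (@measurable_expR R)); apply: measurable_funN.
by apply: measurable_funM => //; exact: measurable_sqnorm.
Qed.

Lemma integral_gaussian (kap : R) d : 0 < kap ->
  (\int[lebesgue_rV d]_x (expR (- (kap * sqnorm x)))%:E = (gaussian_mass kap d)%:E)%E.
Proof.
move=> kap0; elim: d => [|d IH].
  rewrite /= integral_dirac//; last by apply/measurable_EFinP; exact: measurable_gauss.
  by rewrite diracT mul1e /sqnorm /dotp big_ord0 mulr0 oppr0 expR0.
rewrite integral_rV_cons; last 2 first.
  by apply/measurable_EFinP; exact: measurable_gauss.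
  by move=> x; rewrite lee_fin expR_ge0.
have E t v : (expR (- (kap * sqnorm (rV_cons (t, v)))))%:E =
    ((expR (- (kap * (t * t))))%:E * (expR (- (kap * sqnorm v)))%:E)%E.
  rewrite -EFinM -expRD; congr (expR _)%:E.
  rewrite /sqnorm /dotp big_ord_recl rV_cons0 /=.
  under eq_bigr do rewrite rV_consS.
  by rewrite mulrDr opprD.
have inner t : (\int[lebesgue_rV d]_v (expR (- (kap * sqnorm (rV_cons (t, v)))))%:E =
    (gaussian_mass kap d)%:E * (expR (- (kap * (t * t))))%:E)%E.
  under eq_integral do rewrite E.
  rewrite ge0_integralZl_EFin ?expR_ge0 ?IH; first by rewrite muleC.
  - exact: measurableT.
  - by move=> x _; rewrite lee_fin expR_ge0.
  - by apply/measurable_EFinP; exact: measurable_gauss.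
  - by [].
under eq_integral do rewrite inner.
rewrite ge0_integralZl_EFin.
- by rewrite integral_gaussian1// -EFinM /gaussian_mass exprSr.
- exact: measurableT.
- by move=> x _; rewrite lee_fin expR_ge0.
- apply/measurable_EFinP; apply: (measurableT_comp (@measurable_expR R)).
  by apply: measurable_funN; apply: measurable_funM => //; exact: measurable_funM.
- exact/ltW/gaussian_mass_gt0.
Qed.

End gaussian_integral.

Section gaussian_functional.
Context {R : realType} {d : nat}.
Local Notation V := 'rV[R]_d.
Local Notation mu := (lebesgue_rV d).
Implicit Types (x : V) (Q : V -> R[i]).
Variable kap : R.
Hypothesis kap0 : 0 < kap.
Local Notation g := (gaussian kap).

Lemma exp_type_measurable Q : exp_type Q -> cmeasurable Q.
Proof. by move=> [h _]; apply: ccontinuous_cmeasurable; exact: diffn_cont (h 0%N). Qed.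

Lemma gaussian_measurable : cmeasurable (g : V -> R[i]).
Proof. by apply: ccontinuous_cmeasurable; exact: diffn_cont (diffn_gaussian kap 0). Qed.

Lemma gaussian_integrable_bound s : 0 <= s -> exists2 K : R, 0 <= K &
  forall B Q, 0 <= B -> exp_type Q -> (forall x, normc (Q x) <= B * expw s x) ->
    cintegrable mu (fun x => g x * Q x) /\
    normc (cintegral mu (fun x => g x * Q x)) <= K * B.
Proof.
move=> s0; pose k2 := kap / 2.
have k20 : 0 < k2 by rewrite divr_gt0.
pose C := expR (d%:R * (s ^+ 2 / (4 * k2))).
exists (C * gaussian_mass k2 d) => [|B Q B0 eQ hQ].
  by rewrite mulr_ge0 ?expR_ge0// ltW// gaussian_mass_gt0.
have mf : cmeasurable (fun x => g x * Q x).
  by apply: cmeasurableM; [exact: gaussian_measurable|exact: exp_type_measurable].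
pose h x := C * B * expR (- (k2 * sqnorm x)).
have mh : measurable_fun setT h.
  by apply: measurable_funM => //; exact: measurable_gauss.
have le x : normc (g x * Q x) <= h x.
  rewrite normcM normc_real ger0_norm ?expR_ge0//.
  apply: (@le_trans _ _ (expR (- (kap * sqnorm x)) * (B * expw s x))).
    by rewrite ler_wpM2l ?expR_ge0.
  rewrite (_ : kap = k2 + k2); last by rewrite /k2 -splitr.
  rewrite mulrDl opprD expRD.
  rewrite (_ : _ * _ = (expR (- (k2 * sqnorm x)) * expw s x) * (B * expR (- (k2 * sqnorm x)))); last by ring.
  rewrite /h -[leRHS]mulrA ler_wpM2r ?mulr_ge0 ?expR_ge0//.
  exact: gaussian_dominates.
have ih : (\int[mu]_x (h x)%:E = (C * B * gaussian_mass k2 d)%:E)%E.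
  under eq_integral do rewrite /h EFinM.
  rewrite ge0_integralZl_EFin.
  - by rewrite integral_gaussian// -EFinM.
  - exact: measurableT.
  - by move=> x _; rewrite lee_fin expR_ge0.
  - by apply/measurable_EFinP; exact: measurable_gauss.
  - by rewrite mulr_ge0// expR_ge0.
have int : cintegrable mu (fun x => g x * Q x).
  by apply: (cintegrable_le mf mh le); rewrite ih ltry.
split => //; rewrite -lee_fin (le_trans (normc_cintegral int))//.
rewrite [in leRHS]mulrAC -ih; apply: ge0_le_integral => //.
- by move=> x _; rewrite lee_fin normc_ge0.
- by apply/measurable_EFinP; exact: cmeasurable_norm.
- exact/measurable_EFinP.
- by move=> x _; rewrite lee_fin.
Qed.

Definition gaussian_average Q : R[i] := cintegral mu (fun x => g x * Q x).

Lemma exp_type_gaussian_integrable Q : exp_type Q -> cintegrable mu (fun x => g x * Q x).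
Proof.
move=> eQ; have [_ /(_ 0%N)[s [B [s0 B0 [hB _]]]]] := eQ.
have [K _ h] := gaussian_integrable_bound s0.
by have [] := h B Q B0 eQ hB.
Qed.

(** Thus the transforms of [gaussian_average] are analytic and can be differentiated under the
   integral sign. *)
Lemma gaussian_average_exp_bounded : exp_bounded gaussian_average.
Proof.
split.
  move=> a b P Q eP eQ; rewrite /gaussian_average.
  rewrite -!cintegralZ; [|exact: exp_type_gaussian_integrable..].
  rewrite -cintegralD; last 2 first.
    by apply: cintegrableZ; exact: exp_type_gaussian_integrable.
    by apply: cintegrableZ; exact: exp_type_gaussian_integrable.
  by apply: eq_cintegral => x; ring.
move=> s s0; have [K K0 h] := gaussian_integrable_bound s0.
exists 0%N, K; split => // B Q B0 eQ [hQ _].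
by have [] := h B Q B0 eQ hQ.
Qed.

Lemma cintegral_translate (a : V) (f : V -> R[i]) : cmeasurable f ->
  cintegral mu (fun x => f (x + a)) = cintegral mu f.
Proof.
move=> [f1 f2].
have m1 : measurable_fun setT (fun x => (Re (f x))%:E) by exact/measurable_EFinP.
have m2 : measurable_fun setT (fun x => (Im (f x))%:E) by exact/measurable_EFinP.
apply: eq_cplx; rewrite /cintegral /= /Rintegral; congr fine.
  exact: (integral_translate a m1).
exact: (integral_translate a m2).
Qed.

Definition rlin (b : V) : 'I_d -> R[i] := fun j => (b ord0 j)%:C.
Definition ilin (b : V) : 'I_d -> R[i] := fun j => 0 +i* b ord0 j.

Lemma linform_rlin b x : linform (rlin b) x = (dotp b x)%:C.
Proof.
by rewrite /dotp rmorph_sum; apply: eq_bigr => j _; rewrite /rlin rmorphM.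
Qed.

Lemma linform_ilin b x : linform (ilin b) x = (0 +i* 1) * (dotp b x)%:C.
Proof.
rewrite -linform_rlin /linform mulr_sumr; apply: eq_bigr => j _.
by apply: eq_cplx; rewrite /ilin /rlin /=; ring.
Qed.

Lemma dotpr0 x : dotp x 0 = 0.
Proof. by rewrite -(scale0r (0 : V)) dotpZr mul0r. Qed.
Lemma sqnorm0 : sqnorm (0 : V) = 0.
Proof. exact: dotpr0. Qed.

(** Completing the square: translation by [a / (2 kappa)]. *)
Lemma gaussian_average_shift (a b : V) :
  gaussian_average (fun x => cexp (linform (rlin a) x) * cexp (linform (ilin b) x)) =
  cexp (((4 * kap)^-1 * sqnorm a) +i* ((2 * kap)^-1 * dotp b a)) *
  gaussian_average (fun x => cexp (linform (ilin b) x)).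
Proof.
pose f x := g x * (cexp (linform (rlin a) x) * cexp (linform (ilin b) x)).
have ef : exp_type (fun x => cexp (linform (rlin a) x) * cexp (linform (ilin b) x)).
  by apply: exp_typeM; exact: exp_type_cexp_linform.
have mf : cmeasurable f.
  by apply: cintegrable_measurable; exact: exp_type_gaussian_integrable.
have eb := exp_type_cexp_linform (ilin b).
rewrite /gaussian_average -/f -(cintegral_translate ((2 * kap)^-1 *: a) mf).
rewrite -cintegralZ; last exact: exp_type_gaussian_integrable.
apply: eq_cintegral => x; rewrite /f !gaussianE -!cexpD; congr cexp.
rewrite !linform_rlin !linform_ilin !dotpDr !dotpZr sqnormD dotpZr sqnormZ (dotpC x a).
have k1 : kap != 0 by rewrite gt_eqF.
by apply: eq_cplx => /=; rewrite /sqnorm; field.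
Qed.

(** Along the complex line [s + i t] spanned by [b], the transform [f] satisfies
   [d_t f = i d_s f], and its dependence on [s] is known from [gaussian_average_shift]; at
   [s = 0] this is the differential equation of a Gaussian in [t]. *)
Lemma gaussian_fourier (b : V) : gaussian_average (fun x => cexp (linform (ilin b) x)) =
  (expR (- ((4 * kap)^-1 * sqnorm b)) * gaussian_mass kap d)%:C.
Proof.
pose ii : R[i] := 0 +i* 1.
pose mus (i : 'I_2) : 'I_d -> R[i] := if i == ord0 then rlin b else ilin b.
pose L := gaussian_average.
have hL := gaussian_average_exp_bounded.
pose Z (s t : R) : 'rV[R]_2 := \row_i (if i == ord0 then s else t).
have Z0 s t : Z s t ord0 ord0 = s by rewrite mxE.
have Z1 s t : Z s t ord0 (lift ord0 ord0) = t by rewrite mxE.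
have mus0 : mus ord0 = rlin b by [].
have mus1 : mus (lift ord0 ord0) = ilin b by [].
have kE s t x : expkernel mus (Z s t) x =
    cexp (linform (rlin (s *: b)) x) * cexp (linform (ilin (t *: b)) x).
  rewrite /expkernel big_ord_recl big_ord1 Z0 Z1 mus0 mus1 cexpD.
  rewrite !linform_rlin !linform_ilin !dotpZl !rmorphM; congr (_ * cexp _).
  exact: mulrCA.
pose phi t := L (fun x => cexp (linform (ilin (t *: b)) x)).
have lap s t : laplace L mus (Z s t) =
    cexp (((4 * kap)^-1 * sqnorm (s *: b)) +i* ((2 * kap)^-1 * dotp (t *: b) (s *: b))) * phi t.
  rewrite /laplace /phi -gaussian_average_shift; congr L.
  by apply/funext => x; exact: kE.
have lap0 t : laplace L mus (Z 0 t) = phi t.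
  by rewrite lap scale0r sqnorm0 dotpr0 !mulr0 (_ : 0 +i* 0 = 0)// cexp0 mul1r.
pose c := (2 * kap)^-1 * sqnorm b.
(* the derivative in [s] from the explicit formula *)
have d0 (t : R) : is_cderive (Z 0 t) (basis_rV ord0) (laplace L mus) (ii * (c * t)%:C * phi t).
  apply/is_cderive_line.
  have E (s : R) : s *: basis_rV ord0 + Z 0 t = Z s t.
    apply/rowP => i; rewrite !mxE eqxx /=.
    by case: (i == ord0); rewrite /= ?mulr1 ?addr0 // mulr0 add0r.
  apply: is_cderive_ext (fun s => esym (congr1 _ (E s))).
  apply: is_cderive_ext (fun s => esym (lap s t)).
  apply: is_cderive_eq (is_cderiveM (L := ii * (c * t)%:C) (is_cderive_eq (is_cderive_cexp (L := ii * (c * t)%:C) _) _) (is_cderive_cst _ _ _)) _.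
  - split => /=.
      rewrite (_ : (fun y => _) = ((4 * kap)^-1 * sqnorm b) \*: (id ^+ 2)); last first.
        by apply/funext => s; rewrite sqnormZ exprfctE -[RHS]/(_ * _); ring.
      by apply: is_derive_eq; rewrite /GRing.scale /=; ring.
    rewrite (_ : (fun y => _) = (c * t) \*: id); last first.
      by apply/funext => s; rewrite dotpZl dotpZr /c /sqnorm -[RHS]/(_ * _); ring.
    by apply: is_derive_eq; rewrite /GRing.scale /=; ring.
  - by rewrite scale0r sqnorm0 dotpr0 !mulr0 (_ : 0 +i* 0 = 0)// cexp0 mulr1.
  - by rewrite mulr0 addr0.
(* the derivative in [t] is [ii] times the derivative in [s] *)
have d1 (t : R) : is_cderive t 1 phi (- (c * t)%:C * phi t).
  have h0 := is_cderive_laplace mus hL (Z 0 t) ord0.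
  have h1 := is_cderive_laplace mus hL (Z 0 t) (lift ord0 ord0).
  have e0 : L (fun T => expkernel mus (Z 0 t) T * linform (mus ord0) T) = ii * (c * t)%:C * phi t.
    have [_ E0] := cpartialP h0; have [_ E1] := cpartialP (d0 t).
    exact: etrans (esym E0) E1.
  have e1 : L (fun T => expkernel mus (Z 0 t) T * linform (mus (lift ord0 ord0)) T) =
      - (c * t)%:C * phi t.
    rewrite (_ : (fun T => _) = fun T => ii * (expkernel mus (Z 0 t) T * linform (mus ord0) T)).
      rewrite exp_boundedZ//.
        by rewrite e0 !mulrA sqr_ii mulN1r.
      by apply: exp_typeM; [exact: exp_type_expkernel|exact: exp_type_linform].
    apply/funext => T; rewrite mus0 mus1 linform_ilin linform_rlin.
    by rewrite mulrCA.
  apply/is_cderive_line.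
  have /is_cderive_line h1' := is_cderive_eq h1 e1.
  apply: (is_cderive_ext h1') => s.
  rewrite -lap0; congr (laplace L mus _); apply/rowP => i.
  rewrite !mxE eqxx /=; case: (split_ordP (m := 1) i) => j ->; rewrite (ord1 j) /=.
    by rewrite mulr0 addr0.
  by rewrite /GRing.scale /=.
(* [phi' = - c t phi], so that [F] is constant. *)
pose F t := cexp ((2^-1 * c * t ^+ 2))%:C * phi t.
have dF (t : R) : is_cderive t 1 F 0.
  have hq : is_derive t 1 (fun t : R => 2^-1 * c * t ^+ 2) (c * t).
    rewrite (_ : (fun t => _) = (2^-1 * c) \*: (id ^+ 2)); last first.
      by apply/funext => s; rewrite exprfctE.
    by apply: is_derive_eq; rewrite /GRing.scale /=; field.
  apply: is_cderive_eq (is_cderiveM (is_cderive_cexp (is_cderive_real hq)) (d1 t)) _.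
  by ring.
have F10 : normc (F 1 - F 0) <= 0.
  have := @is_cderive_mean_value R F (fun=> 0) (fun=> 0) (fun=> 0) 0 1 ler01 dF
    (fun t => is_derive_cst _ _ _).
  by rewrite subrr; apply => t _; rewrite normc0.
have : F 1 = F 0.
  apply/eqP; rewrite -subr_eq0; apply/eqP/normc_eq0/le_anti.
  by rewrite F10 normc_ge0.
have phi0 : phi 0 = (gaussian_mass kap d)%:C.
  rewrite /phi /L /gaussian_average.
  rewrite (_ : (fun x => _) = fun x : V => (expR (- (kap * sqnorm x)))%:C); last first.
    apply/funext => x; by rewrite linform_ilin scale0r dotpC dotpr0 mulr0 cexp0 mulr1.
  apply: eq_cplx; rewrite /cintegral /= /Rintegral; first by rewrite integral_gaussian.
  by rewrite integral0.
rewrite /F phi0 expr0n mulr0 cexp0 mul1r expr1n mulr1 /phi scale1r => E.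
have W1 : cexp (- (2^-1 * c)%:C) * cexp ((2^-1 * c)%:C) = 1 :> R[i].
  by rewrite -cexpD addNr cexp0.
have := congr1 (fun z => cexp (- (2^-1 * c)%:C) * z) E; rewrite mulrA W1 mul1r => H; apply: (etrans H).
rewrite -rmorphN cexp_real -rmorphM; congr (expR (- _) * _)%:C.
by rewrite /c; field; rewrite gt_eqF.
Qed.

Lemma normc_gaussian_average (a b : V) :
  normc (gaussian_average (fun x => cexp (linform (rlin a) x) * cexp (linform (ilin b) x))) =
  expR ((4 * kap)^-1 * (sqnorm a - sqnorm b)) * gaussian_mass kap d.
Proof.
rewrite gaussian_average_shift gaussian_fourier normcM normc_cexp normc_real /=.
rewrite ger0_norm; last by rewrite mulr_ge0 ?expR_ge0// ltW// gaussian_mass_gt0.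
by rewrite mulrA -expRD mulrBr.
Qed.

End gaussian_functional.

(** * The sesqui-holomorphic extension *)

Section symplectic.
Context {R : realType} {n : nat}.
Local Notation V := 'rV[R]_(n + n).
Implicit Types (X Y T : V).

(** Multiplication by [-i] when [(x, xi)] is identified with [x + i xi]. *)
Definition sympJ X : V := row_mx (rsubmx X) (- lsubmx X).

Lemma sympJD X Y : sympJ (X + Y) = sympJ X + sympJ Y.
Proof. by rewrite /sympJ !linearD add_row_mx. Qed.
Lemma sympJZ (t : R) X : sympJ (t *: X) = t *: sympJ X.
Proof. by rewrite /sympJ !linearZ /= scale_row_mx scalerN. Qed.
Lemma sympJ0 : sympJ 0 = 0.
Proof. by rewrite /sympJ !raddf0 row_mx0. Qed.

Lemma dotp_row_mx m1 m2 (a c : 'rV[R]_m1) (b e : 'rV[R]_m2) :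
  dotp (row_mx a b) (row_mx c e) = dotp a c + dotp b e.
Proof.
rewrite /dotp big_split_ord /=; congr (_ + _); apply: eq_bigr => i _.
  by rewrite !row_mxEl.
by rewrite !row_mxEr.
Qed.

Lemma dotp_sympJ X Y : dotp (sympJ X) Y = - dotp X (sympJ Y).
Proof.
rewrite -{1}[Y]hsubmxK -{2}[X]hsubmxK /sympJ !dotp_row_mx dotpNl dotpNr opprD opprK.
by rewrite addrC.
Qed.

Lemma dotp_sympJJ X : dotp (sympJ X) X = 0.
Proof.
have := dotp_sympJ X X; rewrite [dotp X _]dotpC => h.
have : dotp (sympJ X) X *+ 2 = 0 by rewrite mulr2n {1}h addNr.
by move/eqP; rewrite mulrn_eq0 /= => /eqP.
Qed.

Lemma sympJ_coordl X (j : 'I_n) : sympJ X ord0 (lshift n j) = X ord0 (rshift n j).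
Proof. by rewrite row_mxEl mxE. Qed.
Lemma sympJ_coordr X (j : 'I_n) : sympJ X ord0 (rshift n j) = - X ord0 (lshift n j).
Proof. by rewrite row_mxEr !mxE. Qed.

(** With [z], [w], [s] the complex points of [X], [Y], [T]: [hol i] is the coefficient of [X_i] in
   [z . conj s] and [ahol i] that of [Y_i] in [conj w . s], as linear forms in [T]. *)
Definition hol (i : 'I_(n + n)) : 'I_(n + n) -> R[i] :=
  fun l => rlin (basis_rV i) l + ilin (sympJ (basis_rV i)) l.
Definition ahol (i : 'I_(n + n)) : 'I_(n + n) -> R[i] :=
  fun l => rlin (basis_rV i) l - ilin (sympJ (basis_rV i)) l.

Local Notation ii := ((0 : R) +i* 1).

Lemma linform_hol i T : linform (hol i) T =
  (T ord0 i)%:C + ii * (- sympJ T ord0 i)%:C.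
Proof.
rewrite /linform /hol; under eq_bigr do rewrite mulrDl.
rewrite big_split /= -/(linform _ _) -/(linform _ _) linform_rlin linform_ilin.
by rewrite dotp_sympJ ![dotp (basis_rV i) _]dotpC !dotp_basis.
Qed.

Lemma linform_ahol i T : linform (ahol i) T =
  (T ord0 i)%:C + ii * (sympJ T ord0 i)%:C.
Proof.
rewrite /linform /ahol; under eq_bigr do rewrite mulrDl mulNr.
rewrite big_split /= sumrN -/(linform _ _) -/(linform _ _) linform_rlin linform_ilin.
rewrite dotp_sympJ ![dotp (basis_rV i) _]dotpC !dotp_basis.
by rewrite -mulrN -rmorphN opprK.
Qed.

Lemma hol_CR (j : 'I_n) T :
  linform (hol (lshift n j)) T + ii * linform (hol (rshift n j)) T = 0.
Proof.
rewrite !linform_hol sympJ_coordl sympJ_coordr opprK.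
by apply: eq_cplx => /=; ring.
Qed.

Lemma ahol_CR (j : 'I_n) T :
  linform (ahol (lshift n j)) T - ii * linform (ahol (rshift n j)) T = 0.
Proof.
rewrite !linform_ahol sympJ_coordl sympJ_coordr.
by apply: eq_cplx => /=; ring.
Qed.

End symplectic.

Section weyl_extension.
Context {R : realType} {n : nat}.
Local Notation V := 'rV[R]_(n + n).
Local Notation W := 'rV[R]_((n + n) + (n + n)).
Local Notation ii := ((0 : R) +i* 1).
Implicit Types (X Y T : V) (Z p : W).
Variable h : R.
Hypothesis h0 : 0 < h.
Local Notation kap := (h^-1).

Let kap0 : 0 < kap. Proof. by rewrite invr_gt0. Qed.

(** [z . conj w] for the complex points [z], [w] of [X], [Y]. *)
Definition hermitian X Y : R[i] := (dotp X Y)%:C + ii * (dotp (sympJ X) Y)%:C.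

(** The linear forms in [T] multiplying the coordinates of [(X, Y)] in
   [(z . conj s + conj w . s) / h]. *)
Definition pair_form (k : 'I_((n + n) + (n + n))) : 'I_(n + n) -> R[i] :=
  match fintype.split k with inl i => fun l => kap%:C * hol i l | inr i => fun l => kap%:C * ahol i l end.

Lemma pair_forml i : pair_form (lshift _ i) = fun l => kap%:C * hol i l.
Proof. by rewrite /pair_form; case: fintype.split_ordP => j /eqP; rewrite eq_shift // => /eqP ->. Qed.
Lemma pair_formr i : pair_form (rshift _ i) = fun l => kap%:C * ahol i l.
Proof. by rewrite /pair_form; case: fintype.split_ordP => j /eqP; rewrite eq_shift // => /eqP ->. Qed.

Lemma linform_scale d (c : R[i]) (a : 'I_d -> R[i]) (T : 'rV[R]_d) :
  linform (fun l => c * a l) T = c * linform a T.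
Proof. by rewrite /linform mulr_sumr; apply: eq_bigr => l _; rewrite mulrA. Qed.

Lemma expkernel_pair X Y T : expkernel pair_form (row_mx X Y) T =
  cexp (linform (rlin (kap *: (X + Y))) T) * cexp (linform (ilin (kap *: sympJ (X - Y))) T).
Proof.
rewrite /expkernel -cexpD big_split_ord /=; congr cexp.
rewrite linform_rlin linform_ilin !dotpZl.
under eq_bigr do rewrite row_mxEl pair_forml linform_scale linform_hol.
under [X in _ + X]eq_bigr do rewrite row_mxEr pair_formr linform_scale linform_ahol.
apply: eq_cplx.
  rewrite cReD !cRe_sum /= dotpDl mulrDr /dotp !mulr_sumr.
  rewrite !mul0r !mulr0 ?subr0 ?addr0 -!big_split /=.
  by apply: eq_bigr => i _; ring.
rewrite cImD !cIm_sum /= dotp_sympJ dotpDl dotpNl opprB /dotp.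
rewrite mulrBr !mulr_sumr !mul0r !mul1r !add0r -!big_split -sumrB /=.
by apply: eq_bigr => i _; ring.
Qed.

Variable F : (V -> R[i]) -> R[i].
Hypothesis tF : tempered F.
Local Notation L := (gaussian_pairing kap F).

Let hL : exp_bounded L. Proof. exact: tempered_exp_bounded. Qed.

(** In the Gaussian [e^{-|z - s|^2 / h}] convolved with [F], the square is polarised into
   [z . conj w - z . conj s - conj w . s + |s|^2], which is its value when [w = z]. *)
Definition weyl_ext X Y : R[i] :=
  ((pi * h) ^- n)%:C *
  (cexp (- kap%:C * hermitian X Y) * laplace L pair_form (row_mx X Y)).

Lemma dconv_cst c Q : exp_type Q -> F (fun T => c * (gaussian kap T * Q T)) = c * L Q.
Proof.
move=> eQ; have sQ := schwartz_gaussian kap0 eQ; have [lin _] := tF.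
have := lin c 0 _ _ sQ sQ; rewrite mul0r addr0 => <-.
by congr F; apply/funext => T; rewrite mul0r addr0.
Qed.

Lemma exp_type_pair (a b : V) :
  exp_type (fun T => cexp (linform (rlin a) T) * cexp (linform (ilin b) T)).
Proof. by apply: exp_typeM; exact: exp_type_cexp_linform. Qed.

Lemma laplace_pair X Y : laplace L pair_form (row_mx X Y) =
  L (fun T => cexp (linform (rlin (kap *: (X + Y))) T) *
     cexp (linform (ilin (kap *: sympJ (X - Y))) T)).
Proof. by rewrite /laplace; congr L; apply/funext => T; exact: expkernel_pair. Qed.

Lemma V_weyl_pair X Y : V_weyl h F X Y = ((pi * h) ^- n)%:C *
  (cexp ((- (kap * sqnorm X)) +i* (- (2 * kap * dotp Y X))) *
   L (fun T => cexp (linform (rlin ((2 * kap) *: X)) T) *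
     cexp (linform (ilin ((2 * kap) *: Y)) T))).
Proof.
rewrite /V_weyl -dconv_cst; last exact: exp_type_pair.
congr (_ * F _); apply/funext => T.
rewrite gaussianE -!cexpD; congr cexp; rewrite linform_rlin linform_ilin !dotpZl.
rewrite sqnormB dotpDr dotpNr.
by apply: eq_cplx => /=; ring.
Qed.

Lemma sqnorm_half X Y : sqnorm (2^-1 *: (X + Y)) - dotp X Y = 4^-1 * sqnorm (X - Y).
Proof. by rewrite sqnormZ sqnormD sqnormB; field. Qed.

(** Up to a unimodular factor, the exponential tested against [F] in [weyl_ext] is a translated and
   modulated Gaussian, with centre [(X + Y) / 2] and frequency [J (X - Y) / 2]; the factor
   [e^{|X - Y|^2 / (4h)}] comes from completing the square. *)
Lemma normc_weyl_ext X Y : normc (weyl_ext X Y) =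
  expR ((4 * h)^-1 * sqnorm (X - Y)) *
  normc (V_weyl h F (2^-1 *: (X + Y)) (2^-1 *: sympJ (X - Y))).
Proof.
rewrite V_weyl_pair /weyl_ext laplace_pair !scalerA.
have h1 : 2 * kap * 2^-1 = kap by field; rewrite gt_eqF.
have nc (c z P : R[i]) : normc (c * (cexp z * P)) = expR (Re z) * normc (c * P).
  by rewrite (normcM c (_ * _)) (normcM (cexp z)) normc_cexp (normcM c P); ring.
rewrite h1 !nc /=.
rewrite !mul0r !mulr0 oppr0 !mul0r !subr0 addr0.
rewrite mulrA -expRD; congr (expR _ * _).
have := sqnorm_half X Y; move: (sqnorm _) (sqnorm _) (dotp _ _) => a b c E.
have -> : a = 4 * (b - c) by rewrite E; field.
by field; rewrite gt_eqF.
Qed.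

Lemma weyl_ext_diag X : weyl_ext X X = dconv F (nu_weyl_density h) X.
Proof.
rewrite /weyl_ext laplace_pair subrr sympJ0 scaler0.
rewrite -dconv_cst; last exact: exp_type_pair.
rewrite /dconv.
have e1 : exp_type (fun T => cexp (linform (rlin (kap *: (X + X))) T) * cexp (linform (ilin 0) T)).
  exact: exp_type_pair.
have -> : (fun T => nu_weyl_density h (X - T)) =
    fun T => ((pi * h) ^- n)%:C * cexp (- kap%:C * hermitian X X) *
    (gaussian kap T * (cexp (linform (rlin (kap *: (X + X))) T) * cexp (linform (ilin 0) T))).
  apply/funext => T; rewrite /nu_weyl_density rmorphM -mulrA; congr (_ * _).
  rewrite -[LHS]/((expR _)%:C) -cexp_real gaussianE -!cexpD; congr cexp.
  rewrite linform_rlin linform_ilin /hermitian dotp_sympJJ [dotp 0 T]dotpC dotpr0 dotpZl.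
  rewrite sqnormB dotpDl /sqnorm.
  by apply: eq_cplx => /=; ring.
by rewrite !dconv_cst// mulrA.
Qed.

(** Expanding both coordinates around [p] leaves a constant and three exponentials of square-free
   monomials in the increment. *)
Lemma analytic_at_bilinear (c : R[i]) (a b : 'I_((n + n) + (n + n))) p : a != b ->
  analytic_at (fun Z => cexp (c * (Z ord0 a * Z ord0 b)%:C)) p.
Proof.
move=> ab.
have -> : (fun Z => cexp (c * (Z ord0 a * Z ord0 b)%:C)) = fun Z : W =>
    cexp (c * (p ord0 a * p ord0 b)%:C) *
    (cexp (c * (p ord0 b)%:C * (\prod_(j in [set a]%SET) (Z - p) ord0 j)%:C) *
    (cexp (c * (p ord0 a)%:C * (\prod_(j in [set b]%SET) (Z - p) ord0 j)%:C) *
     cexp (c * (\prod_(j in [set a; b]%SET) (Z - p) ord0 j)%:C))).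
  apply/funext => Z; rewrite -!cexpD; congr cexp.
  rewrite !big_set1 big_setU1 ?inE//= big_set1 !mxE.
  by apply: eq_cplx => /=; rewrite !(cReM, cImM, cReD, cImD) /=; ring.
apply: analytic_at_mul; first exact: analytic_at_cst.
apply: analytic_at_mul; first by apply: (@analytic_at_cexp_monomial _ _ _ _ _ a); rewrite inE.
apply: analytic_at_mul; first by apply: (@analytic_at_cexp_monomial _ _ _ _ _ b); rewrite inE.
by apply: (@analytic_at_cexp_monomial _ _ _ _ _ a); rewrite !inE eqxx.
Qed.

Definition hermitian_pair Z : R[i] := hermitian (lsubmx Z) (rsubmx Z).

Lemma analytic_prefactor p : analytic_at (fun Z => cexp (- kap%:C * hermitian_pair Z)) p.
Proof.
pose c := - kap%:C.
have -> : (fun Z => cexp (- kap%:C * hermitian_pair Z)) = fun Z : W =>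
    \prod_(i < n + n) cexp (c * (Z ord0 (lshift _ i) * Z ord0 (rshift _ i))%:C) *
    \prod_(j < n) (cexp (c * ii * (Z ord0 (lshift _ (rshift n j)) * Z ord0 (rshift _ (lshift n j)))%:C) *
      cexp (- c * ii * (Z ord0 (lshift _ (lshift n j)) * Z ord0 (rshift _ (rshift n j)))%:C)).
  apply/funext => Z; rewrite -cexp_bigsum.
  under [X in _ = _ * X]eq_bigr do rewrite -cexpD.
  rewrite -cexp_bigsum -cexpD; congr cexp.
  rewrite /hermitian_pair /hermitian mulrDr; congr (_ + _).
    rewrite /dotp rmorph_sum mulr_sumr; apply: eq_bigr => i _.
    by rewrite !mxE.
  rewrite /dotp big_split_ord /= rmorphD !rmorph_sum -big_split /= mulrA mulr_sumr.
  apply: eq_bigr => j _; rewrite sympJ_coordl sympJ_coordr !mxE.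
  by rewrite [X in _ + X%:C]mulNr rmorphN /c; move: ii => u; ring.
apply: analytic_at_mul.
  by apply: analytic_at_prod => i _; apply: analytic_at_bilinear; rewrite eq_lrshift.
apply: analytic_at_prod => j _.
by apply: analytic_at_mul; apply: analytic_at_bilinear; rewrite eq_lrshift.
Qed.

Lemma weyl_ext_pairsE : on_pairs weyl_ext = fun Z =>
  ((pi * h) ^- n)%:C * (cexp (- kap%:C * hermitian_pair Z) * laplace L pair_form Z).
Proof. by apply/funext => Z; rewrite /on_pairs /weyl_ext hsubmxK. Qed.

Lemma weyl_ext_analytic : real_analytic (on_pairs weyl_ext).
Proof.
rewrite weyl_ext_pairsE; apply/real_analytic_at => p.
apply: analytic_at_mul; first exact: analytic_at_cst.
apply: analytic_at_mul; first exact: analytic_prefactor.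
by exists (laplace_coef L pair_form p), 1; exact: laplace_series.
Qed.

Lemma is_cderive_hermitianl Z i : is_cderive Z (basis_rV (lshift _ i)) hermitian_pair
  (linform (hol i) (rsubmx Z)).
Proof.
apply: (@is_cderive_quad _ _ _ _ _ _ 0 1) => // t _.
rewrite basis_lshift -{1}[Z]hsubmxK scale_row_mx add_row_mx scaler0 add0r.
rewrite /hermitian_pair /hermitian row_mxKl row_mxKr sympJD sympJZ !dotpDl !dotpZl.
rewrite linform_hol dotp_sympJ ![dotp (basis_rV i) _]dotpC !dotp_basis.
rewrite [X in normc X](_ : _ = 0) ?normc0 ?mul0r//.
by apply: eq_cplx; rewrite !(cReM, cImM, cReD, cImD, cReN, cImN) /=; ring.
Qed.

Lemma is_cderive_hermitianr Z i : is_cderive Z (basis_rV (rshift _ i)) hermitian_pair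
  (linform (ahol i) (lsubmx Z)).
Proof.
apply: (@is_cderive_quad _ _ _ _ _ _ 0 1) => // t _.
rewrite basis_rshift -{1}[Z]hsubmxK scale_row_mx add_row_mx scaler0 add0r.
rewrite /hermitian_pair /hermitian row_mxKl row_mxKr !dotpDr !dotpZr.
rewrite linform_ahol !dotp_basis.
rewrite [X in normc X](_ : _ = 0) ?normc0 ?mul0r//.
by apply: eq_cplx; rewrite !(cReM, cImM, cReD, cImD, cReN, cImN) /=; ring.
Qed.

(** The Cauchy-Riemann equations of the transform are linear relations between the forms. *)
Lemma laplace_CR (k l : 'I_((n + n) + (n + n))) (c : R[i]) Z :
  (forall T, linform (pair_form k) T + c * linform (pair_form l) T = 0) ->
  L (fun T => expkernel pair_form Z T * linform (pair_form k) T) +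
  c * L (fun T => expkernel pair_form Z T * linform (pair_form l) T) = 0.
Proof.
move=> hkl; have [lin _] := hL.
have e m : exp_type (fun T => expkernel pair_form Z T * linform (pair_form m) T).
  by apply: exp_typeM; [exact: exp_type_expkernel|exact: exp_type_linform].
have := lin 1 c _ _ (e k) (e l); rewrite mul1r => <-.
rewrite (_ : (fun T => _) = fun T => 0 * expkernel pair_form Z T).
  by rewrite exp_boundedZ ?mul0r//; exact: exp_type_expkernel.
apply/funext => T; rewrite mul0r mul1r mulrCA -mulrDr hkl mulr0 //.
Qed.

Lemma is_cderive_weyl_ext Z k (dq : R[i]) : is_cderive Z (basis_rV k) hermitian_pair dq ->
  cpartial k (on_pairs weyl_ext) Z = ((pi * h) ^- n)%:C * cexp (- kap%:C * hermitian_pair Z) *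
   (- kap%:C * dq * laplace L pair_form Z +
    L (fun T => expkernel pair_form Z T * linform (pair_form k) T)).
Proof.
move=> hq; rewrite weyl_ext_pairsE.
have dl := is_cderive_laplace pair_form hL Z k.
have de := is_cderive_cexp (is_cderiveZ (- kap%:C) hq).
have [_ ->] := cpartialP (is_cderiveZ (((pi * h) ^- n)%:C) (is_cderiveM de dl)).
by ring.
Qed.

Lemma CR_combine (u k A P a b a' b' : R[i]) : a' + u * b' = 0 -> a + u * b = 0 ->
  A * (- k * a' * P + a) + u * (A * (- k * b' * P + b)) = 0.
Proof.
move=> E1 E2.
transitivity (A * (- k * (a' + u * b') * P + (a + u * b))); first by ring.
by rewrite E1 E2 mulr0 mul0r addr0 mulr0.
Qed.

(** The prefactor and the transform satisfy the same Cauchy-Riemann equations, by [hol_CR] and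
   [ahol_CR]. *)
Theorem weyl_ext_sesqui : is_sesqui_ext (dconv F (nu_weyl_density h)) weyl_ext.
Proof.
split; first exact: weyl_ext_analytic.
split; [|split; last exact: weyl_ext_diag].
  move=> X Y j; rewrite !cpartial_lshift.
  rewrite !(is_cderive_weyl_ext (is_cderive_hermitianl _ _)).
  have := hol_CR j (rsubmx (row_mx X Y)).
  have := @laplace_CR (lshift _ (lshift n j)) (lshift _ (rshift n j)) ii (row_mx X Y).
  rewrite !pair_forml; move=> H E; apply: CR_combine; first exact: E.
  by apply: H => T; rewrite !linform_scale mulrCA -mulrDr hol_CR mulr0.
move=> X Y j; rewrite !cpartial_rshift.
rewrite !(is_cderive_weyl_ext (is_cderive_hermitianr _ _)).
have := ahol_CR j (lsubmx (row_mx X Y)).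
have := @laplace_CR (rshift _ (lshift n j)) (rshift _ (rshift n j)) (- ii) (row_mx X Y).
rewrite !pair_formr.
move=> H E; rewrite -mulNr; apply: CR_combine; first by rewrite mulNr; exact: E.
by apply: H => T; rewrite !linform_scale mulNr mulrCA -mulrBr ahol_CR mulr0.
Qed.

End weyl_extension.

(** * The norm of the extension *)

Section unmeasurable_monotone.
Context d (T : measurableType d) {R : realType} (mu : {measure set T -> \bar R}).
Local Open Scope ereal_scope.

(** For suprema over uncountable families, such as the least admissible function, whose measurability
   is not at hand. *)
Lemma ge0_integral_le (f g : T -> \bar R) : (forall x, 0 <= f x) -> (forall x, f x <= g x) ->
  \int[mu]_x f x <= \int[mu]_x g x.
Proof.
move=> f0 fg.
rewrite !ge0_integralTE//; last by move=> x; exact: le_trans (fg x).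
apply: le_ereal_sup => _ [k /= kf <-]; exists k => // x; exact: le_trans (fg x).
Qed.

Lemma L1_Linfty_normE (f : T -> \bar R) :
  'N[mu]_1[f] + 'N[mu]_+oo[f] =
  \int[mu]_x `|f x| + (if mu setT > 0 then ess_sup mu (abse \o f) else 0).
Proof. by rewrite Lnorm1 Lnorm.unlock. Qed.

End unmeasurable_monotone.

Section half_symplectic.
Context {R : realType} {n : nat}.
Local Notation V := 'rV[R]_(n + n).
Local Notation mu := (lebesgue_rV (n + n)).

(** The frequency at which the transform of [F] is evaluated in [normc_weyl_ext]. *)
Definition half_symp (W : V) : V := 2^-1 *: sympJ W.

Definition swap_halves (i : 'I_(n + n)) : 'I_(n + n) :=
  match fintype.split i with inl j => rshift n j | inr j => lshift n j end.

Lemma swap_halvesl j : swap_halves (lshift n j) = rshift n j.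
Proof. by rewrite /swap_halves; case: fintype.split_ordP => k /eqP; rewrite eq_shift // => /eqP ->. Qed.
Lemma swap_halvesr j : swap_halves (rshift n j) = lshift n j.
Proof. by rewrite /swap_halves; case: fintype.split_ordP => k /eqP; rewrite eq_shift // => /eqP ->. Qed.

Lemma swap_halvesK : cancel swap_halves swap_halves.
Proof.
move=> i; case: (fintype.split_ordP i) => j ->; by rewrite ?swap_halvesl ?swap_halvesr ?swap_halvesl.
Qed.

Definition half_sign (i : 'I_(n + n)) : R := (if (i < n)%N then 1 else -1) / 2.

Lemma half_symp_affine W : half_symp W = affine_coord swap_halves half_sign (fun=> 0) W.
Proof.
apply/rowP => i; rewrite /half_symp /half_sign mxE [RHS]mxE addr0.
case: (fintype.split_ordP i) => j ->.
  by rewrite swap_halvesl sympJ_coordl; ring.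
by rewrite swap_halvesr sympJ_coordr; ring.
Qed.

Lemma half_sign_neq0 i : half_sign i != 0.
Proof. by rewrite /half_sign mulf_neq0 ?invr_neq0 ?pnatr_eq0//; case: ifP => _; rewrite ?oppr_eq0 oner_eq0. Qed.

Lemma half_sign_prod : \prod_i `|half_sign i|^-1 = 2 ^+ (n + n) :> R.
Proof.
rewrite (eq_bigr (fun=> 2)) ?prodr_const ?card_ord// => i _.
by rewrite /half_sign normrM normfV; case: ifP => _; rewrite ?normrN normr1 normr_nat div1r invrK.
Qed.

Lemma measurable_half_symp : measurable_fun setT half_symp.
Proof. by rewrite (_ : half_symp = affine_coord swap_halves half_sign (fun=> 0)); [exact: measurable_affine_coord|apply/funext => W; exact: half_symp_affine]. Qed.

Lemma integral_half_symp (f : V -> \bar R) : measurable_fun setT f -> (forall x, (0 <= f x)%E) ->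
  (\int[mu]_x f (half_symp x) = (2 ^+ (n + n))%:E * \int[mu]_x f x)%E.
Proof.
move=> mf f0; rewrite -half_sign_prod.
rewrite -(@integral_affine_coord R _ swap_halves swap_halves half_sign (fun=> 0) f swap_halvesK swap_halvesK half_sign_neq0 mf f0).
by apply: eq_integral => x _; rewrite half_symp_affine.
Qed.

Lemma ess_sup_half_symp (f : V -> \bar R) :
  (ess_sup mu (f \o half_symp) <= ess_sup mu f)%E.
Proof.
apply/ess_supP; have [A [mA A0 sub]] := ess_sup_ge mu f.
exists (half_symp @^-1` A); split.
- by rewrite -[X in measurable X]setTI; apply: measurable_half_symp.
- have := @lebesgue_affine_coord R _ swap_halves swap_halves half_sign (fun=> 0) A swap_halvesK swap_halvesK half_sign_neq0 mA.
  rewrite (_ : affine_coord _ _ _ @^-1` A = half_symp @^-1` A); last first.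
    by apply/funext => x /=; rewrite half_symp_affine.
  by move=> e; apply: (etrans e); apply: etrans (mule0 _); congr (_ * _)%E; exact: A0.
- by move=> x; exact: sub.
Qed.

(** The change of variables multiplies the [L^1] norm by [2 ^ (2n)] and preserves null sets. *)
Lemma half_symp_norm (psi : V -> R) : measurable_fun setT psi ->
  (L1_Linfty_norm (fun W => (psi (half_symp W))%:E) <=
   (2 ^+ (n + n))%:E * L1_Linfty_norm (fun W => (psi W)%:E))%E.
Proof.
move=> mpsi; rewrite /L1_Linfty_norm !L1_Linfty_normE ge0_muleDr; last 2 first.
- by apply: integral_ge0 => x _; exact: abse_ge0.
- case: ifPn => // mT; by apply: ess_sup_gee => //; apply: nearW => x; exact: abse_ge0.
apply: leeD.
  rewrite -integral_half_symp//; apply: measurableT_comp => //.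
  exact/measurable_EFinP.
have c1 : (1 <= 2 ^+ (n + n) :> R)%R by rewrite exprn_ege1// ler1n.
case: ifPn => // mT; last by rewrite mule0.
have e0 : (0 <= ess_sup mu (abse \o (fun W => (psi W)%:E)))%E.
  by apply: ess_sup_gee => //; apply: nearW => x; exact: abse_ge0.
apply: (le_trans (ess_sup_half_symp (abse \o (fun W => (psi W)%:E)))).
by rewrite -[leLHS]mul1e; apply: lee_wpmul2r => //; rewrite lee_fin.
Qed.

Lemma in_L1_LinftyP (psi : V -> R) : in_L1_Linfty psi <->
  measurable_fun setT psi /\ (L1_Linfty_norm (fun W => (psi W)%:E) < +oo)%E.
Proof.
split.
  move=> [/andP[/=]]; rewrite !inE /= => mp f1 /andP[_]; rewrite !inE /= => f2.
  by split => //; rewrite /L1_Linfty_norm; apply: lte_add_pinfty.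
move=> [mp]; rewrite /L1_Linfty_norm.
have p1 := @Lnorm_ge0 _ _ _ mu 1%E (fun W => (psi W)%:E).
have p2 := @Lnorm_ge0 _ _ _ mu +oo%E (fun W => (psi W)%:E).
move=> hf; split; apply/andP; rewrite !inE /=; split => //; apply: le_lt_trans hf.
  by rewrite leeDl.
by rewrite leeDr.
Qed.

Lemma in_L1_Linfty_half_symp (psi : V -> R) : in_L1_Linfty psi ->
  in_L1_Linfty (fun W => psi (half_symp W)).
Proof.
move=> /in_L1_LinftyP[mp fp]; apply/in_L1_LinftyP; split.
  by apply: measurableT_comp => //; exact: measurable_half_symp.
apply: (le_lt_trans (half_symp_norm mp)).
by rewrite lte_mul_pinfty.
Qed.

End half_symplectic.

Section Dh_estimate.
Context {R : realType} {n : nat}.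
Local Notation V := 'rV[R]_(n + n).
Variables (h : R) (F : (V -> R[i]) -> R[i]) (psi : V -> R).
Hypothesis h0 : 0 < h.
Hypothesis tF : tempered F.
Hypothesis bF : V_weyl_bound h F psi.

Lemma weyl_ext_bound X Y :
  normc (weyl_ext h F X Y) <= expR ((4 * h)^-1 * sqnorm (X - Y)) * psi (half_symp (X - Y)).
Proof. by rewrite normc_weyl_ext// ler_wpM2l ?expR_ge0//; exact: bF. Qed.

Lemma weyl_ext_Dh : in_L1_Linfty psi -> Dh h (dconv F (nu_weyl_density h)).
Proof.
move=> ipsi; exists (weyl_ext h F); split; first exact: weyl_ext_sesqui.
exists (fun W => psi (half_symp W)); split; first exact: in_L1_Linfty_half_symp.
exact: weyl_ext_bound.
Qed.

(** By [normc_weyl_ext], the least admissible function at [W] is at most [psi (J W / 2)]. *)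
Lemma Dh_norm_bound : in_L1_Linfty psi ->
  (Dh_norm h (dconv F (nu_weyl_density h)) <=
   (2 ^+ (n + n))%:E * L1_Linfty_norm (fun W => (psi W)%:E))%E.
Proof.
move=> /in_L1_LinftyP[mp _]; apply: le_trans (half_symp_norm mp).
have E := sesqui_ext_unique (weyl_ext_sesqui h0 tF).
have D0 W : (0 <= Dh_psi h (dconv F (nu_weyl_density h)) W)%E.
  apply: le_trans; last first.
    by apply: ereal_sup_ubound => /=; exists W, 0; split; [rewrite subr0|reflexivity].
  by rewrite lee_fin mulr_ge0 ?expR_ge0 ?normc_ge0.
have D1 W : (Dh_psi h (dconv F (nu_weyl_density h)) W <= (psi (half_symp W))%:E)%E.
  apply: ge_ereal_sup => _ [X [Y [<- ->]]]; rewrite lee_fin E.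
  rewrite expRN ler_pdivrMr ?expR_gt0// mulrC.
  rewrite [_ / (4 * h)]mulrC; exact: weyl_ext_bound.
rewrite /Dh_norm /L1_Linfty_norm !L1_Linfty_normE; apply: leeD.
  apply: ge0_integral_le => W; first exact: abse_ge0.
  by rewrite gee0_abs// gee0_abs// (le_trans (D0 W) (D1 W)).
case: ifPn => // _; apply: le_ess_sup; apply: nearW => W /=.
by rewrite gee0_abs// (le_trans (D1 W))// lee_fin ler_norm.
Qed.

End Dh_estimate.

(** * Square-integrable functions and Fubini's theorem *)

Section square_integral.
Context {R : realType} d (T : measurableType d) (mu : {measure set T -> \bar R}).
Implicit Types (f g : T -> R[i]) (k : R[i]).

(** The square of the [L^2] norm, in the extended reals: estimates by the inequality between
   arithmetic and geometric means then replace the Cauchy-Schwarz inequality. *)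
Definition sq f : \bar R := (\int[mu]_x (normc (f x) ^+ 2)%:E)%E.

Lemma sq_ge0 f : (0 <= sq f)%E.
Proof. by apply: integral_ge0 => x _; rewrite lee_fin sqr_ge0. Qed.

Lemma measurable_sq f : cmeasurable f -> measurable_fun setT (fun x => (normc (f x) ^+ 2)%:E).
Proof.
move=> mf; apply/measurable_EFinP; apply: (@measurable_funX _ _ _ _ (fun x => normc (f x))).
exact: cmeasurable_norm.
Qed.

Lemma sqZ k f : cmeasurable f -> sq (fun x => k * f x)%R = ((normc k ^+ 2)%:E * sq f)%E.
Proof.
move=> mf; rewrite /sq; under eq_integral do rewrite normcM exprMn EFinM.
rewrite ge0_integralZl_EFin//.
- by move=> x _; rewrite lee_fin sqr_ge0.
- exact: measurable_sq.
- exact: sqr_ge0.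
Qed.

Lemma sqD f g : cmeasurable f -> cmeasurable g ->
  (sq (fun x => f x + g x)%R <= 2%:E * sq f + 2%:E * sq g)%E.
Proof.
move=> mf mg; rewrite -!ge0_integralZl_EFin//; try exact: measurable_sq;
  try by move=> x _; rewrite lee_fin sqr_ge0.
rewrite -ge0_integralD//; last 4 first.
- by move=> x _; rewrite -EFinM lee_fin mulr_ge0// sqr_ge0.
- by apply: measurable_funeM; exact: measurable_sq.
- by move=> x _; rewrite -EFinM lee_fin mulr_ge0// sqr_ge0.
- by apply: measurable_funeM; exact: measurable_sq.
apply: ge0_integral_le => x; first by rewrite lee_fin sqr_ge0.
rewrite -!EFinM -EFinD lee_fin.
have := normcD (f x) (g x); have := normc_ge0 (f x + g x).
move: (normc _) (normc (f x)) (normc (g x)) => c a b c0 cab.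
apply: (@le_trans _ _ ((a + b) ^+ 2)).
  by rewrite lerXn2r ?nnegrE// (le_trans c0).
rewrite -subr_ge0 (_ : _ - _ = (a - b) ^+ 2) ?sqr_ge0//; ring.
Qed.

Lemma sq_lincomb a b f g : cmeasurable f -> cmeasurable g -> (sq f < +oo)%E -> (sq g < +oo)%E ->
  (sq (fun x => a * f x + b * g x)%R < +oo)%E.
Proof.
move=> mf mg sf sg; apply: (le_lt_trans (sqD _ _)); try exact: cmeasurableZ.
by rewrite !sqZ// !lte_add_pinfty// !lte_mul_pinfty// ?lee_fin ?sqr_ge0// lte_mul_pinfty// ?lee_fin ?sqr_ge0.
Qed.

Lemma amgm (t a b : R) : 0 < t -> a * b <= t * a ^+ 2 + t^-1 * b ^+ 2.
Proof.
move=> t0; rewrite -subr_ge0.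
have -> : t * a ^+ 2 + t^-1 * b ^+ 2 - a * b =
    t^-1 * ((t * a - b / 2) ^+ 2 + 3 / 4 * b ^+ 2) by field; rewrite gt_eqF.
by rewrite mulr_ge0 ?invr_ge0 ?(ltW t0)// addr_ge0 ?sqr_ge0// mulr_ge0 ?sqr_ge0// divr_ge0.
Qed.

Lemma normc_mul_conj (z w : R[i]) : normc (z * conjc w) = normc z * normc w.
Proof. by rewrite normcM normcJ. Qed.

Lemma amgm_integral f g (t : R) : 0 < t -> cmeasurable f -> cmeasurable g ->
  (\int[mu]_x (normc (f x) * normc (g x))%R%:E <= t%:E * sq f + t^-1%:E * sq g)%E.
Proof.
move=> t0 mf mg; have ti0 : 0 <= t^-1 by rewrite invr_ge0 ltW.
rewrite -!ge0_integralZl_EFin ?(ltW t0)//; try exact: measurable_sq;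
  try by move=> x _; rewrite lee_fin sqr_ge0.
rewrite -ge0_integralD//; last 4 first.
- by move=> x _; rewrite -EFinM lee_fin mulr_ge0 ?(ltW t0)// sqr_ge0.
- by apply: measurable_funeM; exact: measurable_sq.
- by move=> x _; rewrite -EFinM lee_fin mulr_ge0// sqr_ge0.
- by apply: measurable_funeM; exact: measurable_sq.
apply: ge0_integral_le => x; rewrite ?lee_fin ?mulr_ge0 ?normc_ge0//.
exact: amgm.
Qed.

Lemma cintegrable_mul_conj f g : cmeasurable f -> cmeasurable g ->
  (sq f < +oo)%E -> (sq g < +oo)%E -> cintegrable mu (fun x => f x * conjc (g x)).
Proof.
move=> mf mg sf sg; apply/cintegrableP; split.
  by apply: cmeasurableM => //; exact: cmeasurable_conj.
under eq_integral do rewrite normc_mul_conj.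
apply: (le_lt_trans (amgm_integral (@ltr01 R) mf mg)).
by rewrite invr1 !mul1e lte_add_pinfty.
Qed.

Lemma normc_cintegral_mul_conj f g (t : R) : 0 < t -> cmeasurable f -> cmeasurable g ->
  (sq f < +oo)%E -> (sq g < +oo)%E ->
  ((normc (cintegral mu (fun x => f x * conjc (g x))%R))%:E <= t%:E * sq f + t^-1%:E * sq g)%E.
Proof.
move=> t0 mf mg sf sg; apply: (le_trans (normc_cintegral (cintegrable_mul_conj mf mg sf sg))).
by under eq_integral do rewrite normc_mul_conj; exact: amgm_integral.
Qed.

Lemma cintegral_mul_conj_self f : cmeasurable f -> (sq f < +oo)%E ->
  (normc (cintegral mu (fun x => f x * conjc (f x))%R))%:E = sq f.
Proof.
move=> mf sf.
have -> : cintegral mu (fun x => f x * conjc (f x)) = (fine (sq f))%:C.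
  transitivity (cintegral mu (fun x => (normc (f x) ^+ 2)%:C)).
    by apply: eq_cintegral => x; rewrite mulcJ.
  by apply: eq_cplx => //=; rewrite /Rintegral integral0_eq.
rewrite normc_real ger0_norm ?fineK ?ge0_fin_numE ?sq_ge0//.
by rewrite fine_ge0// sq_ge0.
Qed.

Lemma sq_eq0 f : cmeasurable f -> sq f = 0%E -> {ae mu, forall x, f x = 0}.
Proof.
move=> mf sf0.
have [h _] := @ae_eq_integral_abs _ _ R mu setT measurableT _ (measurable_sq mf).
have h0 : (\int[mu]_x `|(normc (f x) ^+ 2)%:E| = 0)%E.
  by apply: etrans sf0; apply: eq_integral => x _; rewrite gee0_abs// lee_fin sqr_ge0.
move: (h h0); apply: filterS => x /(_ I) [] /eqP.
by rewrite sqrf_eq0 => /eqP /normc_eq0.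
Qed.

Lemma cmeasurable_comp d' (T' : measurableType d') (phi : T' -> T) f :
  measurable_fun setT phi -> cmeasurable f -> cmeasurable (fun x => f (phi x)).
Proof. by move=> mphi [f1 f2]; split; [exact: (measurableT_comp f1)|exact: (measurableT_comp f2)]. Qed.

End square_integral.

Section L2_norm.
Context {R : realType} {n : nat}.
Implicit Types f : 'rV[R]_n -> R[i].
Local Notation lam := (lebesgue_rV n).

Lemma L2normE f : L2norm f = sqrte (sq lam f).
Proof.
rewrite -poweR12_sqrt ?sq_ge0// /L2norm Lnorm.unlock; congr poweR.
apply: eq_integral => x _; rewrite gee0_abs ?lee_fin ?normc_ge0//.
by rewrite poweR_EFin (powR_mulrn 2) ?normc_ge0.
Qed.

Lemma in_L2P f : in_L2 f <-> cmeasurable f /\ (sq lam f < +oo)%E.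
Proof.
rewrite /in_L2 L2normE; have := sq_ge0 lam f.
by case: (sq lam f) => [r| |] // _; rewrite /= ?ltry.
Qed.

Lemma L2norm_le f g (K : R) : 0 <= K -> (sq lam f <= K%:E * sq lam g)%E ->
  (L2norm f <= (Num.sqrt K)%:E * L2norm g)%E.
Proof.
move=> K0 h; rewrite !L2normE; have := h; have := sq_ge0 lam f; have := sq_ge0 lam g.
have [->|Kn0] := eqVneq K 0.
  move=> _ h1; rewrite mul0e sqrtr0 mul0e => h2.
  by rewrite (_ : sq lam f = 0%E) ?sqrte0//; apply/eqP; rewrite eq_le h1 h2.
have Kp : 0 < Num.sqrt K by rewrite sqrtr_gt0 lt_neqAle eq_sym Kn0.
have Kp' : 0 < K by rewrite lt_neqAle eq_sym Kn0.
case: (sq lam g) => [b| |]; last 2 first.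
- by move=> _ _ _ /=; rewrite gt0_muley ?lte_fin// leey.
- by rewrite leeNy_eq.
case: (sq lam f) => [a| |] //= b0 a0.
by rewrite -!EFinM !lee_fin -sqrtrM// => ab; exact: ler_wsqrtr.
Qed.

End L2_norm.

Section fubini_complex.
Context {R : realType} d1 d2 (T1 : measurableType d1) (T2 : measurableType d2).
Variables (m1 : {sigma_finite_measure set T1 -> \bar R}).
Variables (m2 : {sigma_finite_measure set T2 -> \bar R}).

(** The total integral of a nonintegrable section is a convention, hence the detour by the positive
   and negative parts. *)
Lemma measurable_param_integral (f : T1 * T2 -> R) : measurable_fun setT f ->
  measurable_fun setT (fun x => \int[m2]_y f (x, y)).
Proof.
move=> mf; apply: (measurableT_comp (@fine_measurable R _ measurableT)).
pose g := EFin \o f; have mg : measurable_fun setT g by exact/measurable_EFinP.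
rewrite (_ : (fun x => _) = fun x => (\int[m2]_y g^\+ (x, y) - \int[m2]_y g^\- (x, y))%E).
  apply: emeasurable_funB.
    by apply: (@measurable_fun_fubini_tonelli_F _ _ _ _ _ m2 _) => //; exact: measurable_funepos.
  by apply: (@measurable_fun_fubini_tonelli_F _ _ _ _ _ m2 _) => //; exact: measurable_funeneg.
apply/funext=> x; rewrite [LHS]integralE.
by congr (_ - _)%E; apply: eq_integral => y _; rewrite ?funeposE ?funenegE.
Qed.

Lemma cmeasurable_param (f : T1 * T2 -> R[i]) : cmeasurable f ->
  cmeasurable (fun x => cintegral m2 (fun y => f (x, y))).
Proof.
move=> [f1 f2]; split.
  exact: (measurable_param_integral f1).
exact: (measurable_param_integral f2).
Qed.

Lemma Rfubini1 (f : T1 * T2 -> R) : (m1 \x m2)%E.-integrable setT (EFin \o f) ->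
  \int[m1]_x (\int[m2]_y f (x, y)) = \int[(m1 \x m2)%E]_z f z.
Proof.
move=> hf; have mf := measurable_int _ hf.
rewrite /Rintegral; congr fine; rewrite -(integral12_prod_meas1 hf).
apply: ae_eq_integral => //.
- apply/measurable_EFinP; apply: measurable_param_integral; exact/measurable_EFinP.
- exact: (measurable_fubini_F hf).
apply: filterS (ae_integrable1 hf) => x hx _; rewrite fineK//.
exact: integrable_fin_num hx.
Qed.

Lemma Rfubini2 (f : T1 * T2 -> R) : (m1 \x m2)%E.-integrable setT (EFin \o f) ->
  measurable_fun setT (fun y => \int[m1]_x f (x, y)) ->
  \int[m2]_y (\int[m1]_x f (x, y)) = \int[(m1 \x m2)%E]_z f z.
Proof.
move=> hf mG; have mf := measurable_int _ hf.
rewrite /Rintegral; congr fine; rewrite -(integral21_prod_meas1 hf).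
apply: ae_eq_integral => //.
- exact/measurable_EFinP.
- exact: (measurable_fubini_G hf).
apply: filterS (ae_integrable2 hf) => x hx _; rewrite fineK//.
exact: integrable_fin_num hx.
Qed.

End fubini_complex.

Section fubini_complex2.
Context {R : realType} d1 d2 (T1 : measurableType d1) (T2 : measurableType d2).
Variables (m1 : {sigma_finite_measure set T1 -> \bar R}).
Variables (m2 : {sigma_finite_measure set T2 -> \bar R}).

Lemma cmeasurable_swap (f : T1 * T2 -> R[i]) : cmeasurable f ->
  cmeasurable (fun p : T2 * T1 => f (p.2, p.1)).
Proof. by apply: cmeasurable_comp; exact: measurable_swap. Qed.

Lemma cmeasurable_pair1 (f : T1 * T2 -> R[i]) x : cmeasurable f -> cmeasurable (fun y => f (x, y)).
Proof. by apply: cmeasurable_comp; exact: pair1_measurable. Qed.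
Lemma cmeasurable_pair2 (f : T1 * T2 -> R[i]) y : cmeasurable f -> cmeasurable (fun x => f (x, y)).
Proof. by apply: cmeasurable_comp; exact: pair2_measurable. Qed.

Lemma cintegrable_prod (f : T1 * T2 -> R[i]) : cmeasurable f ->
  (\int[m1]_x \int[m2]_y (normc (f (x, y)))%:E < +oo)%E -> cintegrable (m1 \x m2)%E f.
Proof.
move=> mf fi; apply/cintegrableP; split => //.
rewrite fubini_tonelli1//; first exact/measurable_EFinP/cmeasurable_norm.
by move=> x; rewrite lee_fin normc_ge0.
Qed.

Lemma cfubini1 (f : T1 * T2 -> R[i]) : cintegrable (m1 \x m2)%E f ->
  cintegral m1 (fun x => cintegral m2 (fun y => f (x, y))) = cintegral (m1 \x m2)%E f.
Proof.
move=> [f1 f2]; apply: eq_cplx; rewrite /cintegral /=.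
  exact: (Rfubini1 f1).
exact: (Rfubini1 f2).
Qed.

Lemma cfubini2 (f : T1 * T2 -> R[i]) : cintegrable (m1 \x m2)%E f ->
  cintegral m2 (fun y => cintegral m1 (fun x => f (x, y))) = cintegral (m1 \x m2)%E f.
Proof.
move=> fi; have [mg1 mg2] := cmeasurable_param m1 (cmeasurable_swap (cintegrable_measurable fi)).
have [f1 f2] := fi; apply: eq_cplx; rewrite /cintegral /=.
  exact: (Rfubini2 f1 mg1).
exact: (Rfubini2 f2 mg2).
Qed.

Lemma cfubini (f : T1 * T2 -> R[i]) : cintegrable (m1 \x m2)%E f ->
  cintegral m1 (fun x => cintegral m2 (fun y => f (x, y))) =
  cintegral m2 (fun y => cintegral m1 (fun x => f (x, y))).
Proof. by move=> fi; rewrite cfubini1// cfubini2. Qed.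

End fubini_complex2.

(** * Coherent states *)

Section measurable_vectors.
Context {R : realType} d (T : measurableType d).

Lemma measurable_dotp m (f g : T -> 'rV[R]_m) : measurable_fun setT f -> measurable_fun setT g ->
  measurable_fun setT (fun t => dotp (f t) (g t)).
Proof.
move=> mf mg; apply: measurable_sum => i; apply: measurable_funM.
  exact: (measurableT_comp (measurable_coord_rV i) mf).
exact: (measurableT_comp (measurable_coord_rV i) mg).
Qed.

Lemma measurable_vecB m (f g : T -> 'rV[R]_m) : measurable_fun setT f -> measurable_fun setT g ->
  measurable_fun setT (fun t => f t - g t).
Proof.
move=> mf mg; apply: measurable_fun_rVP => i; under eq_fun do rewrite !mxE.
apply: measurable_funB; first exact: (measurableT_comp (measurable_coord_rV i) mf).
exact: (measurableT_comp (measurable_coord_rV i) mg).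
Qed.

Lemma measurable_lsubmx m1 m2 (f : T -> 'rV[R]_(m1 + m2)) : measurable_fun setT f ->
  measurable_fun setT (fun t => lsubmx (f t)).
Proof.
move=> mf; apply: measurable_fun_rVP => i; under eq_fun do rewrite !mxE.
exact: (measurableT_comp (measurable_coord_rV _) mf).
Qed.

Lemma measurable_rsubmx m1 m2 (f : T -> 'rV[R]_(m1 + m2)) : measurable_fun setT f ->
  measurable_fun setT (fun t => rsubmx (f t)).
Proof.
move=> mf; apply: measurable_fun_rVP => i; under eq_fun do rewrite !mxE.
exact: (measurableT_comp (measurable_coord_rV _) mf).
Qed.

Lemma measurable_row_mx m1 m2 (f : T -> 'rV[R]_m1) (g : T -> 'rV[R]_m2) :
  measurable_fun setT f -> measurable_fun setT g ->
  measurable_fun setT (fun t => row_mx (f t) (g t)).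
Proof.
move=> mf mg; apply: measurable_fun_rVP => i.
case: (fintype.split_ordP i) => j ->.
  under eq_fun do rewrite row_mxEl.
  exact: (measurableT_comp (measurable_coord_rV _) mf).
under eq_fun do rewrite row_mxEr.
exact: (measurableT_comp (measurable_coord_rV _) mg).
Qed.

End measurable_vectors.

Section coherent_states.
Context {R : realType} {n : nat}.
Local Notation U := 'rV[R]_n.
Local Notation V := 'rV[R]_(n + n).
Local Notation lam := (lebesgue_rV n).
Variable h : R.
Hypothesis h0 : 0 < h.
Implicit Types (X Y : V) (u : U).
Local Notation Psi := (coherent_state h).

Definition coherent_height : R := (pi * h) `^ (- (n%:R / 4)).
Local Notation c0 := coherent_height.

Let pih : 0 < pi * h. Proof. by rewrite mulr_gt0 ?pi_gt0. Qed.

Lemma coherent_height_ge0 : 0 <= c0.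
Proof. exact: powR_ge0. Qed.

Lemma coherent_height_mass : c0 ^+ 2 * gaussian_mass h^-1 n = 1.
Proof.
rewrite /gaussian_mass invrK -powR_mulrn ?coherent_height_ge0// /c0 -powRrM.
rewrite -(powR_mulrn n) ?sqrtr_ge0// -powR12_sqrt ?(ltW pih)// -powRrM.
rewrite -powRD; last by rewrite (gt_eqF pih) implybT.
by rewrite (_ : _ + _ = 0) ?powRr0//; field.
Qed.

Lemma coherent_stateE X u : Psi X u = c0%:C * cexp ((- (sqnorm (u - lsubmx X) / (2 * h))) +i*
  (h^-1 * dotp u (rsubmx X) - (2 * h)^-1 * dotp (lsubmx X) (rsubmx X))).
Proof.
rewrite /coherent_state -/c0 rmorphM -[X in _ * X * _]/((expR _)%:C) -mulrA; congr (_ * _).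
by rewrite -cexp_real -cexpD; congr cexp; apply: eq_cplx => /=; rewrite ?addr0 ?add0r.
Qed.

Lemma conj_coherent X u : conjc (Psi X u) = c0%:C * cexp ((- (sqnorm (u - lsubmx X) / (2 * h))) +i*
  - (h^-1 * dotp u (rsubmx X) - (2 * h)^-1 * dotp (lsubmx X) (rsubmx X))).
Proof.
rewrite coherent_stateE; set z := cexp _; transitivity (c0%:C * conjc z).
  by case: z => p q; apply: eq_cplx => /=; ring.
by rewrite /z conj_cexp.
Qed.

Lemma normc_coherent X u :
  normc (Psi X u) = c0 * expR (- ((2 * h)^-1 * sqnorm (u - lsubmx X))).
Proof.
rewrite coherent_stateE normcM normc_cexp normc_real ger0_norm ?coherent_height_ge0//=.
by rewrite [sqnorm _ / _]mulrC.
Qed.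

Lemma normc_coherent_le X u : normc (Psi X u) <= c0.
Proof.
rewrite normc_coherent -[leRHS]mulr1 ler_wpM2l ?coherent_height_ge0//.
by rewrite -expR0 ler_expR oppr_le0 mulr_ge0 ?sqnorm_ge0// invr_ge0 mulr_ge0// ltW.
Qed.

Lemma cmeasurable_coherent2 : cmeasurable (fun p : V * U => Psi p.1 p.2).
Proof.
have mX := @measurable_fst _ _ V U; have mu := @measurable_snd _ _ V U.
have ml := measurable_lsubmx mX; have mr := measurable_rsubmx mX.
apply: cmeasurableM.
  apply: cmeasurable_real; apply: measurable_funM; first exact: measurable_cst.
  apply: (measurableT_comp (@measurable_expR R)); apply: measurable_funN.
  apply: measurable_funM; last exact: measurable_cst.
  by apply: measurable_dotp; exact: measurable_vecB.
apply: cmeasurable_cexp; split => /=; first exact: measurable_cst.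
by apply: measurable_funB; apply: measurable_funM; try exact: measurable_cst; exact: measurable_dotp.
Qed.

Lemma cmeasurable_coherent X : cmeasurable (Psi X).
Proof. exact: cmeasurable_pair1 cmeasurable_coherent2. Qed.

Lemma integral_shifted_gaussian (k : R) (x : U) : 0 < k ->
  (\int[lam]_u (expR (- (k * sqnorm (u - x))))%:E = (gaussian_mass k n)%:E)%E.
Proof.
move=> k0; rewrite -integral_gaussian//.
have := @integral_translate R n (- x) (fun u => (expR (- (k * sqnorm u)))%:E); apply.
by apply/measurable_EFinP; exact: measurable_gauss.
Qed.

Lemma measurable_shifted_gaussian (k : R) (x : U) :
  measurable_fun setT (fun u : U => (expR (- (k * sqnorm (u - x))))%:E).
Proof.
apply/measurable_EFinP; apply: (measurableT_comp (@measurable_expR R)); apply: measurable_funN.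
apply: measurable_funM; first exact: measurable_cst.
by apply: measurable_dotp; apply: measurable_vecB; [exact: measurable_id|exact: measurable_cst|exact: measurable_id|exact: measurable_cst].
Qed.

Lemma sq_coherent X : sq lam (Psi X) = 1%E.
Proof.
rewrite /sq; under eq_integral do rewrite normc_coherent exprMn EFinM.
transitivity ((c0 ^+ 2)%:E * \int[lam]_u (expR (- (h^-1 * sqnorm (u - lsubmx X))))%:E)%E.
  rewrite -ge0_integralZl_EFin ?sqr_ge0//.
  - apply: eq_integral => u _; congr (_ * _)%E; congr EFin.
    by rewrite -expRM_natl; congr expR; field; rewrite gt_eqF.
  - exact: measurable_shifted_gaussian.
by rewrite integral_shifted_gaussian ?invr_gt0// -EFinM coherent_height_mass.
Qed.

Lemma integral_coherent X :
  (\int[lam]_u (normc (Psi X u))%:E = (c0 * gaussian_mass (2 * h)^-1 n)%:E)%E.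
Proof.
under eq_integral do rewrite normc_coherent EFinM.
rewrite ge0_integralZl_EFin ?coherent_height_ge0//.
- by rewrite integral_shifted_gaussian// invr_gt0 mulr_gt0.
- exact: measurable_shifted_gaussian.
Qed.

Lemma sqnorm_split X : sqnorm X = sqnorm (lsubmx X) + sqnorm (rsubmx X).
Proof. by rewrite /sqnorm -{1 2}[X]hsubmxK dotp_row_mx. Qed.

(** The product of two coherent states is a Gaussian with a linear exponent, real part coming from
   the positions and imaginary part from the momenta, to which [normc_gaussian_average]
   applies. *)
Lemma normc_overlap X Y : normc (inner (Psi X) (Psi Y)) = expR (- ((4 * h)^-1 * sqnorm (X - Y))).
Proof.
set x := lsubmx X; set xi := rsubmx X; set y := lsubmx Y; set eta := rsubmx Y.
pose a := h^-1 *: (x + y); pose b := h^-1 *: (xi - eta).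
pose K := (c0 ^+ 2)%:C * cexp ((- ((2 * h)^-1 * (sqnorm x + sqnorm y))) +i*
  (- ((2 * h)^-1 * (dotp x xi - dotp y eta)))).
have hn : h != 0 by rewrite gt_eqF.
have kap0 : 0 < h^-1 by rewrite invr_gt0.
have E : inner (Psi X) (Psi Y) = K * gaussian_average h^-1
    (fun u => cexp (linform (rlin a) u) * cexp (linform (ilin b) u)).
  rewrite -cintegralZ; last first.
    apply: exp_type_gaussian_integrable => //.
    by apply: exp_typeM; exact: exp_type_cexp_linform.
  apply: eq_cintegral => u; rewrite gaussianE linform_rlin linform_ilin.
  rewrite coherent_stateE conj_coherent -/x -/xi -/y -/eta.
  rewrite mulrACA -!cexpD /K expr2 rmorphM -[RHS]mulrA -!cexpD; congr (_ * cexp _).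
  rewrite !sqnormB !dotpZl !dotpDl !dotpNl ![dotp _ u]dotpC.
  apply: eq_cplx => /=; first by field.
  by field.
rewrite E normcM normc_gaussian_average//.
rewrite /K normcM normc_cexp normc_real ger0_norm ?sqr_ge0//=.
rewrite mulrACA [X in _ * X]mulrC.
transitivity (c0 ^+ 2 * gaussian_mass h^-1 n * (expR (- ((2 * h)^-1 * (sqnorm x + sqnorm y))) *
  expR ((4 * h^-1)^-1 * (sqnorm a - sqnorm b)))); first by ring.
rewrite coherent_height_mass mul1r -expRD; congr expR.
rewrite sqnorm_split !linearB /= -/x -/xi -/y -/eta /a /b !sqnormZ !sqnormB sqnormD.
by field.
Qed.


End coherent_states.

(** * Superpositions of coherent states *)

Section young.
Context {R : realType} {d : nat}.
Local Notation V := 'rV[R]_d.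
Local Notation mu := (lebesgue_rV d).
Implicit Types (A B : V -> R[i]) (k : V -> R).
Local Open Scope ereal_scope.

Lemma measurable_diff2 k : measurable_fun setT k ->
  measurable_fun setT (fun p : V * V => k (p.2 - p.1)%R).
Proof.
move=> mk; apply: (measurableT_comp mk).
by apply: measurable_vecB; [exact: measurable_snd|exact: measurable_fst].
Qed.

Lemma integral_translate_sub (a : V) (f : V -> \bar R) : measurable_fun setT f ->
  \int[mu]_x f (x - a)%R = \int[mu]_x f x.
Proof. by move=> mf; rewrite -(integral_translate (- a)%R mf). Qed.

(** Young's inequality for the kernel [k (Y - X)], in a weighted form: [t] is adjusted in each use so
   as to absorb one of the two terms. *)
Lemma young_bound A B k (K t : R) : (0 < t)%R -> cmeasurable A -> cmeasurable B ->
  measurable_fun setT k -> (forall v, 0 <= k v)%R -> \int[mu]_v (k v)%:E = K%:E ->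
  \int[mu]_X \int[mu]_Y (normc (A X) * normc (B Y) * k (Y - X))%R%:E <=
  (t * K)%:E * sq mu A + (t^-1 * K)%:E * sq mu B.
Proof.
move=> t0 mA mB mk k0 Kk.
have K0 : (0 <= K)%R by rewrite -lee_fin -Kk; apply: integral_ge0 => v _; rewrite lee_fin.
have ti0 : (0 <= t^-1)%R by rewrite invr_ge0 ltW.
pose P := fun p : V * V => (t * (normc (A p.1) ^+ 2 * k (p.2 - p.1)))%:E.
pose Q := fun p : V * V => (t^-1 * (normc (B p.2) ^+ 2 * k (p.2 - p.1)))%:E.
have mk2 := measurable_diff2 mk.
have mP : measurable_fun setT P.
  apply/measurable_EFinP; apply: measurable_funM; first exact: measurable_cst.
  apply: measurable_funM => //.
  by apply: measurable_funX; apply: cmeasurable_norm; apply: cmeasurable_comp => //; exact: measurable_fst.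
have mQ : measurable_fun setT Q.
  apply/measurable_EFinP; apply: measurable_funM; first exact: measurable_cst.
  apply: measurable_funM => //.
  by apply: measurable_funX; apply: cmeasurable_norm; apply: cmeasurable_comp => //; exact: measurable_snd.
have P0 p : 0 <= P p by rewrite lee_fin mulr_ge0 ?(ltW t0)// mulr_ge0 ?sqr_ge0.
have Q0 p : 0 <= Q p by rewrite lee_fin mulr_ge0// mulr_ge0 ?sqr_ge0.
have mP1 X : measurable_fun setT (fun Y => P (X, Y)) by exact: measurable_fun_pair2.
have mQ1 X : measurable_fun setT (fun Y => Q (X, Y)) by exact: measurable_fun_pair2.
apply: (@le_trans _ _ (\int[mu]_X (\int[mu]_Y P (X, Y) + \int[mu]_Y Q (X, Y)))).
  apply: ge0_integral_le => X.
    by apply: integral_ge0 => Y _; rewrite lee_fin !mulr_ge0 ?normc_ge0.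
  rewrite -ge0_integralD//; apply: ge0_integral_le => Y.
    by rewrite lee_fin !mulr_ge0 ?normc_ge0.
  rewrite /P /Q /= -EFinD lee_fin !mulrA -mulrDl ler_wpM2r//.
  have := amgm (normc (A X)) (normc (B Y)) t0.
  by rewrite !expr2 !mulrA.
rewrite ge0_integralD//; last 4 first.
- by move=> X _; exact: integral_ge0.
- exact: (@measurable_fun_fubini_tonelli_F _ _ _ _ _ mu P).
- by move=> X _; exact: integral_ge0.
- exact: (@measurable_fun_fubini_tonelli_F _ _ _ _ _ mu Q).
rewrite le_eqVlt; apply/orP; left; apply/eqP; congr (_ + _).
  rewrite /sq -ge0_integralZl_EFin//; last 3 first.
  - by move=> x _; rewrite lee_fin sqr_ge0.
  - exact: measurable_sq.
  - by rewrite mulr_ge0// ltW.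
  apply: eq_integral => X _.
  have e : \int[mu]_Y (k (Y - X)%R)%:E = K%:E.
    by rewrite -Kk; apply: (integral_translate_sub X (f := fun v => (k v)%:E)); exact/measurable_EFinP.
  transitivity ((t * normc (A X) ^+ 2)%:E * \int[mu]_Y (k (Y - X)%R)%:E).
    rewrite -ge0_integralZl_EFin//.
    - by apply: eq_integral => Y _; rewrite /P /= mulrA.
    - by move=> Y _; rewrite lee_fin.
    - by apply/measurable_EFinP; exact: (measurable_fun_pair2 X mk2).
    - by rewrite mulr_ge0 ?sqr_ge0// ltW.
  by rewrite e -!EFinM; congr EFin; ring.
rewrite [LHS](fubini_tonelli Q mQ Q0).
rewrite /sq -ge0_integralZl_EFin//; last 3 first.
- by move=> x _; rewrite lee_fin sqr_ge0.
- exact: measurable_sq.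
- by rewrite mulr_ge0.
apply: eq_integral => Y _.
have e : \int[mu]_X (k (Y - X)%R)%:E = K%:E.
  by rewrite -Kk; apply: (integral_reflect Y (f := fun v => (k v)%:E)); exact/measurable_EFinP.
transitivity ((t^-1 * normc (B Y) ^+ 2)%:E * \int[mu]_X (k (Y - X)%R)%:E).
  rewrite -ge0_integralZl_EFin//.
  - by apply: eq_integral => X _; rewrite /Q /= mulrA.
  - by move=> X _; rewrite lee_fin.
  - by apply/measurable_EFinP; exact: (measurable_fun_pair1 Y mk2).
  - by rewrite mulr_ge0 ?sqr_ge0.
by rewrite e -!EFinM; congr EFin; ring.
Qed.

End young.

Section bargmann.
Context {R : realType} {n : nat}.
Local Notation U := 'rV[R]_n.
Local Notation V := 'rV[R]_(n + n).
Local Notation lam := (lebesgue_rV n).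
Local Notation mu := (lebesgue_rV (n + n)).
Variable h : R.
Hypothesis h0 : 0 < h.
Implicit Types (X Y : V) (u : U) (f g : U -> R[i]) (a : V -> R[i]).
Local Notation Psi := (coherent_state h).
Local Notation c0 := (@coherent_height R n h).

Lemma inner_conj f g : cintegrable lam (fun u => f u * conjc (g u)) ->
  conjc (inner f g) = inner g f.
Proof.
move=> fg; rewrite /inner -cintegral_conj//; apply: eq_cintegral => u.
by case: (f u) (g u) => [p q] [r s]; apply: eq_cplx => /=; ring.
Qed.

(** Analysis and synthesis with coherent states; [bargmann] is a Bargmann transform. *)
Definition bargmann f X : R[i] := inner f (Psi X).
Definition superpose a u : R[i] := cintegral mu (fun X => a X * Psi X u).

Lemma coherent_in_L2 X : in_L2 (Psi X).
Proof. by apply/in_L2P; split; [exact: cmeasurable_coherent|rewrite sq_coherent// ltry]. Qed.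

Lemma cmeasurable_bargmann f : cmeasurable f -> cmeasurable (bargmann f).
Proof.
move=> mf; apply: (@cmeasurable_param R _ _ V U lam
  (fun p : V * U => f p.2 * conjc (Psi p.1 p.2))).
apply: cmeasurableM; first by apply: cmeasurable_comp mf; exact: measurable_snd.
by apply: cmeasurable_conj; exact: cmeasurable_coherent2.
Qed.

Lemma bargmann_bounded f X : in_L2 f -> normc (bargmann f X) <= fine (sq lam f) + 1.
Proof.
move=> /in_L2P[mf sf]; have := @normc_cintegral_mul_conj _ _ _ lam f (Psi X) 1 ltr01 mf
  (cmeasurable_coherent h X) sf.
rewrite sq_coherent// ltry invr1 !mul1e => /(_ isT).
by rewrite -{1}(fineK (x := sq lam f)) ?ge0_fin_numE ?sq_ge0// -EFinD lee_fin.
Qed.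

Lemma cmeasurable_superpose2 a : cmeasurable a -> cmeasurable (fun p : V * U => a p.1 * Psi p.1 p.2).
Proof.
move=> ma; apply: cmeasurableM; last exact: cmeasurable_coherent2.
by apply: cmeasurable_comp ma; exact: measurable_fst.
Qed.

Lemma cmeasurable_superpose a : cmeasurable a -> cmeasurable (superpose a).
Proof.
move=> ma; apply: (@cmeasurable_param R _ _ U V mu (fun p : U * V => a p.2 * Psi p.2 p.1)).
exact: (cmeasurable_swap (cmeasurable_superpose2 ma)).
Qed.

Lemma superpose_integrable a u : cintegrable mu a -> cintegrable mu (fun X => a X * Psi X u).
Proof.
move=> /cintegrableP[ma ia].
apply: (@cintegrable_le _ _ _ _ _ (fun X => c0 * normc (a X))).
- exact: (cmeasurable_pair2 u (cmeasurable_superpose2 ma)).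
- by apply: measurable_funM; [exact: measurable_cst|exact: cmeasurable_norm].
- move=> X; rewrite normcM mulrC ler_wpM2r ?normc_ge0//; exact: normc_coherent_le.
under eq_integral do rewrite EFinM.
rewrite ge0_integralZl_EFin ?coherent_height_ge0//.
- by rewrite lte_mul_pinfty ?lee_fin ?coherent_height_ge0.
- by move=> X _; rewrite lee_fin normc_ge0.
- by apply/measurable_EFinP; exact: cmeasurable_norm.
Qed.

Lemma integral_normc_lty a : cintegrable mu a -> exists2 M : R, 0 <= M &
  (\int[mu]_X (normc (a X))%:E = M%:E)%E.
Proof.
move=> /cintegrableP[ma ia].
have i0 : (0 <= \int[mu]_X (normc (a X))%:E)%E.
  by apply: integral_ge0 => X _; rewrite lee_fin normc_ge0.
exists (fine (\int[mu]_X (normc (a X))%:E)); first exact: fine_ge0.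
by rewrite fineK// ge0_fin_numE.
Qed.

Lemma integral_normcZ a (k : R) : 0 <= k -> cmeasurable a ->
  (\int[mu]_X (normc (a X) * k)%:E = k%:E * \int[mu]_X (normc (a X))%:E)%E.
Proof.
move=> k0 ma; under eq_integral do rewrite mulrC EFinM.
rewrite ge0_integralZl_EFin//.
- by move=> X _; rewrite lee_fin normc_ge0.
- by apply/measurable_EFinP; exact: cmeasurable_norm.
Qed.

(** The superposition is bounded, and it is integrable by Tonelli's theorem. *)
Lemma superpose_in_L2 a : cintegrable mu a -> in_L2 (superpose a).
Proof.
move=> ia; have ma := cintegrable_measurable ia.
apply/in_L2P; split; first exact: cmeasurable_superpose.
have [M M0 Ma] := integral_normc_lty ia.
have c00 := @coherent_height_ge0 R n h.
have b1 u : ((normc (superpose a u))%:E <= \int[mu]_X (normc (a X * Psi X u))%:E)%E.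
  exact: normc_cintegral (superpose_integrable u ia).
have b2 u : normc (superpose a u) <= c0 * M.
  rewrite -lee_fin; apply: (le_trans (b1 u)).
  rewrite EFinM -Ma -integral_normcZ//; apply: ge0_integral_le => X.
    by rewrite lee_fin normc_ge0.
  by rewrite lee_fin normcM ler_wpM2l ?normc_ge0//; exact: normc_coherent_le.
pose c1 := c0 * gaussian_mass (2 * h)^-1 n.
have c10 : 0 <= c1 by rewrite mulr_ge0// ltW// gaussian_mass_gt0// invr_gt0 mulr_gt0.
have b3 : (\int[lam]_u (normc (superpose a u))%:E <= (c1 * M)%:E)%E.
  apply: (@le_trans _ _ (\int[lam]_u \int[mu]_X (normc (a X * Psi X u))%:E)%E).
    by apply: ge0_integral_le => u; [rewrite lee_fin normc_ge0|exact: b1].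
  have mf : measurable_fun setT (fun p : V * U => (normc (a p.1 * Psi p.1 p.2))%:E).
    by apply/measurable_EFinP; apply: cmeasurable_norm; exact: cmeasurable_superpose2.
  have f0 (p : V * U) : (0 <= (normc (a p.1 * Psi p.1 p.2))%:E)%E by rewrite lee_fin normc_ge0.
  have E := @fubini_tonelli _ _ V U R mu lam _ mf f0.
  move: E => /= E; rewrite -E.
  rewrite EFinM -Ma -integral_normcZ//; apply: ge0_integral_le => X.
    by apply: integral_ge0 => u _; rewrite lee_fin normc_ge0.
  under eq_integral do rewrite normcM EFinM.
  rewrite ge0_integralZl_EFin ?normc_ge0//.
  - by rewrite integral_coherent.
  - by move=> u _; rewrite lee_fin normc_ge0.
  - by apply/measurable_EFinP; apply: cmeasurable_norm; exact: cmeasurable_coherent.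
apply: (@le_lt_trans _ _ (\int[lam]_u ((c0 * M)%:E * (normc (superpose a u))%:E))%E).
  apply: ge0_integral_le => u; first by rewrite lee_fin sqr_ge0.
  by rewrite -EFinM lee_fin expr2 ler_wpM2r ?normc_ge0.
rewrite ge0_integralZl_EFin ?mulr_ge0//.
- by apply: lte_mul_pinfty; rewrite ?lee_fin ?mulr_ge0//; apply: (le_lt_trans b3); rewrite ltry.
- by move=> u _; rewrite lee_fin normc_ge0.
- by apply/measurable_EFinP; apply: cmeasurable_norm; exact: cmeasurable_superpose.
Qed.

(** Analysis and synthesis are adjoint to each other, by Fubini's theorem. *)
Lemma inner_superpose a g : cintegrable mu a -> in_L2 g ->
  inner (superpose a) g = cintegral mu (fun X => a X * conjc (bargmann g X)).
Proof.
move=> ia /in_L2P[mg sg]; have ma := cintegrable_measurable ia.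
pose k := fun p : V * U => a p.1 * Psi p.1 p.2 * conjc (g p.2).
have mk : cmeasurable k.
  apply: cmeasurableM; first exact: cmeasurable_superpose2.
  by apply: cmeasurable_conj; apply: cmeasurable_comp mg; exact: measurable_snd.
have sc X : (sq lam (Psi X) < +oo)%E by rewrite sq_coherent// ltry.
have mc X := cmeasurable_coherent h X.
have ik : cintegrable (mu \x lam)%E k.
  apply: cintegrable_prod => //; have [M M0 Ma] := integral_normc_lty ia.
  have sg' : sq lam g \is a fin_num by rewrite ge0_fin_numE// sq_ge0.
  have s0 : 0 <= 1 + fine (sq lam g) by rewrite addr_ge0// fine_ge0// sq_ge0.
  apply: (@le_lt_trans _ _ (\int[mu]_X (normc (a X) * (1 + fine (sq lam g)))%:E)%E).
    apply: ge0_integral_le => X; first by apply: integral_ge0 => u _; rewrite lee_fin normc_ge0.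
    under eq_integral do rewrite /k /= -mulrA normcM normc_mul_conj EFinM.
    rewrite ge0_integralZl_EFin ?normc_ge0//.
    - rewrite EFinM; apply: lee_wpmul2l; first by rewrite lee_fin normc_ge0.
      apply: (le_trans (amgm_integral lam (@ltr01 R) (mc X) mg)).
      by rewrite invr1 !mul1e sq_coherent// EFinD fineK.
    - by move=> u _; rewrite lee_fin mulr_ge0 ?normc_ge0.
    - by apply/measurable_EFinP; apply: measurable_funM; exact: cmeasurable_norm.
  by rewrite integral_normcZ// Ma -EFinM ltry.
transitivity (cintegral lam (fun u => cintegral mu (fun X => k (X, u)))).
  apply: eq_cintegral => u; rewrite /superpose mulrC -cintegralZ; last exact: superpose_integrable.
  by apply: eq_cintegral => X; rewrite /k mulrC.
rewrite -cfubini//; apply: eq_cintegral => X.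
have iX := cintegrable_mul_conj (mc X) mg (sc X) sg.
have iX' := cintegrable_mul_conj mg (mc X) sg (sc X).
rewrite /bargmann inner_conj// /inner -cintegralZ//.
by apply: eq_cintegral => u; rewrite /k /= mulrA.
Qed.

Definition overlap_mass : R := gaussian_mass (4 * h)^-1 (n + n).
Local Notation Ck := overlap_mass.

Lemma overlap_mass_gt0 : 0 < Ck.
Proof. by rewrite gaussian_mass_gt0// invr_gt0 mulr_gt0. Qed.

Lemma cintegrable_mul_bargmann a g : cintegrable mu a -> in_L2 g ->
  cintegrable mu (fun X => a X * conjc (bargmann g X)).
Proof.
move=> ia g2; have [mg sg] := (in_L2P g).1 g2; have ma := cintegrable_measurable ia.
have [M M0 Ma] := integral_normc_lty ia.
have s0 : 0 <= fine (sq lam g) + 1 by rewrite addr_ge0// fine_ge0// sq_ge0.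
apply: (@cintegrable_le _ _ _ _ _ (fun X => normc (a X) * (fine (sq lam g) + 1))).
- by apply: cmeasurableM => //; apply: cmeasurable_conj; exact: cmeasurable_bargmann.
- by apply: measurable_funM; [exact: cmeasurable_norm|exact: measurable_cst].
- by move=> X; rewrite normc_mul_conj ler_wpM2l ?normc_ge0// bargmann_bounded.
- by rewrite integral_normcZ// Ma -EFinM ltry.
Qed.

Lemma bargmann_superpose_le a X : cintegrable mu a ->
  ((normc (bargmann (superpose a) X))%:E <=
   \int[mu]_Y (normc (a Y) * expR (- ((4 * h)^-1 * sqnorm (Y - X))))%:E)%E.
Proof.
move=> ia; have cX := coherent_in_L2 X.
rewrite /bargmann inner_superpose//.
apply: (le_trans (normc_cintegral (cintegrable_mul_bargmann ia cX))).
apply: ge0_integral_le => Y; rewrite lee_fin ?normc_ge0// normc_mul_conj.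
by rewrite /bargmann normc_overlap// -[Y - X]opprB sqnormN.
Qed.

(** The norm of the superposition is a double integral of [a] against the overlaps of coherent
   states, whose modulus is a Gaussian of [Y - X]. *)
Lemma sq_superpose_le a : cintegrable mu a -> (sq mu a < +oo)%E ->
  (sq lam (superpose a) <= (2 * Ck)%:E * sq mu a)%E.
Proof.
move=> ia sa; have ma := cintegrable_measurable ia.
have b2 := superpose_in_L2 ia; have [mb sb] := (in_L2P _).1 b2.
rewrite -cintegral_mul_conj_self// -/(inner _ _) inner_superpose//.
apply: (le_trans (normc_cintegral (cintegrable_mul_bargmann ia b2))).
pose k v := expR (- ((4 * h)^-1 * sqnorm (v : V))).
have mk : measurable_fun setT k by exact: (@measurable_gauss R (4 * h)^-1 (n + n)).
apply: (@le_trans _ _ (\int[mu]_X \int[mu]_Y (normc (a X) * normc (a Y) * k (Y - X))%R%:E)%E).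
  apply: ge0_integral_le => X; first by rewrite lee_fin normc_ge0.
  under eq_integral do rewrite -mulrA EFinM.
  rewrite ge0_integralZl_EFin ?normc_ge0//.
  - rewrite normc_mul_conj EFinM; apply: lee_wpmul2l; first by rewrite lee_fin normc_ge0.
    exact: bargmann_superpose_le.
  - by move=> Y _; rewrite lee_fin mulr_ge0 ?normc_ge0// expR_ge0.
  - apply/measurable_EFinP; apply: measurable_funM; first exact: cmeasurable_norm.
    exact: (measurable_fun_pair2 X (measurable_diff2 mk)).
have := @young_bound R _ a a k Ck 1 ltr01 ma ma mk.
move=> /(_ (fun v => expR_ge0 _)).
rewrite integral_gaussian ?invr_gt0 ?mulr_gt0// => /(_ erefl) /le_trans; apply.
move: sa (sq_ge0 mu a); rewrite invr1 !mul1r; case: (sq mu a) => [s| |]// _ _.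
by rewrite -!EFinM -EFinD lee_fin (_ : 2 * Ck * s = Ck * s + Ck * s)//; ring.
Qed.

End bargmann.

(** * Truncation and the Bessel inequality *)

Section truncation.
Context {R : realType} {d : nat}.
Local Notation V := 'rV[R]_d.
Local Notation mu := (lebesgue_rV d).
Implicit Types (X : V) (phi : V -> R[i]) (m : nat).

Definition cube_set m : set V := box (fun=> `[- m%:R, m%:R]%classic).

Lemma measurable_cube_set m : measurable (cube_set m).
Proof. by apply: measurable_box => i; exact: measurable_itv. Qed.

Lemma cube_set_lty m : (mu (cube_set m) < +oo)%E.
Proof.
rewrite lebesgue_rV_box; last by move=> i; exact: measurable_itv.
rewrite (eq_bigr (fun=> (m%:R + m%:R)%:E)).
  by rewrite prodEFin ltry.
move=> i _; rewrite lebesgue_measure_itv /= lte_fin.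
case: ifPn => [_|]; first by rewrite -EFinD opprK.
rewrite -leNgt => h; have -> : m%:R = 0 :> R by have := ler0n R m; lra.
by rewrite addr0.
Qed.

Lemma cube_set_homo : {homo cube_set : m p / (m <= p)%N >-> (m <= p)%O}.
Proof.
move=> m p mp; apply/subsetPset => X hX i; have := hX i; rewrite /= !in_itv /= => /andP[h1 h2].
have mp' : m%:R <= p%:R :> R by rewrite ler_nat.
by apply/andP; split; lra.
Qed.

Lemma cube_set_bigcup : \bigcup_m cube_set m = setT.
Proof.
apply/seteqP; split => // X _.
pose B := \sum_i `|X ord0 i|.
have [N hN] : exists N : nat, B <= N%:R.
  exists (Num.truncn B).+1; apply: ltW; exact: truncnS_gt.
exists N => // i; rewrite /= in_itv /= -ler_norml; apply: le_trans hN.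
by rewrite /B (bigD1 i) //= lerDl sumr_ge0.
Qed.

Definition trunc m phi X : R[i] := (\1_(cube_set m) X)%:C * phi X.

Lemma trunc_in m phi X : cube_set m X -> trunc m phi X = phi X.
Proof. by move=> h; rewrite /trunc indicE mem_set// mul1r. Qed.
Lemma trunc_notin m phi X : ~ cube_set m X -> trunc m phi X = 0.
Proof. by move=> h; rewrite /trunc indicE memNset// mul0r. Qed.

Lemma cmeasurable_trunc m phi : cmeasurable phi -> cmeasurable (trunc m phi).
Proof.
move=> mphi; apply: cmeasurableM => //; apply: cmeasurable_real.
exact: measurable_indic (measurable_cube_set m).
Qed.

Lemma trunc_le m phi X : normc (trunc m phi X) <= normc (phi X).
Proof.
have [h|h] := pselect (cube_set m X); first by rewrite trunc_in.
by rewrite trunc_notin// normc0 normc_ge0.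
Qed.

Lemma sq_trunc m phi : sq mu (trunc m phi) =
  (\int[mu]_(X in cube_set m) (normc (phi X) ^+ 2)%:E)%E.
Proof.
rewrite [RHS]integral_mkcond; apply: eq_integral => X _; rewrite patchE.
have [h|h] := pselect (cube_set m X); first by rewrite trunc_in// mem_set.
by rewrite trunc_notin// memNset// normc0 expr0n.
Qed.

Lemma sq_trunc_cvg phi : cmeasurable phi -> (sq mu (trunc m phi) @[m --> \oo] --> sq mu phi)%E.
Proof.
move=> mphi; have -> : (fun m => sq mu (trunc m phi)) =
  (fun m => \int[mu]_(X in cube_set m) (normc (phi X) ^+ 2)%:E)%E.
  by apply/funext => m; exact: sq_trunc.
have := @ge0_nondecreasing_set_cvg_integral _ V R cube_set (fun X => (normc (phi X) ^+ 2)%:E) mu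
  cube_set_homo measurable_cube_set.
rewrite cube_set_bigcup; apply.
- by move=> m; apply: measurable_funTS; exact: measurable_sq.
- by move=> m X _; rewrite lee_fin sqr_ge0.
Qed.

Lemma sq_le_of_trunc phi L : cmeasurable phi -> (forall m, sq mu (trunc m phi) <= L)%E ->
  (sq mu phi <= L)%E.
Proof.
move=> mphi h; have c := sq_trunc_cvg mphi.
rewrite -(cvg_lim _ c)//; apply: lime_le; first by apply/cvg_ex; exists (sq mu phi).
exact: nearW.
Qed.

Section bounded.
Variables (phi : V -> R[i]) (M : R) (m : nat).
Hypotheses (mphi : cmeasurable phi) (bphi : forall X, normc (phi X) <= M).

Let M0 : 0 <= M. Proof. by apply: le_trans (bphi 0); exact: normc_ge0. Qed.

Lemma trunc_integrable : cintegrable mu (trunc m phi).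
Proof.
apply: (@cintegrable_le _ _ _ _ _ (fun X => M * \1_(cube_set m) X)).
- exact: cmeasurable_trunc.
- apply: measurable_funM; first exact: measurable_cst.
  exact: measurable_indic (measurable_cube_set m).
- move=> X; have [h|h] := pselect (cube_set m X).
    by rewrite trunc_in// indicE mem_set// mulr1.
  by rewrite trunc_notin// normc0 mulr_ge0.
under eq_integral do rewrite EFinM.
rewrite ge0_integralZl_EFin//.
- rewrite integral_indic//; last exact: measurable_cube_set.
  by rewrite setIT lte_mul_pinfty ?cube_set_lty.
- apply/measurable_EFinP; exact: measurable_indic (measurable_cube_set m).
Qed.

Lemma sq_trunc_lty : (sq mu (trunc m phi) < +oo)%E.
Proof.
apply: (@le_lt_trans _ _ (\int[mu]_X (M%:E * (normc (trunc m phi X))%:E))%E).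
  apply: ge0_integral_le => X; first by rewrite lee_fin sqr_ge0.
  rewrite -EFinM lee_fin expr2.
  by rewrite ler_wpM2r ?normc_ge0// (le_trans (trunc_le _ _ _)).
have /cintegrableP[mt it] := trunc_integrable.
rewrite ge0_integralZl_EFin//.
- by rewrite lte_mul_pinfty.
- by move=> X _; rewrite lee_fin normc_ge0.
- by apply/measurable_EFinP; exact: cmeasurable_norm.
Qed.

End bounded.

Lemma sq_trunc_tail phi (e : R) : cmeasurable phi -> (sq mu phi < +oo)%E -> 0 < e ->
  exists m, (sq mu (fun X => (phi X - trunc m phi X)%R) <= e%:E)%E.
Proof.
move=> mphi sphi e0; have c := sq_trunc_cvg mphi.
have fphi : sq mu phi \is a fin_num by rewrite ge0_fin_numE ?sq_ge0.
have E m : (sq mu phi = sq mu (trunc m phi) + sq mu (fun X => (phi X - trunc m phi X)%R))%E.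
  have mt := cmeasurable_trunc m mphi.
  rewrite /sq -ge0_integralD//; last 4 first.
  - by move=> X _; rewrite lee_fin sqr_ge0.
  - exact: measurable_sq.
  - by move=> X _; rewrite lee_fin sqr_ge0.
  - apply: measurable_sq; under eq_fun do rewrite -mulN1r.
    by apply: cmeasurableD => //; exact: cmeasurableZ.
  apply: eq_integral => X _; rewrite -EFinD; congr EFin.
  have [h|h] := pselect (cube_set m X).
    by rewrite trunc_in// subrr normc0 expr0n /= addr0.
  by rewrite trunc_notin// subr0 normc0 expr0n /= add0r.
have [m hm] : exists m, ((fine (sq mu phi) - e)%:E < sq mu (trunc m phi))%E.
  apply: contrapT => /forallNP H.
  have : (sq mu phi <= (fine (sq mu phi) - e)%:E)%E.
    by apply: sq_le_of_trunc => // m; rewrite leNgt; apply/negP; exact: H.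
  by rewrite -[X in (X <= _)%E]fineK// lee_fin; lra.
exists m; have := E m; move: hm fphi (sq_ge0 mu (fun X => (phi X - trunc m phi X)%R)).
move: (sq_ge0 mu (trunc m phi)).
case: (sq mu phi) => [a| |]//; case: (sq mu (trunc m phi)) => [b| |]//; case: (sq mu _) => [c'| |]//=.
by rewrite !lee_fin lte_fin => b0 ab _ c0 [] e1; lra.
Qed.

(** Truncation makes [x] finite, so that half of it can be moved to the left-hand side. *)
Lemma absorb_half (x : \bar R) (L : R) : (0 <= x)%E -> (x < +oo)%E -> (x <= (2^-1)%:E * x + L%:E)%E ->
  (x <= (2 * L)%:E)%E.
Proof. by case: x => [x| |]//; rewrite -EFinM -EFinD !lee_fin => _ _; lra. Qed.

End truncation.

Section bessel.
Context {R : realType} {n : nat}.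
Local Notation U := 'rV[R]_n.
Local Notation lam := (lebesgue_rV n).
Local Notation mu := (lebesgue_rV (n + n)).
Variable h : R.
Hypothesis h0 : 0 < h.
Implicit Types (f g : U -> R[i]).
Local Notation Ck := (@overlap_mass R n h).

(** Duality: the square of the norm of the truncated transform [a] is the scalar product of [f] with
   the superposition of [a], whose norm is controlled by that of [a]. *)
Lemma bessel f : in_L2 f -> (sq mu (bargmann h f) <= (8 * Ck)%:E * sq lam f)%E.
Proof.
move=> f2; have [mf sf] := (in_L2P f).1 f2.
have mS := cmeasurable_bargmann h mf.
have bS X := bargmann_bounded h0 X f2.
have C0 := @overlap_mass_gt0 R n h h0.
have ffin : sq lam f = (fine (sq lam f))%:E by rewrite fineK// ge0_fin_numE ?sq_ge0.
apply: sq_le_of_trunc => // m.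
set a := trunc m _.
have ia : cintegrable mu a := trunc_integrable m mS bS.
have sa : (sq mu a < +oo)%E := sq_trunc_lty m mS bS.
have ma := cintegrable_measurable ia.
have b2 := superpose_in_L2 h0 ia; have [mb sb] := (in_L2P _).1 b2.
(* With this weight, [sq_superpose_le] bounds the first term by half of [sq mu a]. *)
have t0 : 0 < (4 * Ck)^-1 by rewrite invr_gt0 mulr_gt0.
rewrite (_ : 8 * Ck = 2 * (4 * Ck)); last by ring.
rewrite ffin -EFinM -mulrA; apply: absorb_half => //; first exact: sq_ge0.
have -> : sq mu a = (normc (inner (superpose h a) f))%:E.
  rewrite -cintegral_mul_conj_self// inner_superpose//; congr (normc _)%:E.
  apply: eq_cintegral => X; rewrite /a.
  have [hX|hX] := pselect (cube_set m X); first by rewrite trunc_in.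
  by rewrite trunc_notin// !mul0r.
apply: (le_trans (normc_cintegral_mul_conj t0 mb mf sb sf)).
have -> : (normc (inner (superpose h a) f))%:E = sq mu a.
  rewrite -cintegral_mul_conj_self// inner_superpose//; congr (normc _)%:E.
  apply: eq_cintegral => X; rewrite /a.
  have [hX|hX] := pselect (cube_set m X); first by rewrite trunc_in.
  by rewrite trunc_notin// !mul0r.
apply: leeD; last by rewrite invrK {1}ffin -EFinM.
have := sq_superpose_le h0 ia sa => /(lee_wpmul2l (x := ((4 * Ck)^-1)%:E)) H.
apply: (le_trans (H _)); first by rewrite lee_fin ltW.
rewrite muleA -EFinM (_ : _ * _ = 2^-1)//; field.
by rewrite gt_eqF.
Qed.

End bessel.

(** * Weak convergence of series in L^2 *)

Section L2_series.
Context {R : realType} d (T : measurableType d) (mu : {measure set T -> \bar R}).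
Implicit Types (f g : T -> R[i]).

Lemma ccvg_part (P : R[i] -> R) (u : nat -> R[i]) l :
  (forall z, `|P z| <= normc z) -> (forall z w, P (z - w) = P z - P w) -> ccvg u l ->
  P (u N) @[N --> \oo] --> P l.
Proof.
move=> Pn PB h; apply/cvgrPdist_le => e e0.
move: h => /cvgrPdist_le /(_ e e0) [N _ hN].
exists N => // m /= /hN /=; rewrite sub0r normrN (ger0_norm (normc_ge0 _)) => he.
by rewrite distrC -PB (le_trans (Pn _)).
Qed.

Lemma ccvg_of_parts (u : nat -> R[i]) l : Re (u N) @[N --> \oo] --> Re l ->
  Im (u N) @[N --> \oo] --> Im l -> ccvg u l.
Proof.
move=> h1 h2; apply: (@ccvg_squeeze _ _ _ (fun N => `|Re (u N) - Re l| + `|Im (u N) - Im l|)).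
  by move=> N; apply: le_trans (normc_le _) _; rewrite cReD cImD cReN cImN.
rewrite -[X in _ --> X]addr0; apply: cvgD.
  by rewrite -(normr0 R) -(subrr (Re l)); apply: cvg_norm; apply: cvgB => //; exact: cvg_cst.
by rewrite -(normr0 R) -(subrr (Im l)); apply: cvg_norm; apply: cvgB => //; exact: cvg_cst.
Qed.

Lemma half_geometric_sum (N : nat) : \sum_(k < N) (2^-1 : R) ^+ k <= 2.
Proof.
have -> : \sum_(k < N) (2^-1 : R) ^+ k = 2 - 2 * 2^-1 ^+ N.
  elim: N => [|N IH]; first by rewrite big_ord0 expr0; ring.
  by rewrite big_ord_recr /= IH exprS; field.
by rewrite lerBlDr lerDl mulr_ge0// exprn_ge0.
Qed.

Lemma cmeasurable_sum (b : nat -> T -> R[i]) N : (forall k, cmeasurable (b k)) ->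
  cmeasurable (fun u => \sum_(k < N) b k u).
Proof.
move=> mb; elim: N => [|N IH].
  by under eq_fun do rewrite big_ord0; exact: cmeasurable_cst.
by under eq_fun do rewrite big_ord_recr /=; exact: cmeasurableD.
Qed.

(** A form of the Riesz-Fischer theorem: a geometrically convergent series in [L^2] converges weakly.
   The function [H = sum_k 4^k |b_k|^2] is integrable, and [|b_k| <= 2^-k sqrt H], so that the
   series converges where [H] is finite and its partial sums are dominated by [2 sqrt H]. *)
Lemma L2_series (b : nat -> T -> R[i]) (M : R) : (forall k, cmeasurable (b k)) ->
  (forall k, ((4 ^+ k)%R%:E * sq mu (b k) <= (M / (2 ^ (k + 1))%N%:R)%R%:E)%E) ->
  exists B, [/\ cmeasurable B, (sq mu B < +oo)%E &
    forall g, cmeasurable g -> (sq mu g < +oo)%E ->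
      ccvg (fun N => cintegral mu (fun u => (\sum_(k < N) b k u) * conjc (g u)))
           (cintegral mu (fun u => B u * conjc (g u)))].
Proof.
move=> mb hb.
pose t k u := (4 ^+ k * normc (b k u) ^+ 2)%:E.
pose H u := (\sum_(0 <= k <oo) t k u)%E.
have t0 k u : (0 <= t k u)%E by rewrite lee_fin mulr_ge0 ?sqr_ge0// exprn_ge0.
have mt k : measurable_fun setT (t k).
  by rewrite /t; under eq_fun do rewrite EFinM; apply: measurable_funeM; exact: measurable_sq.
have H0 u : (0 <= H u)%E by apply: nneseries_ge0.
have mH : measurable_fun setT H.
  by apply: (@ge0_emeasurable_sum _ _ _ _ t xpredT).
have iH : (\int[mu]_u H u < +oo)%E.
  rewrite integral_nneseries//; apply: (@le_lt_trans _ _ M%:E); last exact: ltry.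
  have := cvg_lim _ (@cvg_geometric_eseries_half R M 0); rewrite expr0 divr1 => <- //.
  apply: lee_nneseries => [k _ _|k _]; first exact: integral_ge0.
  apply: le_trans (hb k); rewrite /t; under eq_integral do rewrite EFinM.
  rewrite ge0_integralZl_EFin// ?exprn_ge0//; last exact: measurable_sq.
  by move=> u _; rewrite lee_fin sqr_ge0.
pose D := [set u | (H u < +oo)%E].
have mD : measurable D.
  rewrite (_ : D = setT `&` H @^-1` (~` [set +oo%E])).
    by apply: mH => //; apply: measurableC; exact: emeasurable_set1.
  by apply/seteqP; split => u; rewrite /D /= ltey; [move=> /eqP hu; split|move=> [_ /eqP]].
have aeD : {ae mu, forall u, D u}.
  have : mu.-integrable setT H.
    by apply/integrableP; split => //; under eq_integral do rewrite gee0_abs//.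
  move=> /(integrable_ae measurableT); apply: filterS => u /(_ I).
  by rewrite /D /= -ge0_fin_numE.
pose s u := Num.sqrt (fine (H u)).
have s0 u : 0 <= s u by exact: sqrtr_ge0.
have s2 u : s u ^+ 2 = fine (H u) by rewrite sqr_sqrtr// fine_ge0.
have bnd k u : D u -> normc (b k u) <= 2^-1 ^+ k * s u.
  move=> Du; have Hf : H u = (fine (H u))%:E by rewrite fineK// ge0_fin_numE.
  have : (t k u <= H u)%E.
    apply: le_trans (nneseries_lim_ge k.+1 _); last by move=> i _ _; exact: t0.
    by rewrite big_nat_recr//= leeDr// sume_ge0.
  rewrite Hf lee_fin => h1.
  rewrite exprVn mulrC ler_pdivlMr ?exprn_gt0//.
  rewrite -(ler_sqr (x := _ * _)) ?nnegrE ?mulr_ge0 ?normc_ge0 ?exprn_ge0//.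
  by rewrite s2 exprMn mulrC -exprM mulnC exprM (_ : 2 ^+ 2 = 4 :> R)//; ring.
(* Cut off outside [D], the partial sums converge everywhere, which makes the limit measurable. *)
pose b' k u := (\1_D u)%:C * b k u.
have b'D k u : D u -> b' k u = b k u.
  by move=> Du; rewrite /b' indicE mem_set// mul1r.
have bnd' k u : normc (b' k u) <= 2^-1 ^+ k * s u.
  have [Du|Du] := pselect (D u); first by rewrite b'D// bnd.
  by rewrite /b' indicE memNset// mul0r normc0 mulr_ge0 ?exprn_ge0.
have mb' k : cmeasurable (b' k).
  by apply: cmeasurableM => //; apply: cmeasurable_real; exact: measurable_indic.
pose S N u := \sum_(k < N) b' k u.
have nS N u : \sum_(k < N) normc (b' k u) <= 2 * s u.
  apply: (@le_trans _ _ (\sum_(k < N) 2^-1 ^+ k * s u)); first exact: ler_sum.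
  by rewrite -mulr_suml ler_wpM2r// half_geometric_sum.
have bS N u : normc (S N u) <= 2 * s u by apply: le_trans (normc_sum _ _ _) (nS N u).
have conv u : exists l, ccvg (S ^~ u) l.
  apply: (@cauchy_ccvg _ _ (fun N => \sum_(k < N) normc (b' k u)) (2 * s u)) => // m N mN.
  have split_sum (W : zmodType) (F : nat -> W) :
      \sum_(k < N) F k - \sum_(k < m) F k = \sum_(m <= k < N) F k.
    by rewrite -!(big_mkord xpredT) (big_cat_nat _ (n := m))//= addrAC subrr add0r.
  have -> : S N u - S m u = \sum_(m <= k < N) b' k u by exact: (split_sum _ (fun k => b' k u)).
  rewrite (split_sum _ (fun k => normc (b' k u))).
  exact: normc_sum.
have [B hB] := choice conv.
have [mB1 mB2] : cmeasurable B.
  split; [apply: (@measurable_fun_cvg _ _ _ _ (fun N u => Re (S N u)))|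
          apply: (@measurable_fun_cvg _ _ _ _ (fun N u => Im (S N u)))].
  - by move=> N; have [] := cmeasurable_sum N mb'.
  - move=> u _; apply: (ccvg_part _ _ (hB u)); [exact: Re_le_normc|].
    by move=> z w; rewrite cReD cReN.
  - by move=> N; have [] := cmeasurable_sum N mb'.
  - move=> u _; apply: (ccvg_part _ _ (hB u)); [exact: Im_le_normc|].
    by move=> z w; rewrite cImD cImN.
have mB : cmeasurable B by [].
have bB u : normc (B u) <= 2 * s u by apply: (ccvg_norm_le (hB u)) => N; exact: bS.
have i4H : (\int[mu]_u (4%:E * H u) < +oo)%E.
  by rewrite ge0_integralZl_EFin// lte_mul_pinfty.
have s4 u : ((4 * s u ^+ 2)%:E <= 4%:E * H u)%E.
  rewrite s2 EFinM; apply: lee_wpmul2l; first by rewrite lee_fin.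
  by move: (H0 u); case: (H u) => [r| |] //= _; rewrite leey.
exists B; split => //.
  apply: le_lt_trans i4H; apply: ge0_integral_le => u; first by rewrite lee_fin sqr_ge0.
  apply: le_trans (s4 u); rewrite lee_fin (_ : 4 * s u ^+ 2 = (2 * s u) ^+ 2); last by ring.
  by rewrite lerXn2r ?nnegrE ?normc_ge0 ?mulr_ge0.
move=> g mg sg.
pose F N u := (\sum_(k < N) b k u) * conjc (g u).
have mF N : cmeasurable (F N).
  by apply: cmeasurableM; [exact: cmeasurable_sum|exact: cmeasurable_conj].
have mBg : cmeasurable (fun u => B u * conjc (g u)).
  by apply: cmeasurableM => //; exact: cmeasurable_conj.
pose G u := (4%:E * H u + (normc (g u) ^+ 2)%:E)%E.
have iG : mu.-integrable setT G.
  have G0 u : (0 <= G u)%E by rewrite adde_ge0 ?mule_ge0 ?lee_fin// sqr_ge0.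
  apply/integrableP; split.
    by apply: emeasurable_funD; [exact: measurable_funeM|exact: measurable_sq].
  under eq_integral do rewrite gee0_abs//.
  rewrite ge0_integralD//.
  - exact: lte_add_pinfty.
  - by move=> u _; rewrite mule_ge0 ?lee_fin.
  - exact: measurable_funeM.
  - by move=> u _; rewrite lee_fin sqr_ge0.
  - exact: measurable_sq.
have FS N u : D u -> F N u = S N u * conjc (g u).
  by move=> Du; congr (_ * _); apply: eq_bigr => k _; rewrite b'D.
have part (P : R[i] -> R) : (forall z, `|P z| <= normc z) ->
    (forall z w, P (z - w) = P z - P w) ->
    (forall f, cmeasurable f -> measurable_fun setT (fun u => P (f u))) ->
    \int[mu]_u P (F N u) @[N --> \oo] --> \int[mu]_u P (B u * conjc (g u)).
  move=> Pn PB mP.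
  have [|||||iL _ cv] := @dominated_convergence _ _ R mu setT measurableT
    (fun N u => (P (F N u))%:E) (fun u => (P (B u * conjc (g u)))%:E) G.
  - by move=> N; apply/measurable_EFinP; apply: mP.
  - by apply/measurable_EFinP; exact: (mP _ mBg).
  - move: aeD; apply: filterS => u Du _; apply: cvg_EFin; first exact: nearW.
    under eq_fun do rewrite FS//.
    apply: (ccvg_part Pn PB); apply: ccvgM; first exact: hB.
    exact: ccvg_cst.
  - exact: iG.
  - move: aeD; apply: filterS => u Du N _; rewrite FS//.
    apply: (@le_trans _ _ (4 * s u ^+ 2 + normc (g u) ^+ 2)%:E); last first.
      by rewrite EFinD leeD2r.
    rewrite lee_fin; apply: (le_trans (Pn _)); rewrite normc_mul_conj.
    apply: (@le_trans _ _ ((2 * s u) * normc (g u))); first by rewrite ler_wpM2r ?normc_ge0.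
    have := @amgm R 1 (2 * s u) (normc (g u)) ltr01.
    by rewrite invr1 !mul1r exprMn (_ : 2 ^+ 2 = 4 :> R)//; ring.
  have fin := integral_fune_fin_num measurableT iL.
  by apply: fine_cvg; rewrite fineK.
apply: ccvg_of_parts.
  apply: (part (@complex.Re R)); [exact: Re_le_normc| |by move=> f []].
  by move=> z w; rewrite cReD cReN.
apply: (part (@complex.Im R)); [exact: Im_le_normc| |by move=> f []].
by move=> z w; rewrite cImD cImN.
Qed.

End L2_series.

(** * Square-integrable amplitudes *)

Section superpose_square_integrable.
Context {R : realType} {n : nat}.
Local Notation U := 'rV[R]_n.
Local Notation V := 'rV[R]_(n + n).
Local Notation lam := (lebesgue_rV n).
Local Notation mu := (lebesgue_rV (n + n)).
Variable h : R.
Hypothesis h0 : 0 < h.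
Local Notation Ck := (@overlap_mass R n h).

Lemma sq_bargmann_lty (g : U -> R[i]) : in_L2 g -> (sq mu (bargmann h g) < +oo)%E.
Proof.
move=> g2; apply: (le_lt_trans (bessel h0 g2)); have [_ sg] := (in_L2P g).1 g2.
by rewrite lte_mul_pinfty// lee_fin mulr_ge0// ltW// overlap_mass_gt0.
Qed.

Lemma superposeD (a b : V -> R[i]) u : cintegrable mu a -> cintegrable mu b ->
  superpose h (fun X => a X + b X) u = superpose h a u + superpose h b u.
Proof.
move=> ia ib; rewrite /superpose -cintegralD; try exact: superpose_integrable.
by apply: eq_cintegral => X; rewrite mulrDl.
Qed.

Lemma cintegrable_cst0 : cintegrable mu (fun _ : V => 0).
Proof.
apply/cintegrableP; split; first exact: cmeasurable_cst.
by rewrite integral0_eq ?ltry// => X _; rewrite normc0.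
Qed.

Lemma cintegrableB (a b : V -> R[i]) : cintegrable mu a -> cintegrable mu b ->
  cintegrable mu (fun X => a X - b X).
Proof.
move=> ia ib; under eq_fun do rewrite -mulN1r.
by apply: cintegrableD => //; exact: cintegrableZ.
Qed.

Lemma cintegralB (a b : V -> R[i]) : cintegrable mu a -> cintegrable mu b ->
  cintegral mu (fun X => a X - b X) = cintegral mu a - cintegral mu b.
Proof.
move=> ia ib; rewrite -mulN1r -cintegralZ// -cintegralD//; last exact: cintegrableZ.
by apply: eq_cintegral => X; rewrite mulN1r.
Qed.

Lemma cmeasurableB (a b : V -> R[i]) : cmeasurable a -> cmeasurable b ->
  cmeasurable (fun X => a X - b X).
Proof.
move=> ma mb; under eq_fun do rewrite -mulN1r.
by apply: cmeasurableD => //; exact: cmeasurableZ.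
Qed.

(** The integral defining the superposition need not converge for a square-integrable amplitude;
   truncations along which the tails decay like [8 ^ -k] have superpositions which form a
   geometrically convergent series. *)
Lemma superpose_L2 (phi : V -> R[i]) (M0 : R) : cmeasurable phi -> (forall X, normc (phi X) <= M0) ->
  (sq mu phi < +oo)%E ->
  exists b, in_L2 b /\ forall g, in_L2 g ->
    inner b g = cintegral mu (fun X => phi X * conjc (bargmann h g X)).
Proof.
move=> mphi bphi sphi.
have C0 : 0 < Ck := overlap_mass_gt0 h0.
pose Q := fine (sq mu phi) + 1.
have Q0 : 0 < Q by rewrite ltr_wpDl// fine_ge0// sq_ge0.
have e0 k : 0 < Q / 8 ^+ k by rewrite divr_gt0// exprn_gt0.
have [m hm] := choice (fun k => sq_trunc_tail mphi sphi (e0 k.+1)).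
(* [tr 0 = 0], so that the increments [a k] sum to [tr N]. *)
pose tr k : V -> R[i] := if k is k'.+1 then trunc (m k') phi else fun=> 0.
have itr k : cintegrable mu (tr k).
  by case: k => [|k]; [exact: cintegrable_cst0|exact: trunc_integrable bphi].
have mtr k := cintegrable_measurable (itr k).
have tail k : (sq mu (fun X => (phi X - tr k X)%R) <= (Q / 8 ^+ k)%:E)%E.
  case: k => [|k]; last exact: hm.
  rewrite expr0 divr1 /Q EFinD fineK ?ge0_fin_numE ?sq_ge0//.
  rewrite (_ : (fun X => _) = phi); last by apply/funext => X; rewrite subr0.
  by rewrite leeDl.
pose a k X := tr k.+1 X - tr k X.
have ia k : cintegrable mu (a k) by exact: cintegrableB.
have ma k := cintegrable_measurable (ia k).
have sa k : (sq mu (a k) <= (4 * (Q / 8 ^+ k))%:E)%E.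
  have -> : a k = fun X => (phi X - tr k X) + (-1) * (phi X - tr k.+1 X).
    by apply/funext => X; rewrite /a; ring.
  apply: (le_trans (sqD _ _ _)); [exact: cmeasurableB|by apply: cmeasurableZ; exact: cmeasurableB|].
  rewrite sqZ; last exact: cmeasurableB.
  rewrite normcN normc1 expr1n mul1e.
  apply: (@le_trans _ _ (2%:E * (Q / 8 ^+ k)%:E + 2%:E * (Q / 8 ^+ k.+1)%:E)%E).
    by apply: leeD; apply: lee_wpmul2l => //; rewrite lee_fin.
  rewrite -!EFinM -EFinD lee_fin exprS invfM.
  have := ltW (e0 k); move: (8 ^+ k) => y; rewrite mulrCA => z0; lra.
pose b k := superpose h (a k).
have bL2 k : in_L2 (b k) by exact: superpose_in_L2.
have mb k : cmeasurable (b k) by have [] := (in_L2P _).1 (bL2 k).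
have hb k : ((4 ^+ k)%R%:E * sq lam (b k) <= ((16 * Ck * Q) / (2 ^ (k + 1))%N%:R)%R%:E)%E.
  have sak : (sq mu (a k) < +oo)%E by apply: (le_lt_trans (sa k)); rewrite ltry.
  apply: (@le_trans _ _ ((4 ^+ k)%:E * ((2 * Ck)%:E * (4 * (Q / 8 ^+ k))%:E))%E).
    apply: lee_wpmul2l; first by rewrite lee_fin exprn_ge0.
    apply: (le_trans (sq_superpose_le h0 (ia k) sak)).
    by apply: lee_wpmul2l => //; rewrite lee_fin mulr_ge0// ltW.
  rewrite -!EFinM lee_fin natrX exprD expr1 (_ : 8 = 2 * 4 :> R); last by ring.
  rewrite exprMn le_eqVlt; apply/orP; left; apply/eqP; field.
  by rewrite !expf_neq0.
have [B [mB sB hB]] := L2_series mb hb.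
exists B; split; first exact/in_L2P.
move=> g g2; have [mg sg] := (in_L2P g).1 g2.
have sumb N u : \sum_(k < N) b k u = superpose h (tr N) u.
  elim: N => [|N IH].
    rewrite big_ord0; transitivity (cintegral mu (fun _ : V => 0 : R[i])).
      by apply: eq_cplx; rewrite /cintegral /= /Rintegral integral0_eq.
    by apply: eq_cintegral => X; rewrite mul0r.
  rewrite big_ord_recr /= IH -superposeD//; apply: eq_cintegral => X.
  by rewrite /a [tr N X + _]addrC subrK.
apply: (ccvg_unique (hB g mg sg)).
have sS := sq_bargmann_lty g2; have mS := cmeasurable_bargmann h mg.
pose s := fine (sq mu (bargmann h g)).
have str N : (sq mu (fun X => phi X - tr N X)%R < +oo)%E by apply: (le_lt_trans (tail N)); rewrite ltry.
apply: (@ccvg_squeeze _ _ _ (fun N => (Q + s) * 2^-1 ^+ N)); last first.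
  have := @cvg_geometric R (Q + s) 2^-1; rewrite ger0_norm ?invf_lt1 ?ltr1n//; exact.
move=> N.
have -> : cintegral lam (fun u => (\sum_(k < N) b k u) * conjc (g u)) =
    cintegral mu (fun X => tr N X * conjc (bargmann h g X)).
  rewrite -inner_superpose//; apply: eq_cintegral => u; by rewrite sumb.
have i1 := cintegrable_mul_conj mphi mS sphi sS.
have i2 := cintegrable_mul_bargmann h0 (itr N) g2.
rewrite -normcN opprB -cintegralB//.
have -> : cintegral mu (fun X => phi X * conjc (bargmann h g X) - tr N X * conjc (bargmann h g X)) =
    cintegral mu (fun X => (phi X - tr N X) * conjc (bargmann h g X)).
  by apply: eq_cintegral => X; rewrite mulrBl.
(* The weight [2 ^ N] leaves a factor [4 ^ -N] on the tail and [2 ^ -N] on the other term. *)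
have t0 : 0 < 2 ^+ N :> R by rewrite exprn_gt0.
rewrite -lee_fin; apply: (le_trans (normc_cintegral_mul_conj t0 (cmeasurableB mphi (mtr N)) mS (str N) sS)).
apply: (@le_trans _ _ ((2 ^+ N)%:E * (Q / 8 ^+ N)%:E + (2 ^- N)%:E * s%:E)%E).
  apply: leeD; first by apply: lee_wpmul2l => //; rewrite lee_fin ltW.
  by rewrite /s fineK// ge0_fin_numE// sq_ge0.
rewrite -!EFinM -EFinD lee_fin exprVn (mulrDl Q s) lerD//; last by rewrite mulrC.
rewrite mulrCA ler_wpM2l ?(ltW Q0)// (_ : 8 = 2 * 4 :> R); last by ring.
rewrite exprMn invfM mulrA mulfV ?expf_neq0// mul1r lef_pV2 ?posrE ?exprn_gt0//.
by rewrite lerXn2r// ?nnegrE// ler_nat.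
Qed.

End superpose_square_integrable.

(** * Operators given by reduced kernels *)

Section inner_product.
Context {R : realType} {n : nat}.
Local Notation U := 'rV[R]_n.
Local Notation lam := (lebesgue_rV n).
Implicit Types f g k : U -> R[i].

Lemma in_L2_lincomb (a b : R[i]) f g : in_L2 f -> in_L2 g -> in_L2 (fun u => a * f u + b * g u).
Proof.
move=> /in_L2P[mf sf] /in_L2P[mg sg]; apply/in_L2P; split; last exact: sq_lincomb.
by apply: cmeasurableD; exact: cmeasurableZ.
Qed.

Lemma inner_lincomb (a b : R[i]) f g k : in_L2 f -> in_L2 g -> in_L2 k ->
  inner (fun u => a * f u + b * g u) k = a * inner f k + b * inner g k.
Proof.
move=> /in_L2P[mf sf] /in_L2P[mg sg] /in_L2P[mk sk].
have i1 := cintegrable_mul_conj mf mk sf sk; have i2 := cintegrable_mul_conj mg mk sg sk.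
rewrite /inner -(cintegralZ a i1) -(cintegralZ b i2) -cintegralD; try exact: cintegrableZ.
by apply: eq_cintegral => u; rewrite mulrDl !mulrA.
Qed.

Lemma inner_nondegenerate f : in_L2 f -> (forall k, in_L2 k -> inner f k = 0) ->
  {ae lam, forall u, f u = 0}.
Proof.
move=> f2 h; have [mf sf] := (in_L2P f).1 f2; apply: sq_eq0 => //.
by rewrite -cintegral_mul_conj_self// -/(inner f f) h// normc0.
Qed.

End inner_product.

Section operator.
Context {R : realType} {n : nat}.
Local Notation U := 'rV[R]_n.
Local Notation V := 'rV[R]_(n + n).
Local Notation lam := (lebesgue_rV n).
Local Notation mu := (lebesgue_rV (n + n)).
Implicit Types (X Y : V) (f g : U -> R[i]).
Variables (h : R) (G : V -> V -> R[i]) (k : V -> R) (K : R).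
Hypothesis h0 : 0 < h.
Hypothesis mG : cmeasurable (fun p : V * V => G p.2 p.1).
Hypothesis mk : measurable_fun setT k.
Hypothesis Kk : (\int[mu]_v (k v)%:E = K%:E)%E.
Hypothesis bG : forall X Y,
  normc (G X Y) <= expR ((4 * h)^-1 * sqnorm (X - Y)) * k (X - Y).
Local Notation Psi := (coherent_state h).
Local Notation S := (bargmann h).
Local Notation Ck := (@overlap_mass R n h).

Lemma profile_ge0 v : 0 <= k v.
Proof.
have := le_trans (normc_ge0 _) (bG v 0); rewrite subr0.
by rewrite pmulr_rge0 // expR_gt0.
Qed.

Lemma profile_mass_ge0 : 0 <= K.
Proof. by rewrite -lee_fin -Kk; apply: integral_ge0 => v _; rewrite lee_fin profile_ge0. Qed.

(** The scalar kernel of the operator in the coherent-state representation. *)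
Definition reduced_kernel X Y : R[i] := G Y X * inner (Psi Y) (Psi X).

(** The Gaussian decay of the overlap cancels exactly the growth allowed to [G]. *)
Lemma normc_reduced_kernel X Y : normc (reduced_kernel X Y) <= k (Y - X).
Proof.
rewrite normcM normc_overlap//.
apply: (@le_trans _ _ (expR ((4 * h)^-1 * sqnorm (Y - X)) * k (Y - X) *
  expR (- ((4 * h)^-1 * sqnorm (Y - X))))); first by rewrite ler_wpM2r ?expR_ge0.
by rewrite mulrAC -expRD subrr expR0 mul1r.
Qed.

Lemma cmeasurable_reduced_kernel : cmeasurable (fun p : V * V => reduced_kernel p.1 p.2).
Proof.
apply: cmeasurableM; first exact: mG.
apply: (@cmeasurable_param R _ _ (V * V)%type U lam
  (fun q : (V * V) * U => Psi q.1.2 q.2 * conjc (Psi q.1.1 q.2))).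
have m1 : measurable_fun setT (fun q : (V * V) * U => q.1.1).
  exact: (measurableT_comp (@measurable_fst _ _ V V) (@measurable_fst _ _ (V * V)%type U)).
have m2 : measurable_fun setT (fun q : (V * V) * U => q.1.2).
  exact: (measurableT_comp (@measurable_snd _ _ V V) (@measurable_fst _ _ (V * V)%type U)).
have m3 : measurable_fun setT (fun q : (V * V) * U => q.2) by exact: measurable_snd.
apply: cmeasurableM.
  exact: (cmeasurable_comp (measurable_fun_pair m2 m3) (cmeasurable_coherent2 h)).
apply: cmeasurable_conj.
exact: (cmeasurable_comp (measurable_fun_pair m1 m3) (cmeasurable_coherent2 h)).
Qed.

(** The amplitude of the image of [f]. *)
Definition kernel_action f X : R[i] := cintegral mu (fun Y => reduced_kernel X Y * S f Y).
Local Notation A := kernel_action.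

Lemma integral_shifted_profile X : (\int[mu]_Y (k (Y - X))%:E = K%:E)%E.
Proof.
by rewrite -Kk; apply: (integral_translate_sub X (f := fun v => (k v)%:E)); exact/measurable_EFinP.
Qed.

Lemma cmeasurable_kernel_bargmann f : cmeasurable f ->
  cmeasurable (fun p : V * V => reduced_kernel p.1 p.2 * S f p.2).
Proof.
move=> mf; apply: cmeasurableM; first exact: cmeasurable_reduced_kernel.
by apply: (cmeasurable_comp (@measurable_snd _ _ V V)); exact: cmeasurable_bargmann.
Qed.

Lemma cmeasurable_kernel_action f : cmeasurable f -> cmeasurable (A f).
Proof.
move=> mf; apply: (@cmeasurable_param R _ _ V V mu
  (fun p : V * V => reduced_kernel p.1 p.2 * S f p.2)).
exact: cmeasurable_kernel_bargmann.
Qed.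

Lemma measurable_shifted_profile X : measurable_fun setT (fun Y => k (Y - X)).
Proof. exact: (measurable_fun_pair2 X (measurable_diff2 mk)). Qed.

Lemma kernel_integral_bound f X (M : R) : in_L2 f -> (forall Y, normc (S f Y) <= M) ->
  (\int[mu]_Y (k (Y - X) * normc (S f Y))%:E <= (M * K)%:E)%E.
Proof.
move=> f2 hM; have M0 : 0 <= M by apply: le_trans (hM 0); exact: normc_ge0.
rewrite EFinM -(integral_shifted_profile X) -ge0_integralZl_EFin//.
- apply: ge0_integral_le => Y; first by rewrite lee_fin mulr_ge0 ?profile_ge0 ?normc_ge0.
  by rewrite -EFinM lee_fin mulrC ler_wpM2r ?profile_ge0.
- by move=> Y _; rewrite lee_fin profile_ge0.
- by apply/measurable_EFinP; exact: measurable_shifted_profile.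
Qed.

Lemma kernel_integrable f X : in_L2 f -> cintegrable mu (fun Y => reduced_kernel X Y * S f Y).
Proof.
move=> f2; have [mf sf] := (in_L2P f).1 f2; have mS := cmeasurable_bargmann h mf.
apply: (@cintegrable_le _ _ _ _ _ (fun Y => k (Y - X) * normc (S f Y))).
- exact: (cmeasurable_pair1 X (cmeasurable_kernel_bargmann mf)).
- by apply: measurable_funM; [exact: measurable_shifted_profile|exact: cmeasurable_norm].
- by move=> Y; rewrite normcM ler_wpM2r ?normc_ge0// normc_reduced_kernel.
- apply: (le_lt_trans (kernel_integral_bound X f2 (fun Y => bargmann_bounded h0 Y f2))).
  by rewrite ltry.
Qed.

Lemma normc_kernel_action f X : in_L2 f ->
  ((normc (A f X))%:E <= \int[mu]_Y (k (Y - X) * normc (S f Y))%:E)%E.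
Proof.
move=> f2; apply: (le_trans (normc_cintegral (kernel_integrable X f2))).
apply: ge0_integral_le => Y; rewrite lee_fin ?normc_ge0//.
by rewrite normcM ler_wpM2r ?normc_ge0// normc_reduced_kernel.
Qed.

Lemma kernel_action_bounded f X : in_L2 f -> normc (A f X) <= (fine (sq lam f) + 1) * K.
Proof.
move=> f2; rewrite -lee_fin; apply: (le_trans (normc_kernel_action X f2)).
exact: kernel_integral_bound f2 (fun Y => bargmann_bounded h0 Y f2).
Qed.

Lemma kernel_young (a : V -> R[i]) f (t : R) : 0 < t -> cmeasurable a -> in_L2 f ->
  (\int[mu]_X ((normc (a X))%:E * \int[mu]_Y (k (Y - X) * normc (S f Y))%:E) <=
   (t * K)%:E * sq mu a + (t^-1 * K)%:E * sq mu (S f))%E.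
Proof.
move=> t0 ma f2; have [mf sf] := (in_L2P f).1 f2; have mS := cmeasurable_bargmann h mf.
apply: le_trans (young_bound t0 ma mS mk profile_ge0 Kk).
apply: ge0_integral_le => X.
  rewrite mule_ge0 ?lee_fin ?normc_ge0//; apply: integral_ge0 => Y _.
  by rewrite lee_fin mulr_ge0 ?profile_ge0 ?normc_ge0.
rewrite -ge0_integralZl_EFin ?normc_ge0//.
- rewrite le_eqVlt; apply/orP; left; apply/eqP; apply: eq_integral => Y _.
  by rewrite -EFinM; congr EFin; ring.
- by move=> Y _; rewrite lee_fin mulr_ge0 ?profile_ge0 ?normc_ge0.
- apply/measurable_EFinP; apply: measurable_funM; first exact: measurable_shifted_profile.
  exact: cmeasurable_norm.
Qed.

Definition action_const : R := 2 * ((2 * (K + 1)) * K).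

(** As for the Bessel inequality: Young's inequality on a truncation, and absorption. *)
Lemma sq_kernel_action f : in_L2 f -> (sq mu (A f) <= action_const%:E * sq mu (S f))%E.
Proof.
move=> f2; have [mf sf] := (in_L2P f).1 f2.
have mA := cmeasurable_kernel_action mf.
have bA X := kernel_action_bounded X f2.
have sS := sq_bargmann_lty h0 f2.
have K0 := profile_mass_ge0; have K1 : 0 < K + 1 by rewrite ltr_wpDl.
have Sfin : sq mu (S f) = (fine (sq mu (S f)))%:E by rewrite fineK// ge0_fin_numE ?sq_ge0.
apply: sq_le_of_trunc => // m; set a := trunc m _.
have ma : cmeasurable a := cmeasurable_trunc m mA.
have sa : (sq mu a < +oo)%E := sq_trunc_lty m mA bA.
(* [K + 1] instead of [K], which may vanish. *)
have t0 : 0 < (2 * (K + 1))^-1 by rewrite invr_gt0 mulr_gt0.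
set w := fine _ in Sfin; rewrite Sfin.
have -> : (action_const%:E * w%:E = (2 * (2 * (K + 1) * K * w))%:E)%E.
  by rewrite -EFinM /action_const; congr EFin; ring.
apply: absorb_half => //; first exact: sq_ge0.
have B : (sq mu a <= \int[mu]_X ((normc (a X))%:E * \int[mu]_Y (k (Y - X) * normc (S f Y))%:E))%E.
  apply: ge0_integral_le => X; first by rewrite lee_fin sqr_ge0.
  rewrite expr2 EFinM; apply: lee_wpmul2l; first by rewrite lee_fin normc_ge0.
  apply: le_trans (normc_kernel_action X f2); rewrite lee_fin; exact: trunc_le.
apply: (le_trans B); apply: (le_trans (kernel_young t0 ma f2)).
rewrite Sfin -EFinM invrK; apply: leeD => //.
move: sa (sq_ge0 mu a); case: (sq mu a) => [s| |]// _.
rewrite -!EFinM !lee_fin => s0; rewrite ler_wpM2r//.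
by rewrite mulrC ler_pdivrMr ?mulr_gt0//; lra.
Qed.

Lemma sq_kernel_action_lty f : in_L2 f -> (sq mu (A f) < +oo)%E.
Proof.
move=> f2; apply: (le_lt_trans (sq_kernel_action f2)).
have K0 := profile_mass_ge0.
rewrite lte_mul_pinfty ?(sq_bargmann_lty h0)// lee_fin /action_const !mulr_ge0//.
by rewrite addr_ge0.
Qed.

(** Outside [L^2] the value is arbitrary. *)
Lemma kernel_operator_exists f : exists b, in_L2 f -> in_L2 b /\
  forall g, in_L2 g -> inner b g = cintegral mu (fun X => A f X * conjc (S g X)).
Proof.
have [f2|f2] := pselect (in_L2 f); last by exists f.
have [mf _] := (in_L2P f).1 f2.
have [b hb] := superpose_L2 h0 (cmeasurable_kernel_action mf) (fun X => kernel_action_bounded X f2)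
  (sq_kernel_action_lty f2).
by exists b.
Qed.

Lemma coherent_kernelE f g X Y : in_L2 f -> in_L2 g ->
  inner (coherent_proj h X (fun u => G Y X * coherent_proj h Y f u)) g =
  reduced_kernel X Y * S f Y * conjc (S g X).
Proof.
move=> f2 g2; have [mg sg] := (in_L2P g).1 g2.
have mc (Z : V) := cmeasurable_coherent h Z.
have sc Z : (sq lam (Psi Z) < +oo)%E by rewrite sq_coherent// ltry.
have E : inner (fun u => G Y X * coherent_proj h Y f u) (Psi X) = reduced_kernel X Y * S f Y.
  have i1 := cintegrable_mul_conj (mc Y) (mc X) (sc Y) (sc X).
  transitivity (G Y X * S f Y * inner (Psi Y) (Psi X)).
    rewrite /inner -(cintegralZ _ i1); apply: eq_cintegral => u.
    by rewrite /coherent_proj -/(S f Y) !mulrA.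
  by rewrite /reduced_kernel mulrAC.
have i2 := cintegrable_mul_conj (mc X) mg (sc X) sg.
have i3 := cintegrable_mul_conj mg (mc X) sg (sc X).
rewrite -E /bargmann inner_conj// /inner -(cintegralZ _ i2).
by apply: eq_cintegral => u; rewrite /coherent_proj mulrA.
Qed.

Lemma kernel_pairing_integrable f g : in_L2 f -> in_L2 g ->
  cintegrable (mu \x mu)%E (fun p : V * V => reduced_kernel p.1 p.2 * S f p.2 * conjc (S g p.1)).
Proof.
move=> f2 g2; have [mf sf] := (in_L2P f).1 f2; have [mg sg] := (in_L2P g).1 g2.
have mSg := cmeasurable_bargmann h mg.
apply: cintegrable_prod.
  apply: cmeasurableM; first exact: cmeasurable_kernel_bargmann.
  by apply: cmeasurable_conj; apply: (cmeasurable_comp (@measurable_fst _ _ V V)).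
apply: (@le_lt_trans _ _ (\int[mu]_X ((normc (S g X))%:E * \int[mu]_Y (k (Y - X) * normc (S f Y))%:E))%E).
  apply: ge0_integral_le => X; first by apply: integral_ge0 => Y _; rewrite lee_fin normc_ge0.
  rewrite -ge0_integralZl_EFin ?normc_ge0//.
  - apply: ge0_integral_le => Y; first by rewrite lee_fin normc_ge0.
    rewrite -EFinM lee_fin -[leLHS]/(normc (reduced_kernel X Y * S f Y * conjc (S g X))).
    rewrite normc_mul_conj normcM mulrC ler_wpM2l ?normc_ge0//.
    by rewrite ler_wpM2r ?normc_ge0// normc_reduced_kernel.
  - by move=> Y _; rewrite lee_fin mulr_ge0 ?profile_ge0 ?normc_ge0.
  - apply/measurable_EFinP; apply: measurable_funM; first exact: measurable_shifted_profile.
    by apply: cmeasurable_norm; exact: cmeasurable_bargmann.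
apply: (le_lt_trans (kernel_young (@ltr01 R) mSg f2)).
have K0 := profile_mass_ge0.
rewrite invr1 !mul1r lte_add_pinfty// lte_mul_pinfty// ?lee_fin//; exact: sq_bargmann_lty.
Qed.

Lemma kernel_operator_weak (B : (U -> R[i]) -> (U -> R[i])) :
  (forall f g, in_L2 f -> in_L2 g -> inner (B f) g = cintegral mu (fun X => A f X * conjc (S g X))) ->
  is_weak_integral (mu \x mu)%E (fun (p : V * V) f => coherent_proj h p.1 (fun u =>
     G p.2 p.1 * coherent_proj h p.2 f u)) B.
Proof.
move=> hB f g f2 g2.
have E : (fun p : V * V => inner (coherent_proj h p.1 (fun u => G p.2 p.1 * coherent_proj h p.2 f u)) g) =
    fun p => reduced_kernel p.1 p.2 * S f p.2 * conjc (S g p.1).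
  by apply/funext => p; exact: coherent_kernelE.
have i := kernel_pairing_integrable f2 g2.
split; first by rewrite E.
rewrite hB// E -cfubini1//; apply: eq_cintegral => X.
rewrite /kernel_action mulrC -cintegralZ; last exact: kernel_integrable.
by apply: eq_cintegral => Y; rewrite mulrC.
Qed.

Lemma bargmann_lincomb (a b : R[i]) f g X : in_L2 f -> in_L2 g ->
  S (fun u => a * f u + b * g u) X = a * S f X + b * S g X.
Proof. by move=> f2 g2; apply: inner_lincomb => //; exact: coherent_in_L2. Qed.

Lemma kernel_action_lincomb (a b : R[i]) f g X : in_L2 f -> in_L2 g ->
  A (fun u => a * f u + b * g u) X = a * A f X + b * A g X.
Proof.
move=> f2 g2; have i1 := kernel_integrable X f2; have i2 := kernel_integrable X g2.
rewrite /kernel_action -(cintegralZ a i1) -(cintegralZ b i2) -cintegralD; try exact: cintegrableZ.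
by apply: eq_cintegral => Y; rewrite bargmann_lincomb//; ring.
Qed.

(** The images are only determined by their scalar products, hence almost everywhere. The norm bound
   tests the image against itself and absorbs the resulting term. *)
Theorem kernel_operator_bounded (B : (U -> R[i]) -> (U -> R[i])) :
  (forall f, in_L2 f -> in_L2 (B f)) ->
  (forall f g, in_L2 f -> in_L2 g -> inner (B f) g = cintegral mu (fun X => A f X * conjc (S g X))) ->
  (forall (a b : R[i]) f g, in_L2 f -> in_L2 g ->
     {ae lam, forall u, B (fun v => a * f v + b * g v) u = a * B f u + b * B g u}) /\
  (exists2 C : R, 0 <= C & forall f, in_L2 f -> (sq lam (B f) <= C%:E * sq lam f)%E).
Proof.
move=> B2 hB; split.
  move=> a b f g f2 g2; pose fg v := a * f v + b * g v.
  have fg2 : in_L2 fg by exact: in_L2_lincomb.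
  pose D u := 1 * B fg u + (-1) * (a * B f u + b * B g u).
  have Bfg2 : in_L2 (fun u => a * B f u + b * B g u) by apply: in_L2_lincomb; exact: B2.
  have D2 : in_L2 D by apply: in_L2_lincomb => //; exact: B2.
  have Dk l : in_L2 l -> inner D l = 0.
    move=> l2; have [ml sl] := (in_L2P l).1 l2.
    have sSl := sq_bargmann_lty h0 l2; have mSl := cmeasurable_bargmann h ml.
    rewrite inner_lincomb ?inner_lincomb//; try exact: B2.
    rewrite !hB// mul1r mulN1r.
    have ci f' : in_L2 f' -> cintegrable mu (fun X => A f' X * conjc (S l X)).
      move=> f'2; have [mf' _] := (in_L2P f').1 f'2.
      by apply: cintegrable_mul_conj => //; [exact: cmeasurable_kernel_action|exact: sq_kernel_action_lty].
    rewrite -(cintegralZ a (ci f f2)) -(cintegralZ b (ci g g2)) -cintegralD; try by apply: cintegrableZ; exact: ci.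
    apply/eqP; rewrite subr_eq0; apply/eqP; apply: eq_cintegral => X.
    by rewrite kernel_action_lincomb// mulrDl !mulrA.
  move: (inner_nondegenerate D2 Dk); apply: filterS => u.
  by rewrite /D mul1r mulN1r => /eqP; rewrite subr_eq0 => /eqP.
have C0 : 0 < Ck := overlap_mass_gt0 h0.
have K0 := profile_mass_ge0.
have ac0 : 0 <= action_const by rewrite /action_const !mulr_ge0// addr_ge0.
pose L := 16 * Ck * (action_const * (8 * Ck)).
have L0 : 0 <= L by rewrite /L mulr_ge0 ?(mulr_ge0 _ (ltW C0))// (mulr_ge0 ac0)// mulr_ge0// ltW.
exists (2 * L); first by rewrite mulr_ge0.
move=> f f2; have [mf sf] := (in_L2P f).1 f2.
have [mBf sBf] := (in_L2P _).1 (B2 f f2).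
have ffin : sq lam f = (fine (sq lam f))%:E by rewrite fineK// ge0_fin_numE ?sq_ge0.
have sSB := sq_bargmann_lty h0 (B2 f f2).
have mSB := cmeasurable_bargmann h mBf.
have mA := cmeasurable_kernel_action mf; have sA := sq_kernel_action_lty f2.
(* The weight for which the Bessel bound [8 Ck] becomes one half. *)
have t0 : 0 < 16 * Ck by rewrite mulr_gt0.
rewrite ffin -EFinM -(mulrA 2); apply: absorb_half => //; first exact: sq_ge0.
rewrite -{1}cintegral_mul_conj_self// -/(inner _ _) hB//; last exact: B2.
apply: (le_trans (normc_cintegral_mul_conj t0 mA mSB sA sSB)).
rewrite addeC; apply: leeD.
  have H := bessel h0 (B2 f f2).
  apply: (@le_trans _ _ (((16 * Ck)^-1)%:E * ((8 * Ck)%:E * sq lam (B f)))%E).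
    by apply: lee_wpmul2l => //; rewrite lee_fin invr_ge0 ltW.
  rewrite muleA -EFinM (_ : _ * _ = 2^-1)//; field.
  by rewrite gt_eqF.
apply: (@le_trans _ _ ((16 * Ck)%:E * (action_const%:E * ((8 * Ck)%:E * sq lam f)))%E).
  apply: lee_wpmul2l; first by rewrite lee_fin ltW.
  apply: (le_trans (sq_kernel_action f2)); apply: lee_wpmul2l; first by rewrite lee_fin.
  exact: bessel.
by rewrite ffin -!EFinM /= lee_fin /L !mulrA.
Qed.

End operator.

(** * The Weyl operator *)

Section weyl_operator.
Context {R : realType} {n : nat}.
Local Notation U := 'rV[R]_n.
Local Notation V := 'rV[R]_(n + n).
Local Notation mu := (lebesgue_rV (n + n)).
Variables (h : R) (F : (V -> R[i]) -> R[i]).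
Hypothesis h0 : 0 < h.
Hypothesis tF : tempered F.

Lemma cmeasurable_weyl_ext : cmeasurable (fun p : V * V => weyl_ext h F p.2 p.1).
Proof.
have [c1 c2] := real_analytic_continuous (weyl_ext_analytic h0 tF).
have mE : cmeasurable (on_pairs (weyl_ext h F)) by exact: ccontinuous_cmeasurable.
have mr : measurable_fun setT (fun p : V * V => row_mx p.2 p.1).
  by apply: measurable_row_mx; [exact: measurable_snd|exact: measurable_fst].
have [m1 m2] := cmeasurable_comp mr mE.
by split; [move: m1|move: m2]; congr measurable_fun; apply/funext => p;
  rewrite /on_pairs row_mxKl row_mxKr.
Qed.

Lemma integrable_mass (k : V -> R) : in_L1_Linfty k ->
  exists K : R, (\int[mu]_v (k v)%:E = K%:E)%E.
Proof.
move=> [/Lfun1_integrable ik _]; exists (fine (\int[mu]_v (k v)%:E)%E).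
by rewrite fineK//; exact: integrable_fin_num ik.
Qed.

Lemma weyl_operator_bounded (psi : V -> R) : in_L1_Linfty psi -> V_weyl_bound h F psi ->
  exists A : (U -> R[i]) -> (U -> R[i]), is_weyl_operator h F A /\ bounded_operator A.
Proof.
move=> ipsi bpsi.
pose k v := psi (half_symp v).
have ik : in_L1_Linfty k by exact: in_L1_Linfty_half_symp.
have [mk _] := (in_L1_LinftyP k).1 ik.
have [K Kk] := integrable_mass ik.
have bG : forall X Y, normc (weyl_ext h F X Y) <= expR ((4 * h)^-1 * sqnorm (X - Y)) * k (X - Y).
  exact: weyl_ext_bound.
have mG := cmeasurable_weyl_ext.
have [B hB] := choice (kernel_operator_exists h0 mG mk Kk bG).
have B2 f : in_L2 f -> in_L2 (B f) by move=> /hB[].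
have Bi f g : in_L2 f -> in_L2 g -> inner (B f) g =
    cintegral mu (fun X => kernel_action h (weyl_ext h F) f X * conjc (bargmann h g X)).
  by move=> /hB[_]; apply.
have E := sesqui_ext_unique (weyl_ext_sesqui h0 tF).
pose c : R[i] := ((2 * pi * h) ^- (2 * n))%:C.
exists (fun f u => c * B f u); split.
  exists B => //; rewrite E; exact: (kernel_operator_weak h0 mG mk Kk bG Bi).
have [lin [C C0 bd]] := kernel_operator_bounded h0 mG mk Kk bG B2 Bi.
split.
  move=> a b f g f2 g2; move: (lin a b f g f2 g2); apply: filterS => u ->.
  by rewrite mulrDr !(mulrCA c).
exists (Num.sqrt (normc c ^+ 2 * C)) => f f2.
have [mB sB] := (in_L2P _).1 (B2 f f2).
have s2 : (sq (lebesgue_rV n) (fun u => c * B f u)%R <= (normc c ^+ 2 * C)%:E * sq (lebesgue_rV n) f)%E.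
  rewrite sqZ// (EFinM (normc c ^+ 2) C) -muleA; apply: lee_wpmul2l; first by rewrite lee_fin sqr_ge0.
  exact: bd.
split; last by apply: L2norm_le => //; rewrite mulr_ge0// sqr_ge0.
apply/in_L2P; split; first exact: cmeasurableZ.
by rewrite sqZ// lte_mul_pinfty// lee_fin sqr_ge0.
Qed.

End weyl_operator.

Theorem theorem2p13 (R : realType) (n : nat) (hn : (0 < n)%N) (h : R)
    (hh : 0 < h) :
  (exists C : R, 0 < C /\
     forall F : ('rV[R]_(n + n) -> R[i]) -> R[i], S_W h F ->
       Dh h (dconv F (nu_weyl_density h)) /\
       forall psi : 'rV[R]_(n + n) -> R,
         in_L1_Linfty psi -> V_weyl_bound h F psi ->
         (Dh_norm h (dconv F (nu_weyl_density h))
          <= C%:E * L1_Linfty_norm (fun Y => (psi Y)%:E))%E) /\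
  (forall F : ('rV[R]_(n + n) -> R[i]) -> R[i], S_W h F ->
     exists A : ('rV[R]_n -> R[i]) -> ('rV[R]_n -> R[i]),
       is_weyl_operator h F A /\ bounded_operator A).
Proof.
split.
  exists (2 ^+ (n + n)); split; first by rewrite exprn_gt0.
  move=> F [tF [_ [psi [ipsi bpsi]]]]; split; first exact: weyl_ext_Dh bpsi ipsi.
  by move=> psi' ipsi' bpsi'; exact: Dh_norm_bound.
by move=> F [tF [_ [psi [ipsi bpsi]]]]; exact: weyl_operator_bounded bpsi.
Qed.
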